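(* Let $G$ be a finite $2$-Frobenius group. If $G$ is either character-quadratic or semi-rational then, letting $F$ be the Fitting subgroup of $G$, we have $\pi(F)\subseteq\{2,3\}$ and one of the following holds. (a) $G/F\cong C_3\rtimes C_2$. In this case $F$ is a $2$-group, and $\Gamma_{\mathrm{GK}}(G)$ is $(2\quad 3)$. (b) $G/F\cong C_5\rtimes C_2$ and $3$ divides $|F|$. In this case $\Gamma_{\mathrm{GK}}(G)$ is $(2-3\quad 5)$. (c) $G/F\cong C_5\rtimes C_2$ and $F$ is a $2$-group. In this case $\Gamma_{\mathrm{GK}}(G)$ is $(2\quad 5)$. (d) $G/F\cong C_5\rtimes C_4$. In this case $F$ is a $2$-group, and $\Gamma_{\mathrm{GK}}(G)$ is $(2\quad 5)$. (e) $G/F\cong C_7\rtimes C_3$ and $2$ divides $|F|$. In this case $\Gamma_{\mathrm{GK}}(G)$ is $(2-3\quad 7)$. (f) $G/F\cong C_7\rtimes C_3$ and $F$ is a $3$-group. In this case $\Gamma_{\mathrm{GK}}(G)$ is $(3\quad 7)$. (g) $G/F\cong C_7\rtimes C_6$. In this case $\Gamma_{\mathrm{GK}}(G)$ is $(2-3\quad 7)$. (h) $G/F\cong C_{13}\rtimes C_6$. In this case $\Gamma_{\mathrm{GK}}(G)$ is $(2-3\quad 13)$.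
   Context: All groups are finite. $\pi(X)$ is the set of prime divisors of $|X|$. $C_n$ denotes a cyclic group of order $n$, and $C_n\rtimes C_m$ here denotes a Frobenius group with kernel $C_n$ and complement $C_m$. A group $G$ is a $2$-Frobenius group if it has two normal subgroups $N\le K$ such that $K$ is a Frobenius group with kernel $N$, and $G/N$ is a Frobenius group with kernel $K/N$ (in this situation $N$ is the Fitting subgroup of $G$). The Gruenberg-Kegel graph $\Gamma_{\mathrm{GK}}(G)$ is the simple undirected graph with vertex set $\pi(G)$, two distinct vertices $p,q$ being adjacent if and only if $G$ contains an element of order $pq$. The notation $(p\quad q)$ denotes the graph with vertices $p,q$ and no edges; $(p-q\quad r)$ denotes the graph with vertices $p,q,r$ and the single edge joining $p$ and $q$. For $\chi\in\mathrm{Irr}(G)$ (the set of complex irreducible characters of $G$), $\mathbb{Q}(\chi)=\mathbb{Q}(\chi(g)\mid g\in G)$; for $x\in G$, $\mathbb{Q}(x)=\mathbb{Q}(\psi(x)\mid \psi\in\mathrm{Irr}(G))$. $G$ is semi-rational if $[\mathbb{Q}(x):\mathbb{Q}]\le 2$ for every $x\in G$ (equivalently, for every $x\in G$ the generators of $\langle x\rangle$ lie in at most two conjugacy classes of $G$). $G$ is character-quadratic if $[\mathbb{Q}(\chi):\mathbb{Q}]\le 2$ for every $\chi\in\mathrm{Irr}(G)$. *)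

(* Defs.v *)
From mathcomp Require Import all_boot all_order all_algebra all_fingroup.
From mathcomp Require Import all_solvable all_field all_character.

Set Implicit Arguments.
Unset Strict Implicit.
Unset Printing Implicit Defensive.

Import GroupScope.

(* [Q(s) : Q] for a finite sequence s of algebraic numbers.  The type
   projT1 (num_field_exists s) is an abstract copy of Q(s): it comes with an
   embedding into algC and with preimages of the items of s that generate the
   whole of it over the rationals. *)
Definition Qdegree (s : seq algC) : nat :=
  \dim {: projT1 (num_field_exists s)}.

Section Definitions.

Variables (gT : finGroupType) (G : {group gT}).

Definition character_quadratic : Prop :=
  forall i : Iirr G, Qdegree [seq ('chi_i g)%R | g in G] <= 2.

Definition semi_rational : Prop :=
  forall x, x \in G -> Qdegree [seq ('chi[G]_i x)%R | i : Iirr G] <= 2.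

Definition two_Frobenius : Prop :=
  exists N K : {group gT},
    [/\ N <| G, K <| G, N \subset K,
        [Frobenius K with kernel N] & [Frobenius G / N with kernel K / N]].

(* G is isomorphic to C_n ><| C_m, understood as a Frobenius group with
   cyclic kernel of order n and cyclic complement of order m. *)
Definition Frobenius_cyclic (n m : nat) : Prop :=
  exists K H : {group gT},
    [/\ [Frobenius G = K ><| H], cyclic K, #|K| = n, cyclic H & #|H| = m].

(* Adjacency in the Gruenberg-Kegel graph, whose vertex set is \pi(G). *)
Definition GK_adj (p q : nat) : Prop :=
  [/\ p \in \pi(G), q \in \pi(G), p <> q
    & exists2 x, x \in G & #[x] = (p * q)%N].

(* Equality of labelled graphs: the Gruenberg-Kegel graph of G has vertices V
   and, as undirected edges, the pairs listed in E. *)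
Definition GK_graph_is (V : seq nat) (E : seq (nat * nat)) : Prop :=
  (forall p, p \in \pi(G) <-> p \in V) /\
  (forall p q, GK_adj p q <-> (p, q) \in E \/ (q, p) \in E).

End Definitions.

(* Main.v *)
Require Import Defs.
From mathcomp Require Import all_boot all_order all_algebra all_fingroup.
From mathcomp Require Import all_solvable all_field all_character.
From mathcomp Require Import zify ring.

(** A 2-Frobenius group G with normal subgroups N and K splits over N: by the
    Frattini argument G = N ><| A, where A is the normaliser of a complement R of
    N in K, and A = R ><| H is a Frobenius group isomorphic to G / N.  The
    nilpotence of Frobenius kernels, which is Thompson's theorem, makes N and R
    nilpotent; R is a kernel and a complement at the same time, and this leaves
    only cyclic groups of odd order for R.  Thompson's theorem rests on his normal
    p-complement criterion for odd p ([Thompson_p_nilpotent]), which in turn rests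
    on Frobenius' criterion ([Frobenius_p_nilpotent]) and on a lower bound for the
    number of vectors moved by an elementary abelian p-group acting faithfully on
    an abelian p'-group ([abelem_fix_bound]).

    The hypothesis on G says that some fields have at most two embeddings in the
    algebraic numbers.  Applied to the automorphisms that raise roots of unity to
    powers k1 and k2, it gives a statement on conjugacy: for a semi-rational
    group, two of x, x ^+ k1, x ^+ k2 are conjugate; for a character-quadratic
    group, two of the corresponding Galois conjugates of an irreducible character
    of a normal subgroup are conjugate ([quadratic_chars_orbit], by Clifford's
    theorem).  On a normal cyclic subgroup the two properties coincide, since a
    faithful linear character turns the second into the first.  Both pass to
    quotients.  For k1 = k and k2 = k ^ 2 every alternative gives that x, or the
    character, is conjugate to its power k ^ 2.

    In G / N this forces R to have prime order r, H to be cyclic of order 2, 3, 4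
    or 6, and the r - 1 nontrivial elements of R to form at most two orbits of H,
    all regular; hence the six pairs (r, #|H|) of [tower_cases].

    To find the primes p dividing #|N|, replace N by an elementary abelian
    p-quotient.  Let W be N, or its group of linear characters.  For k prime to p,
    every w in W is sent to its power k ^ 2 by some element of A, that is, W is covered by
    eigenspaces.  An eigenspace of a nontrivial element of A has at most the
    square root of #|W| elements, and for a well chosen scalar few elements of A
    are involved; as r divides #|W| - 1, only p = 2 and p = 3 survive
    ([quadratic_action_prime]).

    If #|H| = 4 then p = 3 is excluded as well.  Let y = h w have order 12, with h
    a generator of H and w in N centralised by H.  The exponents 5 and 7 modulo 12
    invert one of h, w and fix the other, and no element of G induces such an
    action; [tower_compl4] does this for classes, and dually for characters.

    In the Gruenberg-Kegel graph r is isolated, because the centraliser of a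
    nontrivial element of R is R.  The primes 2 and 3 are joined when both occur:
    either H is cyclic of order 6, or the prime that does not divide #|H| divides
    #|N|, and then it is the order of an element of N centralised by H, by
    [Frobenius_compl_fix]. *)

Set Implicit Arguments.
Unset Strict Implicit.
Unset Printing Implicit Defensive.

Import GroupScope.

(** * Normal p-complements and Frobenius' criterion *)

Import FiniteModule.

Lemma quotient_TI_injm (gT : finGroupType) (M A : {group gT}) :
    A \subset 'N(M) -> M :&: A = 1 ->
  exists2 f : {morphism A >-> coset_of M},
    'injm f & forall X : {set gT}, X \subset A -> f @* X = X / M.
Proof.
move=> nMA tiMA; exists (restrm_morphism nMA (coset_morphism M)) => [|X sXA].
  by rewrite ker_restrm ker_coset setIC tiMA.
by rewrite morphim_restrm (setIidPr sXA).
Qed.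

Lemma cycle_prime (gT : finGroupType) (R : {group gT}) x :
  prime #|R| -> x \in R^# -> <[x]> = R.
Proof.
move=> pr_R /setD1P[ntx Rx]; apply/eqP; rewrite eqEcard cycle_subG Rx -orderE /=.
by move/(prime_nt_dvdP pr_R): (order_dvdG Rx) => ->; rewrite ?order_eq1.
Qed.

(** A normal p-complement, if there is one, is the largest normal p'-subgroup. *)
Definition p_nilpotent (p : nat) (gT : finGroupType) (G : {set gT}) :=
  p^'.-Hall(G) 'O_p^'(G).

Section PNilpotent.

Variables (gT : finGroupType) (p : nat).
Implicit Types G H M P : {group gT}.

Lemma p_nilpotentS G H : H \subset G -> p_nilpotent p G -> p_nilpotent p H.
Proof.
move=> sHG nilG; have nO := pcore_normal p^' G.
have hallI := setI_normal_Hall nO nilG sHG.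
have nI : 'O_p^'(G) :&: H <| H by rewrite setIC (normalGI sHG).
by rewrite /p_nilpotent (normal_Hall_pcore hallI nI).
Qed.

Lemma nilpotent_p_nilpotent G : nilpotent G -> p_nilpotent p G.
Proof. exact: nilpotent_pcore_Hall. Qed.

Lemma pgroup_p_nilpotent G : p.-group G -> p_nilpotent p G.
Proof. by move/pgroup_nil/nilpotent_p_nilpotent. Qed.

Lemma normal_p_nilpotent_ext G M :
  M <| G -> p.-group (G / M) -> p_nilpotent p M -> p_nilpotent p G.
Proof.
move=> nsMG pGM nilM.
have nsOG : 'O_p^'(M) <| G := char_normal_trans (pcore_char _ _) nsMG.
have hallO : p^'.-Hall(G) 'O_p^'(M).
  rewrite pHallE (normal_sub nsOG) /=.
  rewrite -(Lagrange (normal_sub nsMG)) partnM ?cardG_gt0 ?indexg_gt0 //.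
  rewrite (card_Hall nilM) -card_quotient ?normal_norm //.
  by rewrite [(#|G / M|`_(p^'))%N]part_p'nat ?muln1 // pnatNK.
by rewrite /p_nilpotent (normal_Hall_pcore hallO nsOG).
Qed.

Lemma p_nilpotent_quo_p' G M :
  M <| G -> p^'.-group M -> p_nilpotent p (G / M) -> p_nilpotent p G.
Proof.
move=> nsMG p'M nilGM.
have := pcore_normal p^' (G / M); case/(inv_quotientN nsMG) => O defO sMO nsOG.
have hallO : p^'.-Hall(G) O.
  have nMO := normalS sMO (normal_sub nsOG) nsMG.
  rewrite pHallE (normal_sub nsOG) /=.
  rewrite -(Lagrange (normal_sub nsMG)) -(Lagrange sMO).
  rewrite partnM ?cardG_gt0 ?indexg_gt0 //.
  rewrite -!card_quotient ?normal_norm // -defO (card_Hall nilGM).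
  by rewrite [(#|M|`_(p^'))%N]part_pnat_id.
by rewrite /p_nilpotent (normal_Hall_pcore hallO nsOG).
Qed.

End PNilpotent.

Lemma morphim_p_nilpotent (aT rT : finGroupType) (D G : {group aT})
    (f : {morphism D >-> rT}) p :
  G \subset D -> p_nilpotent p G -> p_nilpotent p (f @* G).
Proof.
move=> sGD nilG; have sOD := subset_trans (pcore_sub p^' G) sGD.
have hallO := morphim_pHall f sOD nilG.
by rewrite /p_nilpotent (normal_Hall_pcore hallO (morphim_normal f (pcore_normal _ _))).
Qed.

Section Frobenius.

Variables (gT : finGroupType) (p : nat).
Implicit Types D G H M P S U : {group gT}.

(** The p-complement of N_G(D) and the normal p-subgroup D of N_G(D) centralise
    each other. *)
Lemma p_nilpotent_norm_mul G D P :
    p.-group D -> p_nilpotent p 'N_G(D) -> p.-Sylow('N_G(D)) P -> D \subset G ->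
  'N_G(D) \subset 'C_G(D) * P.
Proof.
move=> pD nilN sylP sDG.
have nsO := pcore_normal p^' 'N_G(D).
have defN : 'O_p^'('N_G(D)) * P = 'N_G(D).
  rewrite -norm_joinEr; last first.
    exact: subset_trans (pHall_sub sylP) (normal_norm nsO).
  apply/eqP; rewrite eqEcard join_subG (normal_sub nsO) (pHall_sub sylP) /=.
  rewrite norm_joinEr ?(subset_trans (pHall_sub sylP) (normal_norm nsO)) //.
  rewrite coprime_cardMg; last first.
    rewrite coprime_sym.
    exact: pnat_coprime (pHall_pgroup sylP) (pcore_pgroup _ _).
  rewrite (card_Hall sylP) (card_Hall nilN) mulnC.
  by rewrite partnC ?cardG_gt0.
have nsD : D <| 'N_G(D) := normalSG sDG.
have cOD : 'O_p^'('N_G(D)) \subset 'C(D).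
  have tiO : 'O_p^'('N_G(D)) :&: D = 1.
    by rewrite setIC coprime_TIg // (pnat_coprime pD) //; apply: pcore_pgroup.
  apply/commG1P/trivgP; rewrite -tiO commg_subI //.
    by rewrite subsetI subxx (subset_trans (normal_sub nsO)) ?subsetIr.
  by rewrite subsetI subxx (subset_trans (normal_sub nsD) (normal_norm nsO)).
rewrite -{1}defN mulSg // subsetI cOD andbT.
exact: subset_trans (normal_sub nsO) (subsetIl _ _).
Qed.

Lemma p_nilpotent_norm_Sylow_conj G D P S :
    p.-group D -> p_nilpotent p 'N_G(D) ->
    p.-Sylow('N_G(D)) P -> p.-Sylow('N_G(D)) S -> D \subset G ->
  exists2 c, c \in 'C_G(D) & S :=: P :^ c.
Proof.
move=> pD nilN sylP sylS sDG.
have [n Nn ->] := Sylow_trans sylP sylS.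
have: n^-1 \in 'C_G(D) * P.
  by rewrite (subsetP (p_nilpotent_norm_mul pD nilN sylP sDG)) ?groupV.
case/mulsgP=> c x Cc Px def_n; exists c^-1; first by rewrite groupV.
have ->: n = x^-1 * c^-1 by rewrite -invMg -def_n invgK.
by rewrite conjsgM; congr (_ :^ _); rewrite conjGid ?groupV.
Qed.

(** Alperin's fusion argument, by induction on the index of D = P :&: S.  The
    normalisers of D in P and in S contain D properly.  They lie in Sylow subgroups
    of N_G(D) that are conjugate by some c in C_G(D); hence there is a Sylow
    subgroup R such that P and R, as well as R :^ c and S, have an intersection
    larger than D. *)
Lemma Sylow_conj_cent_cap G :
    (forall U, U \subset G -> p.-group U -> U :!=: 1 ->
       p_nilpotent p 'N_G(U)) ->
  forall P S, p.-Sylow(G) P -> p.-Sylow(G) S ->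
  exists2 c, c \in 'C_G(P :&: S) & S :=: P :^ c.
Proof.
move=> locG P S.
have [n] := ubnP (#|G| - #|P :&: S|); elim: n P S => // n IHn P S lt_n sylP sylS.
have sPG := pHall_sub sylP; have sSG := pHall_sub sylS.
have pP := pHall_pgroup sylP; have pS := pHall_pgroup sylS.
have [sPS | not_sPS] := boolP (P \subset S).
  exists 1; rewrite ?group1 // conjsg1; apply/eqP.
  by rewrite eq_sym eqEcard sPS (card_Hall sylP) (card_Hall sylS) /=.
pose D := (P :&: S)%G; have sDP : D \subset P := subsetIl _ _.
have sDS : D \subset S := subsetIr _ _.
have sDG := subset_trans sDP sPG; have pD := pgroupS sDP pP.
have [D1 | ntD] := eqVneq (D : {set gT}) 1.
  have [g Gg defS] := Sylow_trans sylP sylS.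
  by exists g => //; move: D1 => /= ->; rewrite cent1T setIT.
have neqD (T : {group gT}) : p.-Sylow(G) T -> D \subset T -> D \proper T.
  move=> sylT sDT; rewrite properEcard sDT (card_Hall sylT) -(card_Hall sylP).
  rewrite proper_card // properE sDP /=; apply: contra not_sPS => sPD.
  exact: subset_trans sPD sDS.
have pDP := nilpotent_proper_norm (pgroup_nil pP) (neqD P sylP sDP).
have pDS := nilpotent_proper_norm (pgroup_nil pS) (neqD S sylS sDS).
pose N := 'N_G(D)%G.
have sNPN : 'N_P(D) \subset N by rewrite setSI.
have sNSN : 'N_S(D) \subset N by rewrite setSI.
have [T1 sylT1 sNT1] := Sylow_superset sNPN (pgroupS (subsetIl _ _) pP).
have [T2 sylT2 sNT2] := Sylow_superset sNSN (pgroupS (subsetIl _ _) pS).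
have [c Cc defT2] := p_nilpotent_norm_Sylow_conj pD (locG D sDG pD ntD) sylT1 sylT2 sDG.
have sT1G : T1 \subset G := subset_trans (pHall_sub sylT1) (subsetIl _ _).
have [R sylR sT1R] := Sylow_superset sT1G (pHall_pgroup sylT1).
have card_lt (X Y : {group gT}) :
    D \proper X -> X \subset Y -> Y \subset G -> #|G| - #|Y| < n.
  move=> prDX sXY sYG; rewrite -ltnS (leq_trans _ lt_n) // ltnS.
  rewrite ltn_sub2l //.
    apply: (leq_trans (proper_card prDX)).
    by rewrite subset_leq_card // (subset_trans sXY).
  exact: leq_trans (proper_card prDX) (subset_leq_card sXY).
have Gc : c \in G by case/setIP: Cc.
have CGS (X Y : {group gT}) z: D \subset X -> z \in 'C_G(X) -> z \in 'C_G(D).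
  by move=> sDX; apply: subsetP; rewrite setIS ?centS.
have sDNP : D \subset 'N_P(D) by rewrite subsetI sDP normG.
have sDNS : D \subset 'N_S(D) by rewrite subsetI sDS normG.
have sNPR : 'N_P(D) \subset P :&: R.
  by rewrite subsetI subsetIl (subset_trans sNT1).
have [|x Cx defR] := IHn P R _ sylP sylR.
  by apply: (card_lt 'N_P(D)%G (P :&: R)%G); rewrite // subIset ?sPG.
have sylRc : p.-Sylow(G) (R :^ c) by rewrite pHallJ.
have sNSR : 'N_S(D) \subset (R :^ c) :&: S.
  by rewrite subsetI subsetIl (subset_trans sNT2) // defT2 conjSg.
have [|y Cy defS] := IHn (R :^ c)%G S _ sylRc sylS.
  apply: (card_lt 'N_S(D)%G (R :^ c :&: S)%G); rewrite // subIset ?sSG ?orbT //.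
exists (x * c * y); last by rewrite defS /= defR !conjsgM.
rewrite !groupM //.
  by apply: (CGS _ P) Cx; apply: subset_trans sNPR.
by apply: (CGS _ P) Cy; apply: subset_trans sNSR.
Qed.

(** Consider the transfer into P / P'.  When P controls its own fusion, the
    transfer of x in P is the class of x raised to the index of P in G.  This index
    is prime to p, so that the kernel of the transfer does not contain P. *)
Lemma self_fusion_p_quotient G P :
    prime p -> p.-Sylow(G) P -> P :!=: 1 ->
    (forall x g, x \in P -> g \in G -> x ^ g \in P ->
       exists2 u, u \in P & x ^ g = x ^ u) ->
  exists M : {group gT}, [/\ M <| G, ~~ (G \subset M) & p.-group (G / M)].
Proof.
move=> pr_p sylP ntP fusP; have sPG := pHall_sub sylP.
have pP := pHall_pgroup sylP.
pose alpha := [morphism of restrm (der_norm 1 P) (coset P^`(1))].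
have abA : abelian (alpha @* P).
  by rewrite morphim_restrm setIid der_abelian.
pose tau := transfer_morphism G abA.
have expP (z : fmod_of abA) : (z *+ #|P| = 0)%R.
  apply: fmod_inj; rewrite fmvalZ fmval0.
  apply/eqP; rewrite -order_dvdn; apply: dvdn_trans (order_dvdG (fmodP z)) _.
  exact: dvdn_morphim.
exists ('ker tau)%G; split; first exact: ker_normal.
  have prP' : P^`(1) \proper P by rewrite (sol_der1_proper (pgroup_sol pP)).
  have /subsetPn[x Px notP'x] := proper_subn prP'.
  have Gx := subsetP sPG x Px.
  apply: contra notP'x => /subsetP/(_ x Gx)/kerP/= /(_ Gx).
  have partG := rcosets_cycle_partition sPG Gx.
  have trX := transversalP partG.
  rewrite (transfer_cycle_expansion sPG abA Gx trX).
  set X := transversal _ _ in trX *.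
  set n_ := fun y => #|<[x]> : P :* y|.
  have sXG := subsetP (transversal_sub trX).
  have nx y : y \in X -> (x ^+ n_ y) ^ y^-1 \in P.
    move=> Xy; have := mulg_exp_card_rcosets P x y.
    by rewrite mem_rcoset conjgE invgK mulgA.
  have transf y : y \in X ->
     fmod abA (alpha ((x ^+ n_ y) ^ y^-1)) = (fmod abA (alpha x) *+ n_ y)%R.
    move=> Xy.
    have [||u Pu ->] := fusP (x ^+ n_ y) y^-1 _ _ (nx y Xy).
    - exact: groupX.
    - by rewrite groupV sXG.
    have Axn : alpha (x ^+ n_ y) \in alpha @* P by rewrite mem_morphim ?groupX.
    rewrite (morphJ alpha) ?groupX // [_ ^ _]conjgE.
    have Au : alpha u \in alpha @* P by rewrite mem_morphim.
    rewrite (centsP abA _ Axn _ Au) mulKg morphX //.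
    by rewrite fmodX // mem_morphim.
  rewrite (eq_bigr _ transf) GRing.sumrMnr.
  rewrite (sum_index_rcosets_cycle sPG Gx trX) => tx0.
  have Ax : alpha x \in alpha @* P by rewrite mem_morphim.
  have : alpha x = 1.
    have co : coprime #|alpha @* P| #|G : P|.
      apply: coprime_dvdl (dvdn_morphim _ _) _.
      rewrite (pnat_coprime pP) // -(divgS sPG) (card_Hall sylP).
      by rewrite -{1}(partnC p (cardG_gt0 G)) mulKn ?part_gt0 ?part_pnat.
    rewrite -(expgK co Ax).
    have -> : alpha x ^+ #|G : P| = 1; last by rewrite expg1n.
    by rewrite -[alpha x](fmodK abA) // -fmvalZ tx0; apply: fmval0.
  move=> ax1; apply: coset_idr => //.
  exact: subsetP (der_norm 1 P) x Px.
apply/pgroupP=> q pr_q; case/Cauchy=> // y /morphimP[g Ng Gg ->] oq.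
have : g ^+ #|P| \in 'ker tau.
  apply/kerP; first by rewrite groupX.
  by rewrite morphX // FinRing.zmodXgE; apply: expP.
move/coset_id => /=; rewrite morphX // => /eqP; rewrite -order_dvdn oq.
by move/(pgroupP pP q pr_q).
Qed.

(** Frobenius' criterion.  If x and x ^ g lie in P, then P and P :^ g^-1 are
    conjugate by an element centralising x, so x and x ^ g are already conjugate in
    N_G(P), hence in P.  Transfer then gives a proper normal subgroup of p-power
    index. *)
Lemma Frobenius_p_nilpotent G :
    prime p ->
    (forall U, U \subset G -> p.-group U -> U :!=: 1 ->
       p_nilpotent p 'N_G(U)) ->
  p_nilpotent p G.
Proof.
move=> pr_p; have [n] := ubnP #|G|; elim: n G => // n IHn G ltGn locG.
have [P sylP] := Sylow_exists p G.
have sPG := pHall_sub sylP; have pP := pHall_pgroup sylP.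
have [P1 | ntP] := eqVneq (P : {set gT}) 1.
  have p'G : p^'.-group G.
    rewrite -partG_eq1 -(card_Hall sylP) P1 cards1 //.
  by rewrite /p_nilpotent pcore_pgroup_id // pHallE subxx /= part_pnat_id.
have [|M [nsMG not_sGM pGM]] := self_fusion_p_quotient pr_p sylP ntP.
  move=> x g Px Gg Pxg.
  have sylPg : p.-Sylow(G) (P :^ g^-1) by rewrite pHallJ ?groupV.
  have [c Cc defPg] := Sylow_conj_cent_cap locG sylP sylPg.
  have Dx : x \in P :&: P :^ g^-1 by rewrite inE Px mem_conjgV.
  have [Gc cDc] := setIP Cc; have cxc := centP cDc x Dx.
  pose m := c * g.
  have xm : x ^ g = x ^ m by rewrite /m conjgM [x ^ c]conjgE -cxc mulKg.
  have Nm : m \in 'N_G(P).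
    rewrite inE groupM //= inE /m conjsgM -defPg -conjsgM mulVg conjsg1.
    by rewrite subxx.
  have sylP1 : p.-Sylow('N_G(P)) P.
    by apply: pHall_subl sylP; rewrite ?subsetIl // subsetI sPG normG.
  have := p_nilpotent_norm_mul pP (locG P sPG pP ntP) sylP1 sPG.
  case/subsetP/(_ m Nm)/mulsgP => d u /setIP[_ cPd] Pu def_m.
  by exists u; rewrite // xm def_m conjgM [x ^ d]conjgE -(centP cPd x Px) mulKg.
apply: (normal_p_nilpotent_ext nsMG pGM); apply: IHn.
  rewrite -ltnS (leq_trans _ ltGn) // ltnS proper_card //.
  by rewrite properE (normal_sub nsMG).
move=> U sUM pU ntU; apply: p_nilpotentS (locG U _ pU ntU).
  by rewrite setSI // normal_sub.
by rewrite (subset_trans sUM (normal_sub nsMG)).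
Qed.

End Frobenius.

(** * Fixed points of coprime actions *)

Section CoprimeFixedPoints.

Variable gT : finGroupType.
Implicit Types A B E G H K M P Q R V W X : {group gT}.

(** Written additively in V, the sum over all i in J and all b in Bs i of v ^ b
    equals the sum over b in B of v ^ b, plus (#|J| - 1) v.  A sum over the whole of
    Bs i or of B is fixed by that group, hence zero; thus (#|J| - 1) v = 0. *)
Lemma partitioned_fixfree_triv (I : finType) (J : {set I})
    (Bs : I -> {group gT}) B V :
    abelian V -> B \subset 'N(V) -> (forall i, i \in J -> Bs i \subset B) ->
    {in B^#, forall b, #|[set i in J | b \in Bs i]| = 1%N} ->
    (forall i, i \in J -> 'C_V(Bs i) = 1) -> 1 < #|J| -> coprime #|V| #|J|.-1 ->
  V :=: 1.
Proof.
move=> abV nVB sBs partB fixB J1 coV.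
have sum0 (C : {group gT}) v : C \subset 'N(V) -> 'C_V(C) = 1 ->
   (\sum_(c in C) (actr (fmod abV v) c) = 0)%R.
  move=> nVC fixC; apply: fmod_inj; rewrite fmval0; apply/set1P; rewrite -[[set 1]]fixC.
  rewrite inE fmodP; apply/centP=> c Cc; apply/commgP/conjg_fixP.
  rewrite -fmvalJ ?(subsetP nVC) // actr_sum; congr (fmval _).
  rewrite [RHS](reindex_inj (mulIg c)) /=.
  apply: eq_big => [b | b Cb]; first by rewrite groupMr.
  by rewrite actrM ?(subsetP nVC).
have /card_gt0P[i0 Ji0] : 0 < #|J| by apply: ltnW.
have fixBB : 'C_V(B) = 1.
  by apply/trivgP; rewrite -(fixB i0 Ji0) setIS ?centS ?sBs.
apply/trivgP/subsetP=> v Vv; apply/set1P.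
have: (\sum_(i in J) \sum_(b in Bs i) actr (fmod abV v) b = 0)%R.
  by apply: big1 => i Ji; apply: sum0 (fixB i Ji); rewrite (subset_trans (sBs i Ji)).
have -> : (\sum_(i in J) \sum_(b in Bs i) actr (fmod abV v) b
   = \sum_(b in B) actr (fmod abV v) b *+ #|[set i in J | b \in Bs i]|)%R.
  have sumB i : i \in J -> (\sum_(b in Bs i) actr (fmod abV v) b
                = \sum_(b in B) if b \in Bs i then actr (fmod abV v) b else 0)%R.
    move=> Ji; rewrite -big_mkcondr /=; apply: eq_bigl => b.
    by apply/idP/andP=> [Bb | []//]; rewrite (subsetP (sBs i Ji)).
  rewrite (eq_bigr _ sumB) exchange_big /=; apply: eq_bigr => b Bb.
  rewrite -big_mkcondr /= -GRing.sumr_const; apply: eq_bigl => i.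
  by rewrite !inE.
rewrite (bigD1 1) //= actr1.
have -> : [set i in J | 1 \in Bs i] = J.
  by apply/setP=> i; rewrite inE group1 andbT.
rewrite (eq_bigr (fun b => actr (fmod abV v) b)); last first.
  by move=> b /andP[Bb ntb]; rewrite partB ?GRing.mulr1n // !inE ntb.
have := sum0 B v nVB fixBB; rewrite (bigD1 1) //= actr1.
rewrite -[in X in _ -> X -> _](prednK (ltnW J1)) GRing.mulrS.
rewrite GRing.addrAC => -> ; rewrite GRing.add0r => /(congr1 fmval).
rewrite fmvalZ fmodK // => v1.
by rewrite -(expgK coV Vv) v1 expg1n.
Qed.

(** A Frobenius group is partitioned by its kernel R and the #|R| conjugates of its
    complement H. *)
Lemma Frobenius_compl_fix G R H V :
    [Frobenius G = R ><| H] -> abelian V -> G \subset 'N(V) ->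
    coprime #|V| #|R| -> 'C_V(R) = 1 -> 'C_V(H) = 1 ->
  V :=: 1.
Proof.
move=> frobG abV nVG coVR fixR fixH.
have [defG ntR ntH ltRG ltHG] := Frobenius_context frobG.
have [_ mulRH nRH tiRH] := sdprodP defG.
have [sRG sHG] := mulG_sub mulRH.
(* None stands for R, and Some y for the conjugate of H by y. *)
pose Bs (i : option gT) := if i is Some y then (H :^ y)%G else R.
pose J := None |: Some @: R.
have cardJ : #|J| = #|R|.+1.
  rewrite cardsU1 card_imset //; last by move=> x y [].
  by case: imsetP => // [[]].
apply: (@partitioned_fixfree_triv _ J Bs G V) => //.
- move=> i; rewrite !inE => /orP[/eqP-> // | /imsetP[y Ry ->]].
  by rewrite conj_subG // (subsetP sRG).
- move=> g /setD1P[ntg Gg]; apply/eqP/cards1P.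
  have [_ /normedTI_P[_ _ tiH]] := andP (FrobeniusWcompl frobG).
  have tiRHy y : y \in R -> g \in R -> g \notin H :^ y.
    move=> Ry Rg; apply: contra ntg => Hyg.
    have: g \in R :&: H :^ y by rewrite inE Rg.
    by rewrite -{1}(conjGid Ry) -conjIg tiRH conjs1g => /set1P->.
  have [Rg | notRg] := boolP (g \in R).
    exists None; apply/setP=> i; rewrite !inE.
    case: i => [y|] /=; last by rewrite Rg eqxx.
    by apply/andP=> [[/imsetP[z Rz [->]]]]; apply/negP; apply: tiRHy.
  have: g \in cover (gval R |: (H^# :^: R)).
    by rewrite (cover_partition (Frobenius_partition frobG)).
  case/bigcupP=> _ /setU1P[-> | /imsetP[y Ry ->]]; first by rewrite (negPf notRg).
  rewrite conjD1g => /setD1P[_ Hyg].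
  exists (Some y); apply/setP=> i; rewrite !inE.
  case: i => [z|] /=; last by rewrite (negPf notRg).
  rewrite mem_imset; last by move=> ? ? [].
  apply/andP/eqP=> [[Rz Hzg] | [->]] //.
  congr Some; apply/eqP; rewrite eq_mulgV1 -in_set1 -[[set 1]]tiRH inE groupM ?groupV //=.
  apply: tiH; first by rewrite (subsetP sRG) ?groupM ?groupV.
  rewrite -setI_eq0; apply/set0Pn; exists (g ^ y^-1).
  rewrite inE conjsgM memJ_conjg conjD1g !inE conjg_eq1 ntg -mem_conjg.
  by rewrite Hyg Hzg.
- move=> i; rewrite !inE => /orP[/eqP-> // | /imsetP[y Ry ->]].
  have /normP nVy : y \in 'N(V) by rewrite (subsetP nVG) ?(subsetP sRG).
  by rewrite -{1}nVy centJ -conjIg fixH conjs1g.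
- by rewrite cardJ ltnS cardG_gt0.
by rewrite cardJ.
Qed.

(** Take K maximal among the subgroups of M with a nontrivial fixed vector, and a
    complement E of K in M, which then acts freely on C_V(K).  A subgroup of E of
    order q ^ 2 would be partitioned by q + 1 subgroups of order q, each without
    fixed vectors. *)
Lemma abelem_coprime_fix_maximal q M V :
    q.-abelem M -> prime q -> abelian V -> q^'.-group V -> M \subset 'N(V) ->
    V :!=: 1 -> 'C_V(M) = 1 ->
  exists K : {group gT}, [/\ K \subset M, #|M : K| = q & 'C_V(K) != 1].
Proof.
move=> abelM pr_q abV q'V nVM ntV fixM.
have: [exists K : {group gT}, (K \subset M) && ('C_V(K) != 1)].
  by apply/existsP; exists 1%G; rewrite sub1G cent1T setIT.
pose P (K : {group gT}) := (K \subset M) && ('C_V(K) != 1).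
case/existsP=> K0 PK0; have [K /maxgroupP[/andP[sKM ntVK] maxK] _] := maxgroup_exists (PK0 : P K0).
exists K; suffices: #|M : K| = q by split.
have /splitsP[E compE] := abelem_splits abelM sKM.
have /complP[tiKE defM] := compE.
have sEM : E \subset M by rewrite -defM mulG_subr.
have abelE := abelemS sEM abelM.
have oE : #|M : K| = #|E| by rewrite -(divgS sKM) -defM (TI_cardMg tiKE) mulKn.
rewrite oE.
have ltVK (X : {group gT}) : X \subset E -> X :!=: 1 -> 'C_('C_V(K))(X) = 1.
  move=> sXE ntX; apply/eqP; apply: contraR ntX => ntX.
  have PX : P (K <*> X)%G.
    by rewrite /P join_subG sKM (subset_trans sXE) //= centY setIA.
  have defK := maxK _ PX (joing_subl K X).
  rewrite -subG1 -tiKE subsetI sXE andbT -[gval K]defK joing_subr //.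
have ntE : E :!=: 1.
  apply: contraNneq ntVK => E1; move: defM; rewrite E1 mulg1 => ->.
  by rewrite fixM.
have [n1 | n2] := leqP (logn q #|E|) 1.
  have := card_pgroup (abelem_pgroup abelE); move: n1.
  case: (logn q #|E|) => [_ | [|//] _ ->]; last by rewrite expn1.
  by move/eqP; rewrite expn0 -trivg_card1 (negPf ntE).
have /p_rank_geP[F EF] : 2 <= 'r_q(E) by rewrite p_rank_abelem.
have /pnElemP[sFE abelF oF] := EF.
case/eqP: ntVK.
apply: (@partitioned_fixfree_triv _ 'E_q^1(F) id F 'C_V(K)%G) => //=.
- exact: abelianS (subsetIl _ _) abV.
- have sFM := subset_trans sFE sEM.
  rewrite normsI ?(subset_trans sFM nVM) // norms_cent // cents_norm //.
  exact: sub_abelian_cent2 (abelem_abelian abelM) _ _.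
- by move=> X /pnElemP[].
- move=> x /setD1P[ntx Fx]; apply/eqP/cards1P; exists <[x]>%G.
  have ox : #[x] = q := abelem_order_p abelF Fx ntx.
  apply/setP=> X; rewrite inE in_set1; apply/andP/eqP=> [[] | ->].
    case/pnElemP=> sXF abX oX Xx; apply/val_inj/eqP; rewrite /= eq_sym.
    rewrite eqEcard cycle_subG Xx -orderE ox.
    by rewrite (card_pgroup (abelem_pgroup abX)) oX expn1 leqnn.
  split; last exact: cycle_id.
  apply/pnElemP; rewrite /= cycle_subG; split=> //; last by rewrite -orderE ox logn_prime ?eqxx.
  by rewrite (abelemS _ abelF) ?cycle_subG.
- move=> X /pnElemP[sXF _ oX]; apply: ltVK; first exact: subset_trans sFE.
  by rewrite -cardG_gt1 -(part_pnat_id (pgroupS sXF (abelem_pgroup abelF))) p_part oX expn1 prime_gt1.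
- by rewrite (card_p1Elem_p2Elem EF) ltnS prime_gt0.
rewrite (card_p1Elem_p2Elem EF) /=.
apply: (@p'nat_coprime q); last exact: pnat_id.
exact: pgroupS (subsetIl _ _) q'V.
Qed.

Lemma pgroup_cent_triv (p : nat) B W :
  p.-group W -> p.-group B -> B \subset 'N(W) -> 'C_W(B) = 1 -> W :=: 1.
Proof.
move=> pW pB nWB fixB; have [// | ntW] := eqVneq (gval W) 1.
have [pr_p p_dv_W _] := pgroup_pdiv pW ntW.
have := pgroup_fix_mod pB (_ : [acts B, on W | 'J]); rewrite astabsJ => /(_ nWB).
rewrite afixJ fixB cards1 (eqP p_dv_W) modn_small ?prime_gt1 //.
Qed.

(** By the coprime decomposition V = [V, C] x C_V(C), the B-fixed vectors of
    [V, C] are trivial; but a p-group B acting on a nontrivial p-group has nontrivial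
    fixed points. *)
Lemma coprime_cent_fix_faithful (p : nat) B C V :
    (C : {group gT}) \subset 'N(V) -> B \subset 'N(V) -> B \subset 'C(C) ->
    p.-group V -> abelian V -> p.-group B -> p^'.-group C ->
    C \subset 'C('C_V(B)) -> C \subset 'C(V).
Proof.
move=> nVC nVB cBC pV abV pB p'C cVC.
have nVCB : B \subset 'N([~: V, C]) := normsR nVB (cents_norm cBC).
have sVCV : [~: V, C] \subset V by rewrite commg_subl.
have coVC : coprime #|V| #|C| := pnat_coprime pV p'C.
apply/commG1P; rewrite commGC.
apply: (pgroup_cent_triv (pgroupS sVCV pV) pB nVCB).
apply/eqP; rewrite -subG1 -(coprime_abel_cent_TI nVC coVC abV) subsetI subsetIl /=.
by rewrite centsC (subset_trans cVC) // centS // setSI.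
Qed.

(** The inequality of indices #|X1 : 'C_X1[a]| <= #|X : 'C_X[a]|, without division. *)
Lemma indexS_fix a X X1 : X1 \subset X ->
  #|'C_X[a]| * #|X1| <= #|X| * #|'C_X1[a]|.
Proof.
move=> sX1X; have <- : X1 :&: 'C_X[a] = 'C_X1[a].
  by rewrite setIA (setIidPl sX1X).
rewrite [X1 :&: _]setIC mul_cardG leq_mul2r subset_leq_card ?orbT //.
by rewrite mul_subG // subsetIl.
Qed.

(** The inequality says that a is not a transvection on X.  Let M be a minimal
    <[a]>-invariant subgroup of [Q, a], of exponent q, and X1 = [X, M].  Some K of
    index q in M has a nontrivial fixed vector in X1.  If a normalises K, then K = 1,
    M has order q and the group <[a]> acts freely on it, so p < q; were a to fix a
    subgroup of index at most p in X1, two M-conjugates of this subgroup would meet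
    trivially, #|X1| would divide p ^ 2, and q would divide p ^ 2 - 1, which is
    impossible for odd p.  Otherwise K and its conjugates by a and a ^+ 2 generate M
    pairwise, so that Y = C_X1(K) has the property that Y * Y :^ a is a direct
    product without nontrivial a-fixed vectors, of order at least p ^ 2. *)
Lemma coprime_abelian_fix_bound p a Q X :
    prime p -> odd p -> #[a] = p -> abelian Q -> p^'.-group Q ->
    abelian X -> p.-group X -> a \in 'N(Q) -> a \in 'N(X) -> Q \subset 'N(X) ->
    'C_Q(X) = 1 -> ~~ (a \in 'C(Q)) ->
  p * #|'C_X[a]| < #|X|.
Proof.
move=> pr_p odd_p oa abQ p'Q abX pX nQa nXa nXQ fQX ncQa.
pose A := <[a]>%G; have pA : p.-group A by rewrite /pgroup -orderE oa pnat_id.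
have nQA : A \subset 'N(Q) by rewrite cycle_subG.
have nXA : A \subset 'N(X) by rewrite cycle_subG.
have coQA : coprime #|Q| #|A| by rewrite coprime_sym (pnat_coprime pA).
have ntQA : [~: Q, A] != 1.
  by apply: contra ncQa => /eqP/commG1P; rewrite centsC cycle_subG.
have [|M minM sMQA] := minnormal_exists ntQA (G := A).
  by rewrite normsR ?normG.
have sMQ : M \subset Q by rewrite (subset_trans sMQA) ?commg_subl.
have [nMA ntM abelM] := minnormal_solvable minM sMQ (abelian_sol abQ).
have [_ minM'] := mingroupP minM.
have fixMA : 'C_M(A) = 1.
  by apply/trivgP; rewrite -(coprime_abel_cent_TI nQA coQA abQ) setSI.
have abM := abelianS sMQ abQ; have p'M := pgroupS sMQ p'Q.
have /is_abelemP[q pr_q abelqM] := abelM.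
have qM := abelem_pgroup abelqM.
have oMq : q != p.
  have [_ q_dv _] := pgroup_pdiv qM ntM.
  by have := pgroupP p'M q pr_q q_dv; rewrite !inE.
have nXM := subset_trans sMQ nXQ.
have coXM : coprime #|X| #|M| := pnat_coprime pX p'M.
pose X1 := [~: X, M]%G.
have sX1X : X1 \subset X by rewrite commg_subl.
have nX1M : M \subset 'N(X1) by rewrite normsR ?normG.
have nX1A : A \subset 'N(X1) by rewrite normsR.
have fixX1M : 'C_X1(M) = 1 := coprime_abel_cent_TI nXM coXM abX.
have abX1 := abelianS sX1X abX; have pX1 := pgroupS sX1X pX.
have ntX1 : X1 :!=: 1.
  apply: contra ntM => /eqP/commG1P; rewrite centsC => cXM.
  by rewrite -subG1 -fQX subsetI sMQ.
suffices lt1 : p * #|'C_X1[a]| < #|X1|.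
  rewrite -(ltn_pmul2r (cardG_gt0 'C_X1[a])).
  apply: leq_trans (indexS_fix a sX1X).
  by rewrite mulnAC [X in _ < X]mulnC ltn_pmul2r ?cardG_gt0.
have q'X1 : q^'.-group X1.
  by apply: sub_in_pnat pX1 => r _ /=; rewrite !inE => /eqP->; rewrite eq_sym.
have cYM (K : {group gT}) : K \subset M -> M \subset 'N('C_X1(K)).
  move=> sKM; rewrite normsI // norms_cent // cents_norm //.
  exact: sub_abelian_cent2 abM _ _.
have p2_le (Y : {group gT}) : Y \subset X1 -> Y :!=: 1 -> p <= #|Y|.
  move=> sYX1 ntY; have [_ p_dv_Y _] := pgroup_pdiv (pgroupS sYX1 pX1) ntY.
  by rewrite dvdn_leq.
have [K [sKM iMK ntY]] :=
  abelem_coprime_fix_maximal abelqM pr_q abX1 q'X1 nX1M ntX1 fixX1M.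
have [nKA | nnKA] := boolP (A \subset 'N(K)).
  have K1 : K :=: 1.
    apply: contraTeq ntY => ntK; rewrite negbK.
    by rewrite (minM' K) ?fixX1M // ntK.
  have oM : #|M| = q by rewrite -iMK K1 indexg1.
  have regX1 : semiregular X1 M.
    by move=> m Mm; rewrite -cent_cycle (cycle_prime _ Mm) ?oM.
  have q_dv_X : q %| #|X1|.-1.
    by rewrite -oM; apply: regular_norm_dvd_pred.
  have p_dv_q : p %| q.-1.
    rewrite -oM -oa; apply: regular_norm_dvd_pred => // b Ab.
    by rewrite -cent_cycle (cycle_prime (R := A)) //= -orderE oa.
  have [y My nty] := trivgPn _ ntM.
  have tiC : 'C_X1[a] :&: 'C_X1[a] :^ y = 1.
    apply/trivgP/subsetP=> x /setIP[/setIP[X1x cax]]; rewrite mem_conjg.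
    case/setIP=> _ /cent1P cayx'; have cayx : x \in 'C[a ^ y].
      apply/cent1P; have := congr1 (fun z => conjg z y) cayx'.
      by rewrite conjMg [in X in _ = X -> _]conjMg conjgKV.
    have Mc : [~ a, y] \in M.
      by rewrite commgEr groupMr // memJ_norm ?groupV // (subsetP nMA) ?cycle_id.
    have ntc : [~ a, y] != 1.
      apply: contraNneq nty => /eqP/commgP cay; rewrite -in_set1 -[[set 1]]fixMA.
      by rewrite inE My cent_cycle; apply/cent1P.
    suffices: x \in 'C_X1[[~ a, y]] by rewrite regX1 // !inE ntc.
    rewrite inE X1x cent1C commgEl groupM ?groupV //; first by rewrite cent1C.
    by rewrite cent1C.
  have le2 : #|'C_X1[a]| * #|'C_X1[a]| <= #|X1|.
    rewrite -{2}(cardJg 'C_X1[a] y) -TI_cardMg // subset_leq_card //.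
    apply: mul_subG; first exact: subsetIl.
    by rewrite sub_conjg (normP (groupVr (subsetP nX1M y My))) subsetIl.
  rewrite ltnNge; apply/negP => le_X1.
  have cp : #|'C_X1[a]| <= p.
    by rewrite -(leq_pmul2r (cardG_gt0 'C_X1[a])) (leq_trans le2).
  have leX1 : #|X1| <= p * p by apply: leq_trans le_X1 _; rewrite leq_mul2l cp orbT.
  have [k oX1] := p_natP pX1.
  have lek2 : k <= 2 by rewrite -(leq_exp2l _ _ (prime_gt1 pr_p)) -oX1 -mulnn.
  have k_gt0 : 0 < k.
    by rewrite lt0n; apply: contra ntX1 => /eqP k0; rewrite trivg_card1 oX1 k0.
  have q_dv : q %| (p - 1) * (p + 1).
    case: k lek2 k_gt0 oX1 => [|[|[|]]] // _ _ oX1.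
      by move: q_dv_X; rewrite oX1 expn1 -subn1; apply: dvdn_mulr.
    by rewrite -subn_sqr exp1n subn1 -oX1.
  have ltpq : p < q.
    by rewrite -(prednK (prime_gt0 pr_q)) ltnS dvdn_leq // -subn1 subn_gt0 prime_gt1.
  move: q_dv; rewrite Euclid_dvdM // => /orP[] /dvdn_leq.
    rewrite subn_gt0 prime_gt1 // => /(_ isT); rewrite leqNgt.
    by rewrite (leq_ltn_trans (leq_subr _ _) ltpq).
  rewrite addn1 => /(_ isT) leqp.
  have eq_q : q = p.+1 by apply/eqP; rewrite eqn_leq leqp.
  have := even_prime pr_q; rewrite eq_q /= odd_p => -[[p1] | //].
  by rewrite p1 in pr_p.
have joinM (L1 L2 : {group gT}) : L1 \subset M -> L2 \subset M ->
    #|M : L1| = q -> #|M : L2| = q -> L1 :!=: L2 -> L1 * L2 = M.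
  move=> sL1 sL2 iL1 iL2 neqL; apply: mulg_normal_maximal => //.
  - by rewrite -sub_abelian_normal.
  - by rewrite p_index_maximal ?iL1.
  apply: contra neqL => sL21; rewrite eq_sym eqEcard sL21.
  have := Lagrange sL1; rewrite iL1 -(Lagrange sL2) iL2 => /eqP.
  rewrite eqn_pmul2r ?prime_gt0 // => /eqP->.
  by rewrite leqnn.
pose cK x := (K :^ x)%G.
have nMx x : x \in A -> M :^ x = M by move/(subsetP nMA)/normP.
have sKM' x : x \in A -> cK x \subset M.
  by move=> Ax; rewrite -(nMx x Ax) conjSg.
have iMK' x : x \in A -> #|M : cK x| = q.
  by move=> Ax; rewrite -iMK -!divgS ?sKM' //= cardJg.
have neqK x : x \in A -> x != 1 -> K :!=: K :^ x.
  move=> Ax ntx; apply: contra nnKA => /eqP/esym defK.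
  suffices <- : <[x]> = A by rewrite cycle_subG; apply/normP.
  by apply: cycle_prime; rewrite ?inE ?ntx //= -orderE oa.
have Aa : a \in A := cycle_id a.
have ti (L1 L2 : {group gT}) x : L1 * L2 = M -> x \in X1 -> x \in 'C(L1) ->
    x \in 'C(L2) -> x = 1.
  move=> defM X1x c1x c2x; apply/set1P; rewrite -[[set 1]]fixX1M inE X1x.
  by rewrite -defM centM inE c1x.
have nta : a != 1 by rewrite -order_eq1 oa neq_ltn prime_gt1 ?orbT.
have nta2 : a ^+ 2 != 1.
  rewrite -order_dvdn oa; apply: contraL odd_p => /dvdn_leq p2.
  rewrite (_ : p = 2) //; apply/anti_leq/andP; split; last exact: prime_gt1.
  exact: p2.
have K01 : K * cK a = M by rewrite joinM ?sKM' ?iMK' ?neqK.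
have K02 : K * cK (a ^+ 2) = M.
  by rewrite joinM ?sKM' ?iMK' ?neqK ?groupX.
have K12 : cK a * cK (a ^+ 2) = M.
  rewrite joinM ?sKM' ?iMK' ?groupX //= expgS conjsgM.
  by rewrite (inj_eq (@conjsg_inj _ a)) neqK.
pose Y := 'C_X1(K)%G; have sYX1 : Y \subset X1 := subsetIl _ _.
have nX1a : X1 :^ a = X1 by apply/normP; rewrite -cycle_subG.
have defYa : Y :^ a = 'C_X1(cK a) by rewrite conjIg centJ nX1a.
have tiY : Y :&: Y :^ a = 1.
  apply/trivgP/subsetP=> x /=; rewrite defYa.
  case/setIP=> /setIP[X1x c0x] /setIP[_ c1x].
  by rewrite (ti _ _ x K01).
have cX1 := centsP abX1.
have nYM x z : x \in M -> z \in Y -> z ^ x \in Y.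
  by move=> Mx Yz; rewrite memJ_norm // (subsetP (cYM K sKM)).
have nYaM x z : x \in M -> z \in Y :^ a -> z ^ x \in Y :^ a.
  move=> Mx Yz; rewrite memJ_norm // defYa.
  by rewrite (subsetP (cYM (cK a) (sKM' a Aa))).
have sYaX1 : Y :^ a \subset X1 by rewrite defYa subsetIl.
have UG : Y * Y :^ a = Y <*> Y :^ a.
  by rewrite cent_joinEr //; apply: sub_abelian_cent2 abX1 _ _.
have tiU : 'C_X1[a] :&: (Y * Y :^ a) = 1.
  rewrite UG; apply/trivgP/subsetP=> u /setIP[/setIP[X1u /cent1P cau]].
  rewrite /= -UG; case/mulsgP=> y w Yy Yaw def_u; apply/set1P.
  have uau : u ^ a = u by apply/conjg_fixP/commgP.
  have X1y := subsetP sYX1 y Yy; have X1w := subsetP sYaX1 w Yaw.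
  have Kaw : w ^ a \in 'C(cK (a ^+ 2)).
    rewrite /= expgS conjsgM centJ memJ_conjg.
    by move: Yaw; rewrite defYa => /setIP[].
  have Yay : y ^ a \in Y :^ a by rewrite memJ_conjg.
  have X1ya := subsetP sYaX1 _ Yay.
  pose w' := w * (y ^ a)^-1.
  have Yaw' : w' \in Y :^ a by rewrite groupM ?groupV.
  have wa : w ^ a = y * w'.
    apply: (mulgI (y ^ a)); rewrite -conjMg -def_u uau def_u /w'.
    rewrite [RHS](cX1 _ X1ya) ?groupM ?groupV //.
    by rewrite -!mulgA mulVg mulg1.
  have y1 : y = 1.
    apply: (ti _ _ y K02) => //; first by case/setIP: Yy.
    apply/centP=> k K2k; have Mk := subsetP (sKM' _ (groupX 2 Aa)) k K2k.
    apply/commgP/conjg_fixP.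
    have : y^-1 * y ^ k \in Y :&: Y :^ a.
      rewrite inE groupM ?groupV ?nYM //=.
      have -> : y^-1 * y ^ k = w' * (w' ^ k)^-1.
        have : (w ^ a) ^ k = w ^ a by apply/conjg_fixP/commgP/(centP Kaw).
        rewrite wa conjMg => eq_k; apply: (mulgI y); rewrite mulKVg.
        by apply: (mulIg (w' ^ k)); rewrite eq_k -!mulgA mulVg mulg1.
      by rewrite groupM ?groupV ?nYaM.
    by rewrite tiY => /set1P yk1; apply: (mulgI y^-1); rewrite yk1 mulVg.
  have ww : w ^ a = w by rewrite -[w]mul1g -y1 -def_u uau.
  rewrite def_u y1 mul1g; apply: (ti _ _ w K12) => //.
    by move: Yaw; rewrite defYa => /setIP[].
  by rewrite -ww.
have leU : #|'C_X1[a]| * (#|Y| * #|Y|) <= #|X1|.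
  rewrite -{2}(cardJg Y a) -TI_cardMg // UG -TI_cardMg; last by rewrite /= -UG.
  by rewrite subset_leq_card // mul_subG ?subsetIl //= -UG mul_subG.
apply: leq_trans leU; rewrite mulnC ltn_pmul2l ?cardG_gt0 //.
rewrite (@leq_trans (p * p)) ?ltn_Pmull ?prime_gt1 ?prime_gt0 //.
by rewrite leq_mul ?p2_le.
Qed.

End CoprimeFixedPoints.

(** * Fixed points of elementary abelian p-groups *)

Section FixBound.

Variables (gT : finGroupType) (p : nat).
Implicit Types A B Q V X : {group gT}.

(** Induction on A.  Some subgroup B of index p in A has nontrivial fixed points in
    [Q, A].  On C_V(B), an element a of A outside B moves enough vectors by
    [coprime_abelian_fix_bound], and this inequality multiplies with the one for B. *)
Lemma abelem_fix_bound A Q V :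
    prime p -> odd p -> p.-abelem A -> A :!=: 1 -> abelian Q -> p^'.-group Q ->
    abelian V -> p.-group V -> A \subset 'N(Q) -> A \subset 'N(V) ->
    Q \subset 'N(V) -> 'C_A(Q) = 1 -> 'C_Q(V) = 1 ->
  #|A| * #|'C_V(A)| < #|V|.
Proof.
move=> pr_p odd_p; have [n] := ubnP #|A|; elim: n A => // n IHn A leAn.
move=> abelA ntA abQ p'Q abV pV nQA nVA nVQ fAQ fQV.
have pA := abelem_pgroup abelA; have abA := abelem_abelian abelA.
pose Q1 := [~: Q, A]%G.
have sQ1Q : Q1 \subset Q by rewrite commg_subl.
have coQA : coprime #|Q| #|A| by rewrite coprime_sym (pnat_coprime pA).
have fQ1A : 'C_Q1(A) = 1 := coprime_abel_cent_TI nQA coQA abQ.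
have ntQ1 : Q1 :!=: 1.
  apply: contra ntA => /eqP/commG1P; rewrite centsC => cAQ.
  by rewrite -subG1 -fAQ subsetI subxx.
have nQ1A : A \subset 'N(Q1) by rewrite normsR ?normG.
have [B [sBA iAB ntQ0]] :=
  abelem_coprime_fix_maximal abelA pr_p (abelianS sQ1Q abQ) (pgroupS sQ1Q p'Q)
    nQ1A ntQ1 fQ1A.
pose Q0 := 'C_Q1(B)%G; pose X := 'C_V(B)%G.
have sQ0Q1 : Q0 \subset Q1 := subsetIl _ _.
have sQ0Q := subset_trans sQ0Q1 sQ1Q.
have prBA : B \proper A.
  rewrite properE sBA; apply: contraL (prime_gt1 pr_p) => sAB.
  by rewrite -iAB (_ : B :=: A) ?indexgg //; apply/eqP; rewrite eqEsubset sBA.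
have /subsetPn[a Aa notBa] := proper_subn prBA.
have nta : a != 1 by apply: contraNneq notBa => ->.
have oa : #[a] = p := abelem_order_p abelA Aa nta.
have defA : B * <[a]> = A.
  apply: mulg_normal_maximal; rewrite ?cycle_subG //.
    by rewrite -sub_abelian_normal.
  by rewrite p_index_maximal ?iAB.
have cBA : A \subset 'C(B) by rewrite centsC (subset_trans sBA).
have nBA : A \subset 'N('C(B)) by rewrite norms_cent // cents_norm.
have lt_X : p * #|'C_X[a]| < #|X|.
  apply: (@coprime_abelian_fix_bound _ p a Q0 X) => //.
  - exact: abelianS sQ0Q abQ.
  - exact: pgroupS sQ0Q p'Q.
  - exact: abelianS (subsetIl _ _) abV.
  - exact: pgroupS (subsetIl _ _) pV.
  - by apply: (subsetP _ a Aa); rewrite normsI.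
  - by apply: (subsetP _ a Aa); rewrite normsI.
  - rewrite normsI ?(subset_trans sQ0Q nVQ) //.
    by rewrite norms_cent // cents_norm // subsetIr.
  - apply/trivgP; rewrite -fQV subsetI subIset ?sQ0Q //=.
    apply: (@coprime_cent_fix_faithful _ p B) => //=.
    + by rewrite subIset // (subset_trans sQ0Q).
    + exact: subset_trans sBA nVA.
    + by rewrite centsC subIset // subsetIr.
    + exact: pgroupS sBA pA.
    + by apply: pgroupS p'Q; rewrite subIset // sQ0Q.
    by rewrite subsetIr.
  apply: contra ntQ0 => caQ0; rewrite -subG1 -fQ1A subsetI sQ0Q1 /=.
  have -> : 'C(A) = 'C(B) :&: 'C(<[a]>) by rewrite -centM defA.
  by rewrite subsetI subsetIr /= centsC cycle_subG.
have -> : 'C_V(A) = 'C_X[a].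
  by rewrite -defA centM cent_cycle setIA.
rewrite -(Lagrange sBA) iAB -mulnA.
apply: (@leq_trans (#|B| * #|X|)); first by rewrite ltn_pmul2l.
have [B1 | ntB] := eqVneq (B : {set gT}) 1.
  by rewrite /= B1 cards1 mul1n cent1T setIT.
apply: ltnW; apply: IHn => //.
- by rewrite -ltnS (leq_trans _ leAn) // ltnS proper_card.
- exact: abelemS abelA.
- exact: subset_trans nQA.
- exact: subset_trans nVA.
by apply/trivgP; rewrite -fAQ setSI.
Qed.

End FixBound.

(** * Thompson's normal p-complement criterion *)

Section MorePNilpotent.

Variables (gT : finGroupType) (p : nat).
Implicit Types G H M P : {group gT}.

Lemma p_nilpotentJ G x : p_nilpotent p (G :^ x) = p_nilpotent p G.
Proof. by rewrite /p_nilpotent pcoreJ pHallJ2. Qed.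

Lemma p_nilpotent_normal_pgroup G M :
  M <| G -> 'O_p^'(G) = 1 -> p_nilpotent p M -> p.-group M.
Proof.
move=> nsMG O1 nilM.
have OM1 : 'O_p^'(M) = 1.
  apply/trivgP; rewrite -O1 pcore_max ?pcore_pgroup //.
  exact: char_normal_trans (pcore_char _ _) nsMG.
by have := card_Hall nilM; rewrite /= OM1 cards1 => /esym/eqP; rewrite partG_eq1 pgroupNK.
Qed.

(** Schur-Zassenhaus splits Z off the preimage of the normal p-complement of G / Z;
    as Z is central, its complement is normal. *)
Lemma p_nilpotent_central_ext G Z :
  (Z : {group gT}) \subset 'Z(G) -> p.-group Z -> p_nilpotent p (G / Z) ->
  p_nilpotent p G.
Proof.
move=> sZZ pZ nilGZ; have [sZG cZG] := subsetIP sZZ.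
have nsZG : Z <| G by rewrite sub_center_normal.
have := pcore_normal p^' (G / Z); case/(inv_quotientN nsZG) => T defT sZT nsTG.
have sTG := normal_sub nsTG.
have p'TZ : p^'.-group (T / Z) by rewrite -defT pcore_pgroup.
have nsZT : Z <| T := normalS sZT sTG nsZG.
have hallZ : p.-Hall(T) Z.
  by rewrite /pHall sZT pZ /= -card_quotient ?normal_norm.
have /splitsP[T1 /complP[tiZT defZT]] : [splits T, over Z].
  by apply: SchurZassenhaus_split => //; apply: pHall_Hall hallZ.
have sT1T : T1 \subset T by rewrite -defZT mulG_subr.
have nT1T : T \subset 'N(T1).
  rewrite -defZT mul_subG ?normG // cents_norm // centsC.
  by rewrite centsC (subset_trans cZG) // centS // (subset_trans sT1T).
apply: (normal_p_nilpotent_ext nsTG).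
  rewrite -(isog_pgroup p (third_isog sZT nsZG nsTG)) -defT.
  by rewrite /pgroup card_quotient ?gFnorm // -[_.-nat _]pnatNK; have /and3P[] := nilGZ.
have nsT1T : T1 <| T by rewrite /normal sT1T.
have hallT1 : p^'.-Hall(T) T1.
  by rewrite -(compl_pHall T1 hallZ); apply/complP.
by rewrite /p_nilpotent (normal_Hall_pcore hallT1).
Qed.

End MorePNilpotent.

Section ThompsonSubgroup.

Variables (gT : finGroupType) (p : nat).
Implicit Types P U E : {group gT}.

(** The version of Thompson's J(P) that uses elementary abelian subgroups. *)
Definition Thompson_subgroup (P : {set gT}) :=
  <<\bigcup_(E in 'E_p^('r_p(P))(P)) E>>.

Canonical Thompson_subgroup_group P := Eval hnf in [group of Thompson_subgroup P].

Lemma Thompson_sub P : Thompson_subgroup P \subset P.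
Proof. by rewrite gen_subG; apply/bigcupsP=> E /pnElemP[]. Qed.

Lemma sub_Thompson P E : E \in 'E_p^('r_p(P))(P) -> E \subset Thompson_subgroup P.
Proof.
by move=> EP; apply: sub_gen; apply: (bigcup_max E).
Qed.

Lemma Thompson_char P : Thompson_subgroup P \char P.
Proof.
apply/charP; split=> [|f injf fP]; first exact: Thompson_sub.
apply/eqP; rewrite eqEcard card_injm ?Thompson_sub // leqnn andbT.
have sEP : \bigcup_(E in 'E_p^('r_p(P))(P)) E \subset P.
  by apply/bigcupsP=> E /pnElemP[].
rewrite morphim_gen // gen_subG; apply/subsetP=> _ /morphimP[x Px /bigcupP[E EP Ex] ->].
have [sE _ _] := pnElemP EP.
suffices: f @* E \subset Thompson_subgroup P by move/subsetP->; rewrite ?mem_morphim.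
apply: (@sub_Thompson P (f @* E)%G).
have : (f @* E)%G \in 'E_p^('r_p(P))(f @* P) by rewrite injm_pnElem.
by rewrite fP.
Qed.

Lemma Thompson_neq1 P : prime p -> p.-group P -> P :!=: 1 -> Thompson_subgroup P != 1.
Proof.
move=> pr_p pP ntP; have [E EP] := p_rank_witness p P.
apply: contraNneq ntP => J1; have [sEP _ oE] := pnElemP EP.
have := sub_Thompson EP; rewrite J1 => /trivgP E1.
move: oE; rewrite E1 cards1 logn1 => /esym/eqP; rewrite -leqn0 leqNgt p_rank_gt0.
apply: contraR => ntP; have [_ p_dv _] := pgroup_pdiv pP ntP.
by rewrite mem_primes pr_p cardG_gt0.
Qed.

Lemma ThompsonS P U : U \subset P -> Thompson_subgroup P \subset U ->
  Thompson_subgroup U = Thompson_subgroup P.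
Proof.
move=> sUP sJU.
have eq_r : 'r_p(U) = 'r_p(P).
  apply/eqP; rewrite eqn_leq p_rankS //=.
  have [E EP] := p_rank_witness p P; have [_ abelE oE] := pnElemP EP.
  apply/p_rank_geP; exists E; apply/pnElemP; split=> //.
  exact: subset_trans (sub_Thompson EP) sJU.
congr <<_>>; apply: eq_bigl => E; rewrite eq_r.
apply/pnElemP/idP=> [[sEU abelE oE] | EP].
  by apply/pnElemP; split; rewrite ?(subset_trans sEU).
have [_ abelE oE] := pnElemP EP; split=> //.
exact: subset_trans (sub_Thompson EP) sJU.
Qed.

End ThompsonSubgroup.

(** E and Q act on V through a quotient by U, so the semidirect product of V with
    this quotient is a group in which [abelem_fix_bound] applies. *)
Lemma abelem_quotient_fix_bound (gT : finGroupType) p (U E V : {group gT})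
    (Q : {group coset_of U}) :
    prime p -> odd p -> E \subset 'N(U) -> V \subset 'C(U) ->
    p.-abelem (E / U) -> E / U != 1 -> abelian Q -> p^'.-group Q ->
    abelian V -> p.-group V -> E / U \subset 'N(Q) -> E \subset 'N(V) ->
    coset U @*^-1 Q \subset 'N(V) -> 'C_(E / U)(Q) = 1 ->
    'C_(coset U @*^-1 Q)(V) \subset U ->
  #|E / U| * #|'C_V(E)| < #|V|.
Proof.
move=> pr_p odd_p nUE cUV abelE ntE abQ p'Q abV pV nQE nVE nVQ fEQ fQV.
pose to := ('J %% U)%gact; pose f1 := sdpair1 to; pose f2 := sdpair2 to.
have dom2 (X : {set coset_of U}) : X \subset setT / U.
  apply/subsetP=> x _; rewrite -(coset_mem (mem_repr_coset x)).
  by rewrite mem_quotient ?inE.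
have dom1 : V \subset 'C_(|'J)(U) by rewrite gacentJ.
have actE v g : v \in V -> g \in 'N(U) -> f1 (v ^ g) = f1 v ^ f2 (coset U g).
  move=> Vv Ng; rewrite -[RHS](sdpair_act to).
  - congr f1; rewrite /= modactE ?in_setT //; apply/afixP=> u /setIP[_ Uu].
    by apply/conjg_fixP/commgP/(centP (subsetP cUV v Vv)).
  - exact: subsetP dom1 v Vv.
  by rewrite mem_quotient ?inE.
have quoP (X : {set coset_of U}) y : y \in f2 @* X ->
    exists2 g, g \in 'N(U) & coset U g \in X /\ y = f2 (coset U g).
  case/morphimP=> x _ Xx ->; exists (repr x); first exact: (subsetP (coset_norm x)) (mem_repr_coset x).
  by rewrite (coset_mem (mem_repr_coset x)).
have preP (X : {set coset_of U}) g : g \in 'N(U) -> coset U g \in X ->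
    g \in coset U @*^-1 X.
  by move=> Ng Xg; apply/morphpreP.
have inj1 := injm_sdpair1 to; have inj2 := injm_sdpair2 to.
have normV (X : {set coset_of U}) : coset U @*^-1 X \subset 'N(V) ->
   f2 @* X \subset 'N(f1 @* V).
  move=> nVX; apply/subsetP=> _ /quoP[g Ng [Xg ->]]; rewrite inE.
  apply/subsetP=> _ /imsetP[_ /morphimP[v Rv Vv ->] ->].
  have Vvg : v ^ g \in V by rewrite memJ_norm // (subsetP nVX) // preP.
  by rewrite -actE // mem_morphim // (subsetP dom1).
have oE : #|f2 @* (E / U)| = #|E / U| by rewrite card_injm.
have oV : #|f1 @* V| = #|V| by rewrite card_injm.
rewrite -oE -oV; apply: leq_ltn_trans (_ : #|f2 @* (E / U)| * #|'C_(f1 @* V)(f2 @* (E / U))| < _).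
  rewrite leq_mul2l; apply/orP; right.
  have sCV : 'C_V(E) \subset V := subsetIl _ _.
  rewrite -(card_injm inj1 (subset_trans sCV dom1)) subset_leq_card //.
  rewrite subsetI morphimS //=; apply/centsP=> _ /morphimP[v Rv /setIP[Vv cEv] ->].
  move=> _ /morphimP[x _ /morphimP[g Ng Eg ->] ->].
  apply/commgP/conjg_fixP; rewrite -actE //.
  by congr f1; apply/conjg_fixP/commgP/(centP cEv).
apply: (abelem_fix_bound (Q := f2 @* Q) pr_p odd_p).
- exact: morphim_abelem.
- by rewrite morphim_injm_eq1.
- exact: morphim_abelian.
- exact: morphim_pgroup.
- exact: morphim_abelian.
- exact: morphim_pgroup.
- exact: morphim_norms.
- apply: normV; rewrite quotientK // mul_subG //.
  by apply: subset_trans (cent_sub _); rewrite centsC.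
- exact: normV.
- by rewrite -injm_subcent // fEQ morphim1.
apply/trivgP/subsetP=> y /setIP[/quoP[g Ng [Qg ->]] cVg].
suffices /coset_id-> : g \in U by rewrite [f2 1](morph1 (sdpair2_morphism to)) set11.
apply: (subsetP fQV); rewrite inE preP //=; apply/centP=> v Vv.
apply/commute_sym/commgP/conjg_fixP.
have Vvg : v ^ g \in V.
  by rewrite memJ_norm // (subsetP nVQ) // preP.
apply: (injmP inj1); rewrite ?(subsetP dom1) //=.
rewrite [LHS]actE //; apply/conjg_fixP/commgP/commute_sym/(centP cVg).
by rewrite mem_morphim // (subsetP dom1).
Qed.

Section Thompson.

Variable p : nat.
Hypotheses (pr_p : prime p) (odd_p : odd p).

Definition local_p_nilpotent (gT : finGroupType) (G P : {set gT}) :=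
  forall X : {group gT}, X \char P -> X :!=: 1 -> p_nilpotent p 'N_G(X).

Lemma char_local_proper (gT : finGroupType) (G P H : {group gT}) :
  H \subset G -> local_p_nilpotent G P -> local_p_nilpotent H P.
Proof.
by move=> sHG locG X chX ntX; apply: p_nilpotentS (locG X chX ntX); apply: setSI.
Qed.

(** X is a Sylow subgroup of X <*> M, so the Frattini argument applies in the
    normaliser of X <*> M. *)
Lemma p'quotient_norm (gT : finGroupType) (G M X : {group gT}) :
    M <| G -> p^'.-group M -> p.-group X -> X \subset G ->
  'N_(G / M)(X / M) = 'N_G(X) / M.
Proof.
move=> nsMG p'M pX sXG; have nMG := normal_norm nsMG.
have nMX := subset_trans sXG nMG.
apply/eqP; rewrite eqEsubset subsetI quotientS ?subsetIl //=.
rewrite quotient_norms ?subsetIr // andbT.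
apply/subsetP=> _ /setIP[/morphimP[g Ng Gg ->] nXg].
have [sylX _] := coprime_mulpG_Hall (esym (norm_joinEl nMX)) pX p'M.
have defXM : coset M @*^-1 (X / M) = X <*> M.
  by rewrite quotientK // norm_joinEl // (normC nMX).
pose N := 'N_G(X <*> M)%G.
have sXMG : X <*> M \subset G by rewrite join_subG sXG normal_sub.
have Ng' : g \in N.
  rewrite inE Gg -defXM (subsetP (morphpre_norm _ _)) //.
  by apply/morphpreP.
have nsXMN : X <*> M <| N by rewrite normalSG.
have := Frattini_arg nsXMN sylX => /esym defN.
move: Ng'; rewrite [N : {set _}]defN => /mulsgP[y z].
rewrite /= norm_joinEl // (normC nMX) => /mulsgP[m x Mm Xx ->].
case/setIP=> /setIP[Gz _] nXz ->; rewrite -mulgA.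
have Nxz : x * z \in 'N_G(X).
  by rewrite groupM // inE ?Gz ?nXz ?(subsetP sXG) // (subsetP (normG X)).
rewrite morphM; last 2 first.
- exact: subsetP (normG M) m Mm.
- by apply: (subsetP nMG); case/setIP: Nxz.
by rewrite /= coset_id // mul1g mem_quotient.
Qed.

Lemma local_p_nilpotent_p'quotient (gT : finGroupType) (G P M : {group gT}) :
    M <| G -> p^'.-group M -> p.-group P -> P \subset G ->
  local_p_nilpotent G P -> local_p_nilpotent (G / M) (P / M).
Proof.
move=> nsMG p'M pP sPG locG Xb chXb ntXb.
have nMP := subset_trans sPG (normal_norm nsMG).
have tiMP : M :&: P = 1 by rewrite setIC coprime_TIg // (pnat_coprime pP).
have [f injf fE] := quotient_TI_injm nMP tiMP.
pose X := (f @*^-1 Xb)%G.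
have sXP : X \subset P := subsetIl _ _.
have defXb : Xb :=: X / M.
  by rewrite -fE // morphpreK // fE // char_sub.
have chX : X \char P.
  have chXb' : f @* X \char f @* P by rewrite !fE // -defXb.
  have := injm_char (injm_invm injf) (morphimS _ (subxx P)) chXb'.
  by rewrite !morphim_invm.
have ntX : X :!=: 1 by apply: contraNneq ntXb => X1; rewrite defXb X1 quotient1.
rewrite defXb p'quotient_norm //; last exact: subset_trans sXP sPG.
  apply: morphim_p_nilpotent (locG X chX ntX).
  exact: subset_trans (subsetIl _ _) (normal_norm nsMG).
exact: pgroupS sXP pP.
Qed.

(** Take a counterexample G of least order.  Then O_p'(G) = 1.  The group
    U = O_p(G) is not trivial, contains its centraliser, and G / U is p-nilpotent;
    minimality gives G / U = Q1 (P / U) for an abelian q-group Q1 with q <> p.  If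
    J(P) is contained in U then J(P) = J(U) is normal in G and the hypothesis applies
    to it.  Otherwise let E be an elementary abelian subgroup of P of maximal order
    that is not contained in U.  By [abelem_quotient_fix_bound] for V = Ohm_1(Z(U)),
    the elementary abelian group (E :&: U) V has more elements than E. *)
Theorem Thompson_p_nilpotent (gT : finGroupType) (G P : {group gT}) :
  p.-Sylow(G) P -> local_p_nilpotent G P -> p_nilpotent p G.
Proof.
have [n] := ubnP #|G|; elim: n gT G P => // n IHn gT G P leGn sylP locG.
have sPG := pHall_sub sylP; have pP := pHall_pgroup sylP.
have IHH (H : {group gT}) : H \proper G -> P \subset H -> p_nilpotent p H.
  move=> prHG sPH; have sHG := proper_sub prHG.
  apply: (IHn _ H P) (pHall_subl sPH sHG sylP) (char_local_proper sHG locG).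
  by rewrite -ltnS (leq_trans _ leGn) // ltnS proper_card.
have [O1 | ntO] := eqVneq ('O_p^'(G)) 1; last first.
  have nsO := pcore_normal p^' G; have p'O := pcore_pgroup p^' G.
  apply: (p_nilpotent_quo_p' nsO p'O).
  apply: (IHn _ _ (P / 'O_p^'(G))%G).
  - by rewrite -ltnS (leq_trans _ leGn) // ltnS ltn_quotient // pcore_sub.
  - by apply: quotient_pHall => //; apply: subset_trans sPG (normal_norm nsO).
  exact: local_p_nilpotent_p'quotient.
apply/idPn=> not_nilG.
(* Among the normalisers of p-subgroups that are not p-nilpotent, one with the
   largest p-part is the whole of G. *)
have ntU : 'O_p(G) != 1.
  pose bad (U : {group gT}) :=
    [&& U \subset G, p.-group U, U :!=: 1 & ~~ p_nilpotent p 'N_G(U)].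
  have [U0 badU0] : exists U, bad U.
    apply/existsP; apply: contraR not_nilG => /existsPn noU.
    apply: Frobenius_p_nilpotent => // U sUG pU ntU.
    by have := noU U; rewrite /bad sUG pU ntU /= negbK.
  have [U1 badU1 maxU1] := @arg_maxnP _ U0 bad (fun U : {group gT} => #|'N_G(U)|`_p)%N badU0.
  have [S1 sylS1] := Sylow_exists p 'N_G(U1).
  have sS1G : S1 \subset G := subset_trans (pHall_sub sylS1) (subsetIl _ _).
  have [g Gg sS1P] := Sylow_subJ sylP sS1G (pHall_pgroup sylS1).
  pose U := (U1 :^ g^-1)%G; pose S := (S1 :^ g^-1)%G.
  have NUE : 'N_G(U) = 'N_G(U1) :^ g^-1.
    by rewrite conjIg normJ conjGid ?groupV.
  have sSP : S \subset P by rewrite sub_conjgV.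
  have sylS : p.-Sylow('N_G(U)) S by rewrite NUE pHallJ2.
  have [sU1G pU1 ntU1 badN1] := and4P badU1.
  have sUG : U \subset G by rewrite sub_conjgV conjGid.
  have pU : p.-group U by rewrite pgroupJ.
  have ntU : U :!=: 1 by rewrite trivg_card1 cardJg -trivg_card1.
  have badN : ~~ p_nilpotent p 'N_G(U) by rewrite NUE p_nilpotentJ.
  have oN : (#|'N_G(U1)|`_p = #|S|)%N by rewrite (card_Hall sylS) /= NUE cardJg.
  have [ltSP | ] := boolP (S \proper P).
    have locS : local_p_nilpotent 'N_G(U) S.
      move=> X chX ntX; apply: p_nilpotentS (_ : p_nilpotent p 'N_G(X)).
        by rewrite setSI ?subsetIl.
      apply: contraTT (proper_card (nilpotent_proper_norm (pgroup_nil pP) ltSP)).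
      move=> badX; rewrite -leqNgt.
      have sXP : X \subset P := subset_trans (char_sub chX) sSP.
      have badX' : bad X.
        by rewrite /bad (subset_trans sXP) ?(pgroupS sXP) ?ntX.
      have := maxU1 X badX'; rewrite oN; apply: leq_trans.
      have sNX : 'N_P(S) \subset 'N_G(X).
        rewrite subsetI subIset ?sPG //=.
        exact: char_norm_trans chX (subsetIr _ _).
      have [T sylT sNT] := Sylow_superset sNX (pgroupS (subsetIl _ _) pP).
      by rewrite -(card_Hall sylT) subset_leq_card.
    case/negP: badN.
    have [prN | notprN] := boolP ('N_G(U) \proper G).
      apply: (IHn _ 'N_G(U)%G S) => //.
      by rewrite -ltnS (leq_trans _ leGn) // ltnS proper_card.
    have defN : 'N_G(U) = G.
      by apply/eqP; move: notprN; rewrite properE subsetIl negbK eqEsubset subsetIl.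
    have := proper_card ltSP; rewrite (card_Hall sylP) (card_Hall sylS).
    by rewrite /= defN ltnn.
  rewrite properE sSP negbK => sPS.
  have sPN : P \subset 'N_G(U) := subset_trans sPS (pHall_sub sylS).
  have sNG : G \subset 'N_G(U).
    apply: contraR badN => notsGN; apply: (IHH 'N_G(U)%G) => //.
    by rewrite properE subsetIl.
  apply: contraNneq ntU => OG1; rewrite -subG1 -OG1 pcore_max //.
  by rewrite /normal sUG (subset_trans sNG) ?subsetIr.
set U := 'O_p(G) in ntU.
have nsUG : U <| G := pcore_normal p G; have nUG := normal_norm nsUG.
have pU : p.-group U := pcore_pgroup p G.
have sUP : U \subset P by rewrite pcore_sub_Hall.
have nUP := subset_trans sPG nUG.
have normP (X : {group gT}) : X <| G -> p_nilpotent p X -> X \subset U.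
  move=> nsXG nilX; apply: pcore_max => //.
  exact: p_nilpotent_normal_pgroup nsXG O1 nilX.
have nilGU : p_nilpotent p (G / U).
  apply: (IHn _ _ (P / U)%G).
  - by rewrite -ltnS (leq_trans _ leGn) // ltnS ltn_quotient // pcore_sub.
  - exact: quotient_pHall.
  move=> Xb chXb ntXb.
  have nsUP : U <| P := normalS sUP sPG nsUG.
  have [X defXb sUX nsXP] := inv_quotientN nsUP (char_normal chXb).
  have sXP := normal_sub nsXP.
  rewrite defXb -quotient_subnormG //; last by rewrite (normalS _ _ nsUG) // (subset_trans sXP).
  apply: morphim_p_nilpotent; first by rewrite subIset ?nUG.
  apply: IHH; last by rewrite subsetI sPG normal_norm.
  rewrite properE subsetIl /=; apply: contra ntXb => sGN.
  rewrite defXb -subG1 -trivg_quotient quotientS // pcore_max ?(pgroupS sXP) //.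
  by rewrite /normal (subset_trans sXP) // (subset_trans sGN) ?subsetIr.
have cUU : 'C_G(U) \subset U.
  have nsCG : 'C_G(U) <| G by rewrite norm_normalI // norms_cent.
  apply: normP; first exact: nsCG.
  apply: (@p_nilpotent_central_ext _ _ _ ('C_G(U) :&: U)%G) => /=.
  - rewrite subsetI subsetIl /=; apply: subset_trans (subsetIr _ _) _.
    by rewrite centsC subsetIr.
  - exact: pgroupS (subsetIr _ _) pU.
  have nUC := subset_trans (subsetIl G 'C(U)) nUG.
  have: 'C_G(U) / U \isog 'C_G(U) / (U :&: 'C_G(U)).
    by rewrite isog_sym second_isog.
  case/isogP=> f injf def_f; rewrite [_ :&: U]setIC -[_ / (U :&: _)]def_f.
  apply: morphim_p_nilpotent => //.
  by apply: p_nilpotentS nilGU; rewrite quotientS ?subsetIl.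
set K := 'O_p^'(G / U) in nilGU *.
have p'K : p^'.-group K := pcore_pgroup _ _.
have nKP : P / U \subset 'N(K).
  by rewrite (subset_trans (quotientS _ sPG)) ?gFnorm.
have pPU : p.-group (P / U) := quotient_pgroup _ pP.
have coK : coprime #|K| #|P / U| by rewrite coprime_sym (pnat_coprime pPU).
have ntK : K != 1.
  apply: contra not_nilG => /eqP K1.
  apply: (normal_p_nilpotent_ext nsUG); last exact: pgroup_p_nilpotent.
  have := card_Hall nilGU; rewrite /= -/K K1 cards1 => /esym/eqP.
  by rewrite partG_eq1 pgroupNK.
have [q pr_q q_dv_K] : {q | prime q & q %| #|K|}.
  by apply: pdivP; rewrite cardG_gt1.
have [Qb sylQb nQbP] := sol_coprime_Sylow_exists q (pgroup_sol pPU) nKP coK.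
pose Q1 := 'Z(Qb)%G.
have sQ1K : Q1 \subset K := subset_trans (center_sub _) (pHall_sub sylQb).
have p'Q1 : p^'.-group Q1 := pgroupS sQ1K p'K.
have abQ1 : abelian Q1 := center_abelian _.
have nQ1P : P / U \subset 'N(Q1) := char_norm_trans (center_char _) nQbP.
have ntQ1 : Q1 :!=: 1.
  rewrite /= center_nil_eq1 ?(pgroup_nil (pHall_pgroup sylQb)) //.
  by rewrite -cardG_gt1 (card_Hall sylQb) p_part_gt1 mem_primes pr_q cardG_gt0.
(* A p-nilpotent subgroup containing U is a p-group, because C_G(U) is contained
   in U. *)
have defGU : Q1 <*> (P / U) = G / U.
  have sQPG : Q1 <*> (P / U) \subset G / U.
    by rewrite join_subG quotientS // (subset_trans sQ1K) ?pcore_sub.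
  pose H := (coset U @*^-1 (Q1 <*> (P / U)))%G.
  have sHG : H \subset G by rewrite -(quotientGK nsUG) morphpreS.
  have sPH : P \subset H by rewrite -sub_quotient_pre // joing_subr.
  have defH : H / U = Q1 <*> (P / U) by rewrite cosetpreK.
  apply/eqP; rewrite eqEsubset sQPG /= -defH quotientS //.
  apply: contraR ntQ1 => notsGH.
  have nilH : p_nilpotent p H by apply: IHH; rewrite // properE sHG.
  have nsOH := pcore_normal p^' H.
  have nsUH : U <| H := normalS (subset_trans sUP sPH) sHG nsUG.
  have sOU : 'O_p^'(H) \subset U.
    apply: subset_trans cUU; rewrite subsetI (subset_trans (normal_sub nsOH)) //=.
    apply/commG1P/trivgP.
    have <- : 'O_p^'(H) :&: U = 1.
      by rewrite setIC coprime_TIg // (pnat_coprime pU) //; apply: pcore_pgroup.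
    rewrite commg_subI //.
      by rewrite subsetI subxx (subset_trans (normal_sub nsOH)) ?normal_norm.
    by rewrite subsetI subxx (subset_trans (normal_sub nsUH)) ?normal_norm.
  have pH : p.-group H.
    have := card_Hall nilH; rewrite /= (_ : 'O_p^'(H) = 1).
      by rewrite cards1 => /esym/eqP; rewrite partG_eq1 pgroupNK.
    apply/eqP; rewrite trivg_card1 -(@pnat_1 p #|'O_p^'(H)|) //.
      exact: pgroupS sOU pU.
    exact: pcore_pgroup.
  have pQ1 : p.-group Q1.
    have sQ1H : Q1 \subset H / U by rewrite defH joing_subl.
    exact: pgroupS sQ1H (quotient_pgroup _ pH).
  by rewrite trivg_card1 -(pnat_1 pQ1 p'Q1).
have ntP : P :!=: 1 by apply: contra ntU => /eqP P1; rewrite -subG1 -P1.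
pose V := 'Ohm_1('Z(U))%G.
have sVZ : V \subset 'Z(U) := Ohm_sub 1 _.
have sVU : V \subset U := subset_trans sVZ (center_sub _).
have pV := pgroupS sVU pU.
have abelV : p.-abelem V.
  by apply: Ohm1_abelem (center_abelian _); apply: pgroupS (center_sub _) pU.
have cUV : V \subset 'C(U) := subset_trans sVZ (subsetIr _ _).
have nsVG : V <| G.
  apply: char_normal_trans nsUG; apply: char_trans (center_char _).
  exact: Ohm_char.
have sVP := subset_trans sVU sUP.
have cGV : 'C_G(V) \subset U.
  have nsCG : 'C_G(V) <| G by rewrite norm_normalI // norms_cent // normal_norm.
  apply: normP; first exact: nsCG.
  pose Z := 'Ohm_1('Z(P))%G.
  have chZ : Z \char P := char_trans (Ohm_char 1 _) (center_char P).
  have ntZ : Z :!=: 1.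
    by rewrite /= Ohm1_eq1 center_nil_eq1 ?(pgroup_nil pP).
  apply: p_nilpotentS (locG Z chZ ntZ); rewrite setIS //.
  apply: subset_trans (cent_sub _); rewrite centS //= OhmS // subsetI.
  have sZU : 'Z(P) \subset U.
    apply: subset_trans cUU; rewrite subsetI subIset ?sPG //=.
    by rewrite (subset_trans (subsetIr _ _)) ?centS.
  by rewrite sZU (subset_trans (subsetIr _ _)) ?centS.
have [sJU | ] := boolP (Thompson_subgroup p P \subset U).
  case/negP: not_nilG.
  have chJ := Thompson_char p P.
  have nsJ : Thompson_subgroup p P <| G.
    rewrite -(ThompsonS sUP sJU); apply: char_normal_trans nsUG.
    exact: (Thompson_char p 'O_p(G)%G).
  have := locG (Thompson_subgroup_group p P) chJ (Thompson_neq1 pr_p pP ntP).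
  by rewrite (setIidPl (normal_norm nsJ)).
rewrite gen_subG => /bigcupsP; case=> E EP; apply: contraT => notsEU.
have [sEP abelE oE] := pnElemP EP.
have abE := abelem_abelian abelE; have pE := abelem_pgroup abelE.
have nUE := subset_trans sEP nUP; have sEG := subset_trans sEP sPG.
have sQpG : coset U @*^-1 Q1 \subset G.
  by rewrite -(quotientGK nsUG) morphpreS // (subset_trans sQ1K) ?pcore_sub.
have lt_EV : #|E / U| * #|'C_V(E)| < #|V|.
  apply: (@abelem_quotient_fix_bound _ p 'O_p(G)%G E V Q1) => //.
  - exact: morphim_abelem.
  - by rewrite -subG1 quotient_sub1.
  - exact: abelem_abelian abelV.
  - exact: subset_trans (quotientS _ sEP) nQ1P.
  - exact: subset_trans sEG (normal_norm nsVG).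
  - exact: subset_trans sQpG (normal_norm nsVG).
  - apply/trivgP; rewrite -(trivg_pcore_quotient p G).
    apply: subset_trans (_ : 'C_(P / U)(Q1) \subset _).
      by rewrite setSI ?quotientS.
    apply: pcore_max; first exact: pgroupS (subsetIl _ _) pPU.
    rewrite /normal subIset ?quotientS //= -defGU join_subG.
    rewrite cents_norm /=; last by rewrite centsC subsetIr.
    by rewrite normsI ?normG // norms_cent.
  exact: subset_trans (setSI _ sQpG) cGV.
case/negP: (ltn_geF lt_EV).
pose EU := (E :&: U)%G.
have cEUV : V \subset 'C(EU) by rewrite (subset_trans cUV) ?centS ?subsetIr.
have abelE2 : p.-abelem (EU <*> V).
  rewrite (cprod_abelem p (cprodEY cEUV)) abelV andbT.
  exact: abelemS (subsetIl _ _) abelE.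
have sE2P : EU <*> V \subset P by rewrite join_subG sVP subIset ?sEP.
have le_E2 : #|EU <*> V| <= #|E|.
  rewrite (card_pgroup pE) (card_pgroup (abelem_pgroup abelE2)).
  rewrite leq_exp2l ?prime_gt1 // oE logn_le_p_rank //.
  by apply/pElemP.
rewrite -(leq_pmul2l (cardG_gt0 EU)) mulnA.
have -> : (#|EU| * #|E / U| = #|E|)%N by rewrite card_quotient // LagrangeI.
apply: leq_trans (_ : #|EU <*> V| * #|'C_V(E)| <= _); last first.
  by rewrite leq_mul2r le_E2 orbT.
rewrite mul_cardG -cent_joinEr // leq_mul2l subset_leq_card ?orbT //.
rewrite subsetI subsetIr /= subIset // subIset //.
by rewrite (subset_trans _ abE).
Qed.

End Thompson.

(** * Fixed-point-free automorphisms and Frobenius kernels *)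

Section FixFree.

Implicit Type gT : finGroupType.

Lemma prime_fixfree_coprime gT (N R : {group gT}) :
  prime #|R| -> R \subset 'N(N) -> 'C_N(R) = 1 -> coprime #|N| #|R|.
Proof.
move=> pr_r nNR fixR; rewrite coprime_sym prime_coprime //.
have rR : #|R|.-group R by rewrite /pgroup pnat_id.
have := pgroup_fix_mod rR (_ : [acts R, on N | 'J]); rewrite astabsJ => /(_ nNR).
rewrite afixJ fixR cards1 /dvdn => ->.
by rewrite modn_small ?prime_gt1.
Qed.

(** All Sylow subgroups of N are normal.  For a prime q <> p let S be an R-invariant
    Sylow q-subgroup.  The Frobenius group S R acts on [V, S] and neither factor has
    fixed points there, so [Frobenius_compl_fix] gives [V, S] = 1; then S is
    characteristic in V S, the preimage of a Sylow subgroup of N / V, which is normal. *)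
Lemma nilpotent_by_abelem gT (N R V : {group gT}) p :
    prime #|R| -> R \subset 'N(N) -> 'C_N(R) = 1 ->
    V <| N -> R \subset 'N(V) -> p.-abelem V -> prime p ->
    nilpotent (N / V) -> nilpotent N.
Proof.
move=> pr_r nNR fixR nsVN nVR abelV pr_p nilNV.
have coNR := prime_fixfree_coprime pr_r nNR fixR.
have solR : solvable R by rewrite abelian_sol // cyclic_abelian // prime_cyclic.
have pV := abelem_pgroup abelV; have abV := abelem_abelian abelV.
have [sVN nVN] := andP nsVN.
suffices nsQ q (Q : {group gT}) : prime q -> q.-Sylow(N) Q -> Q <| N.
  rewrite -{1}(Sylow_gen N); apply: nilpotentS (Fitting_nil N).
  rewrite gen_subG; apply/bigcupsP=> Q /SylowP[q pr_q sylQ].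
  by rewrite Fitting_max ?(nsQ q) // (pgroup_nil (pHall_pgroup sylQ)).
move=> pr_q sylQ.
have nsVQ (S : {group gT}) : q.-Sylow(N) S -> V <*> S <| N.
  move=> sylS; have nVS := subset_trans (pHall_sub sylS) nVN.
  have sylSV := quotient_pHall nVS sylS.
  have := pcore_normal q (N / V); rewrite -(nilpotent_Hall_pcore nilNV sylSV).
  rewrite /= -(quotientYidl nVS) -cosetpre_normal !quotientGK //.
  by rewrite /normal joing_subl join_subG normG.
have [eq_qp | neq_qp] := eqVneq q p.
  suffices <- : V <*> Q = Q by apply: nsVQ.
  apply/joing_idPr; rewrite -[gval V]/(gval V).
  apply: (normal_sub_max_pgroup (Hall_max sylQ) _ nsVN).
  by rewrite eq_qp.
have [S sylS nSR] := sol_coprime_Sylow_exists q solR nNR coNR.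
suffices nsSN : S <| N.
  by have [x Nx ->] := Sylow_trans sylS sylQ; rewrite -(conjGid Nx) normalJ.
have sSN := pHall_sub sylS; have nVS := subset_trans sSN nVN.
have qS := pHall_pgroup sylS.
have coVS : coprime #|V| #|S|.
  apply: pnat_coprime pV (pi_pnat qS _).
  by rewrite !inE.
have cVS : S \subset 'C(V).
  have [-> | ntS] := eqVneq (S : {set gT}) 1; first exact: sub1G.
  have tiSR : S :&: R = 1.
    by rewrite coprime_TIg // (coprimeSg sSN).
  have ntR : R :!=: 1 by rewrite -cardG_gt1 prime_gt1.
  have frobSR : [Frobenius S <*> R = S ><| R].
    apply/prime_FrobeniusP => //.
    split; first by rewrite sdprodEY.
    by apply/trivgP; rewrite -fixR setSI.
  have nVSR : S <*> R \subset 'N(V) by rewrite join_subG nVS.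
  rewrite centsC; apply/commG1P.
  have sV1V : [~: V, S] \subset V by rewrite commg_subl.
  apply: (Frobenius_compl_fix frobSR).
  - exact: abelianS sV1V abV.
  - rewrite join_subG normsR ?normG //= ?nSR //.
    by rewrite normsR.
  - exact: coprimeSg sV1V coVS.
  - exact: coprime_abel_cent_TI.
  by apply/trivgP; rewrite -fixR setSI // (subset_trans sV1V).
have sylSVS : q.-Sylow(V <*> S) S.
  by apply: pHall_subl sylS; rewrite ?joing_subr // join_subG sVN.
have nsS : S <| V <*> S.
  by rewrite /normal joing_subr join_subG normG cents_norm // centsC.
rewrite -(normal_Hall_pcore sylSVS nsS).
exact: char_normal_trans (pcore_char _ _) (nsVQ S sylS).
Qed.

(** Thompson's theorem on fixed-point-free automorphisms of prime order.  In a
    minimal counterexample, [nilpotent_by_abelem] shows that N has no proper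
    nontrivial R-invariant normal subgroup.  Let P be an R-invariant Sylow p-subgroup
    for an odd p.  The normalisers of the characteristic subgroups of P are proper
    and R-invariant, hence nilpotent, so N has a normal p-complement; it is invariant,
    and so trivial or equal to N. *)
Theorem prime_fixfree_nilpotent gT (N R : {group gT}) :
  prime #|R| -> R \subset 'N(N) -> 'C_N(R) = 1 -> nilpotent N.
Proof.
have [n] := ubnP #|N|; elim: n gT N R => // n IHn gT N R leNn pr_r nNR fixR.
have coNR := prime_fixfree_coprime pr_r nNR fixR.
have solR : solvable R by rewrite abelian_sol // cyclic_abelian // prime_cyclic.
have IHM (M : {group gT}) : M \proper N -> R \subset 'N(M) -> nilpotent M.
  move=> prMN nMR; apply: IHn pr_r nMR _.
    by rewrite -ltnS (leq_trans _ leNn) // ltnS proper_card.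
  by apply/trivgP; rewrite -fixR setSI ?proper_sub.
have [M /and4P[nsMN nMR ntM neqMN] | noM] :=
    pickP (fun M : {group gT} =>
      [&& M <| N, R \subset 'N(M), M :!=: 1 & M :!=: N]).
  have nilM : nilpotent M by rewrite IHM // properEneq neqMN normal_sub.
  have [p pr_p p_dv_M] : {p | prime p & p %| #|M|} by apply: pdivP; rewrite cardG_gt1.
  pose V := 'Ohm_1('Z('O_p(M)))%G.
  have chVM : V \char M.
    by rewrite (char_trans (Ohm_char 1 _)) // (char_trans (center_char _)) ?pcore_char.
  have pO : p.-group 'O_p(M) := pcore_pgroup p M.
  have abelV : p.-abelem V.
    by apply: Ohm1_abelem (center_abelian _); apply: pgroupS (center_sub _) pO.
  have ntV : V :!=: 1.
    rewrite /= Ohm1_eq1 center_nil_eq1 ?(pgroup_nil pO) //.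
    rewrite -cardG_gt1 (card_Hall (nilpotent_pcore_Hall p nilM)).
    by rewrite p_part_gt1 mem_primes pr_p cardG_gt0.
  have nsVN := char_normal_trans chVM nsMN; have nVR := char_norm_trans chVM nMR.
  apply: (nilpotent_by_abelem pr_r nNR fixR nsVN nVR abelV pr_p).
  have tiRV : V :&: R = 1 by rewrite coprime_TIg // (coprimeSg (normal_sub nsVN)).
  apply: (IHn _ (N / V)%G (R / V)%G).
  - by rewrite -ltnS (leq_trans _ leNn) // ltnS ltn_quotient // normal_sub.
  - by rewrite -(card_isog (quotient_isog nVR tiRV)).
  - exact: quotient_norms.
  rewrite /= -strongest_coprime_quotient_cent ?fixR ?quotient1 ?solR ?orbT //.
  - by rewrite subIset // normal_sub.
  by rewrite (coprimeSg _ coNR) // subIset // normal_sub.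
have minN (M : {group gT}) : M <| N -> R \subset 'N(M) -> M :!=: 1 -> M :=: N.
  move=> nsMN nMR ntM; apply/eqP; have := noM M.
  by rewrite nsMN nMR ntM => /negbFE.
have [pN | not2N] := boolP (2.-group N); first exact: pgroup_nil pN.
have [p pr_p p_dv] : {p | prime p & p %| (#|N|`_(2^'))%N}.
  apply: pdivP; rewrite ltn_neqAle part_gt0 andbT eq_sym.
  by rewrite partG_eq1 pgroupNK.
have odd_p : odd p.
  have := dvdn_odd p_dv; rewrite odd_2'nat; apply; exact: part_pnat.
have p_dv_N : p %| #|N| := dvdn_trans p_dv (dvdn_part _ _).
have [P sylP nPR] := sol_coprime_Sylow_exists p solR nNR coNR.
have sPN := pHall_sub sylP; have pP := pHall_pgroup sylP.
have ntP : P :!=: 1.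
  by rewrite -cardG_gt1 (card_Hall sylP) p_part_gt1 mem_primes pr_p cardG_gt0.
have [nsPN | not_nsPN] := boolP (P <| N).
  by rewrite -(minN P) // (pgroup_nil pP).
have locN : local_p_nilpotent p N P.
  move=> X chX ntX; apply: nilpotent_p_nilpotent; apply: IHM.
    rewrite properE subsetIl /=; apply: contra not_nsPN => sNX.
    have nsXN : X <| N.
      by rewrite /normal (subset_trans (char_sub chX)) // (subset_trans sNX) ?subsetIr.
    have XN : X :=: N by apply: minN => //; apply: char_norm_trans chX nPR.
    rewrite (_ : P :=: N) ?normal_refl //; apply/eqP.
    by rewrite eqEsubset sPN -{1}XN char_sub.
  by rewrite normsI ?norms_norm // (char_norm_trans chX nPR).
have nilpN := Thompson_p_nilpotent pr_p odd_p sylP locN.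
have [O1 | ntO] := eqVneq ('O_p^'(N)) 1.
  apply: (pgroup_nil (p := p)); apply: p_nilpotent_normal_pgroup O1 nilpN.
  exact: normal_refl.
have ON : 'O_p^'(N) = N.
  apply: minN => //; first exact: pcore_normal.
  exact: char_norm_trans (pcore_char _ _) nNR.
have := pcore_pgroup p^' N; rewrite ON => /pgroupP/(_ p pr_p p_dv_N).
by rewrite !inE eqxx.
Qed.

(** An element of prime order of a complement acts on K without fixed points. *)
Theorem Frobenius_kernel_nilpotent gT (G K : {group gT}) :
  [Frobenius G with kernel K] -> nilpotent K.
Proof.
case/existsP=> H frobG; have [defG _ ntH _ _] := Frobenius_context frobG.
have [_ _ nKH _] := sdprodP defG.
have [r pr_r r_dv_H] : {r | prime r & r %| #|H|} by apply: pdivP; rewrite cardG_gt1.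
have [x Hx ox] := Cauchy pr_r r_dv_H.
apply: (@prime_fixfree_nilpotent _ _ <[x]>%G); rewrite -?orderE ?ox //.
  by rewrite cycle_subG (subsetP nKH).
rewrite /= cent_cycle (Frobenius_reg_ker frobG) // !inE Hx andbT.
by rewrite -order_gt1 ox prime_gt1.
Qed.

End FixFree.

(** * Quadratic fields and Galois conjugation *)

Import GRing.Theory Num.Theory.

Local Notation algC_aut := {rmorphism algC -> algC}.

(** Such a field is generated by one root of a monic quadratic polynomial over Q, and
    an automorphism can only fix this root or exchange it with the other one. *)
Lemma Qdegree_le2_aut (s : seq algC) (u1 u2 : algC_aut) : Qdegree s <= 2 ->
  [\/ {in s, forall z, u1 z = z}, {in s, forall z, u2 z = z}
    | {in s, u1 =1 u2}].
Proof.
rewrite /Qdegree; case: (num_field_exists s) => Qs [QsC [s1 Ds _]] /= dimQs.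
have QsC_alg (c : rat) : QsC (c%:A)%R = ratr c.
  by rewrite alg_num_field fmorph_rat.
have [a [b [c [gen_a a2]]]] : exists a : Qs, exists b c : rat,
  (forall z, exists d e : rat, z = d%:A + e *: a)%R
  /\ (a * a = b *: a + c%:A)%R.
  have [triv | /subvPn[a _ not1a]] := boolP ({: Qs} <= 1)%VS.
    exists 0%R, 0%R, 0%R; split; last by rewrite mulr0 scaler0 scale0r addr0.
    move=> z; have /(subvP triv)/vlineP[d ->] := memvf z.
    by exists d, 0%R; rewrite scale0r addr0.
  have gen_a z : exists d e : rat, z = (d%:A + e *: a)%R.
    have: z \in (1 + <[a]>)%VS.
      suffices ->: (1 + <[a]>)%VS = fullv by apply: memvf.
      apply/eqP; rewrite eqEdim subvf /= (leq_trans dimQs) //.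
      rewrite ltnNge; apply: contra not1a => le1.
      suffices ->: 1%VS = (1 + <[a]>)%VS :> {vspace Qs}.
        by rewrite (subvP (addvSr _ _)) ?memv_line.
      by apply/eqP; rewrite eqEdim addvSl dimv1.
    case/memv_addP=> _ /vlineP[d ->] [_ /vlineP[e ->] ->].
    by exists d, e.
  have [d [e Daa]] := gen_a (a * a)%R.
  by exists a, e, d; split; rewrite // Daa addrC.
pose al := QsC a.
have ual (u : algC_aut) : u al = al \/ u al = (ratr b - al)%R.
  have Dal : (al * al = ratr b * al + ratr c)%R.
    by rewrite -rmorphM a2 rmorphD /= QsC_alg -mulr_algl rmorphM /= QsC_alg.
  have Dual : (u al * u al = ratr b * u al + ratr c)%R.
    by rewrite -rmorphM Dal rmorphD rmorphM /= !fmorph_rat.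
  have : ((u al - al) * (u al - (ratr b - al)) = 0)%R.
    have -> : ((u al - al) * (u al - (ratr b - al))
        = (u al * u al - ratr b * u al) - (al * al - ratr b * al))%R.
      by ring.
    by rewrite Dual Dal; ring.
  by move/eqP; rewrite mulf_eq0 !subr_eq0 => /orP[] /eqP; [left | right].
have uE z : z \in s -> exists d e : rat, z = (ratr d + ratr e * al)%R /\
    forall u : algC_aut, u z = (ratr d + ratr e * u al)%R.
  rewrite -Ds => /mapP[z1 _ ->]; have [d [e ->]] := gen_a z1.
  exists d, e; rewrite rmorphD /= QsC_alg -mulr_algl rmorphM /= QsC_alg.
  by split=> // u; rewrite rmorphD rmorphM /= !fmorph_rat.
case: (ual u1) => [u1al | u1al].
  by apply: Or31 => z /uE[d [e [Dz ->]]]; rewrite u1al.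
case: (ual u2) => [u2al | u2al].
  by apply: Or32 => z /uE[d [e [Dz ->]]]; rewrite u2al.
by apply: Or33 => z /uE[d [e [_ uz]]]; rewrite !uz u1al u2al.
Qed.

Section Quadratic.

Implicit Type gT : finGroupType.

(** The degree bound is used through its effect on embeddings: of three automorphisms
    of algC, here u1, u2 and the identity, two agree on the field.  This form is
    inherited by quotients without any field theory. *)
Definition quadratic_chars gT (G : {group gT}) :=
  forall (i : Iirr G) (u1 u2 : algC_aut),
  [\/ {in G, forall g, u1 ('chi_i g)%R = ('chi_i g)%R},
      {in G, forall g, u2 ('chi_i g)%R = ('chi_i g)%R}
    | {in G, forall g, u1 ('chi_i g)%R = u2 ('chi_i g)%R}].

Definition quadratic_classes gT (G : {group gT}) :=
  forall (x : gT) (u1 u2 : algC_aut), x \in G ->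
  [\/ forall i : Iirr G, u1 ('chi_i x)%R = ('chi_i x)%R,
      forall i : Iirr G, u2 ('chi_i x)%R = ('chi_i x)%R
    | forall i : Iirr G, u1 ('chi_i x)%R = u2 ('chi_i x)%R].

Definition quadratic_group gT (G : {group gT}) :=
  quadratic_chars G \/ quadratic_classes G.

Lemma quadratic_group_of gT (G : {group gT}) :
  character_quadratic G \/ semi_rational G -> quadratic_group G.
Proof.
case=> [quadG | quadG]; [left => i u1 u2 | right => x u1 u2 Gx].
  have [] := Qdegree_le2_aut u1 u2 (quadG i) => eq_u; [apply: Or31 | apply: Or32 | apply: Or33];
    by move=> g Gg; apply: eq_u; apply/imageP; exists g.
have [] := Qdegree_le2_aut u1 u2 (quadG x Gx) => eq_u; [apply: Or31 | apply: Or32 | apply: Or33];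
  by move=> i; apply: eq_u; apply/imageP; exists i.
Qed.

Lemma quadratic_quotient gT (G N : {group gT}) :
  N <| G -> quadratic_group G -> quadratic_group (G / N).
Proof.
move=> nsNG [quadG | quadG]; [left => i u1 u2 | right => _ u1 u2 /morphimP[x Nx Gx ->]].
  have [] := quadG (mod_Iirr i) u1 u2 => eq_u; [apply: Or31 | apply: Or32 | apply: Or33];
  move=> _ /morphimP[g Ng Gg ->]; have := eq_u g Gg;
  by rewrite mod_IirrE // cfModE.
have [] := quadG x u1 u2 Gx => eq_u; [apply: Or31 | apply: Or32 | apply: Or33];
  by move=> i; have := eq_u (mod_Iirr i); rewrite mod_IirrE // cfModE.
Qed.

(** On <[x]> the character is a sum of linear characters, whose values are n-th roots
    of unity. *)
Lemma char_power_aut gT (G : {group gT}) x n k (u : algC_aut) (chi : 'CF(G)) :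
    x \in G -> #[x] %| n -> (forall z, z ^+ n = 1 -> u z = z ^+ k)%R ->
    chi \is a character ->
  u (chi x) = chi (x ^+ k).
Proof.
move=> Gx x_dv_n uE Nchi; have sXG : <[x]> \subset G by rewrite cycle_subG.
rewrite -(cfResE _ sXG (cycle_id x)) -(cfResE _ sXG (mem_cycle x k)).
have /char_sum_irr[r ->] := cfRes_char <[x]>%G Nchi.
rewrite !sum_cfunE rmorph_sum /=; apply: eq_bigr => i _.
have Lchi := irr_cyclic_lin i (cycle_cyclic x).
rewrite uE ?lin_charX ?cycle_id //.
rewrite -lin_charX ?cycle_id //; have /dvdnP[m ->] := x_dv_n.
by rewrite mulnC expgM expg_order expg1n lin_char1.
Qed.

(** The automorphism raising roots of unity to the power k sends the column of x in
    the character table to the column of x ^+ k, and distinct classes have distinct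
    columns. *)
Lemma quadratic_classes_power gT (G : {group gT}) x k1 k2 :
    quadratic_classes G -> x \in G -> coprime k1 #[x] -> coprime k2 #[x] ->
  [\/ exists2 g, g \in G & x ^ g = x ^+ k1, exists2 g, g \in G & x ^ g = x ^+ k2
    | exists2 g, g \in G & (x ^+ k1) ^ g = x ^+ k2].
Proof.
move=> quadG Gx co1 co2.
have [u1 u1E] := Qn_aut_exists co1; have [u2 u2E] := Qn_aut_exists co2.
have uE1 i := char_power_aut Gx (dvdnn _) u1E (irr_char i).
have uE2 i := char_power_aut Gx (dvdnn _) u2E (irr_char i).
have conjP y z : y \in G -> (forall i, ('chi[G]_i y = 'chi_i z)%R) -> exists2 g, g \in G & y ^ g = z.
  move=> Gy eq_yz; have /imsetP[g Gg ->] : z \in y ^: G.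
    by apply/(eq_irr_mem_classP _ Gy) => i; rewrite eq_yz.
  by exists g.
have [] := quadG x u1 u2 Gx => eq_u; [apply: Or31 | apply: Or32 | apply: Or33].
- by apply: conjP => // i; rewrite -uE1 eq_u.
- by apply: conjP => // i; rewrite -uE2 eq_u.
by apply: conjP => [|i]; rewrite ?groupX // -uE1 -uE2 eq_u.
Qed.

Lemma constt_Res_conj gT (G B : {group gT}) (i : Iirr G) (j1 j2 : Iirr B) :
    B <| G -> (j1 \in irr_constt ('Res[B] 'chi_i) -> j2 \in irr_constt ('Res[B] 'chi_i) ->
  exists2 g, g \in G & 'chi_j2 = ('chi_j1 ^ g)%CF)%R.
Proof.
move=> nsBG Res1; rewrite irr_consttE (Clifford_Res_sum_cfclass nsBG Res1).
rewrite cfdotZl mulf_eq0 negb_or => /andP[_]; rewrite cfdot_suml => nz_sum.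
have [chi /cfclassP[g Gg ->] nz_chi] : exists2 chi,
    chi \in (('chi_j1 ^: G)%CF)%R & ('[chi, 'chi_j2] != 0)%R.
  apply/hasP; apply: contraR nz_sum => /hasPn no_chi.
  by rewrite big_seq big1 // => chi /no_chi; rewrite negbK => /eqP.
exists g => //; move: nz_chi.
by rewrite -conjg_IirrE cfdot_irr pnatr_eq0 eqb0 negbK => /eqP->.
Qed.

(** If two automorphisms agree on an irreducible character of G lying above chi_j, they
    send chi_j to constituents of the same restriction, which are conjugate by
    Clifford's theorem. *)
Lemma quadratic_chars_orbit gT (G B : {group gT}) (j : Iirr B) (u1 u2 : algC_aut) :
    quadratic_chars G -> B <| G ->
  [\/ exists2 g, g \in G & (cfAut u1 'chi_j = ('chi_j ^ g)%CF)%R,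
      exists2 g, g \in G & (cfAut u2 'chi_j = ('chi_j ^ g)%CF)%R
    | exists2 g, g \in G & (cfAut u2 'chi_j = ((cfAut u1 'chi_j) ^ g)%CF)%R].
Proof.
move=> quadG nsBG; have sBG := normal_sub nsBG.
have [i Ind_i] := constt_cfInd_irr j sBG.
have Res_j : j \in irr_constt ('Res[B] 'chi_i)%R by rewrite -constt_Ind_Res.
have autP (u v : algC_aut) : {in G, forall g, u ('chi_i g)%R = v ('chi_i g)%R} ->
    exists2 g, g \in G & (cfAut u 'chi_j = (cfAut v 'chi_j ^ g)%CF)%R.
  move=> eq_uv; have eq_i : aut_Iirr u i = aut_Iirr v i.
    apply: irr_inj; rewrite !aut_IirrE; apply/cfun_inP=> g Gg.
    by rewrite !cfunE eq_uv.
  have Res_aut (w : algC_aut) : aut_Iirr w j \in irr_constt ('Res[B] 'chi_(aut_Iirr w i))%R.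
    rewrite !inE aut_IirrE -cfAutRes aut_IirrE cfdot_aut_irr.
    by rewrite fmorph_eq0.
  have := Res_aut u; rewrite eq_i => /(constt_Res_conj nsBG (Res_aut v))[g Gg].
  by rewrite !aut_IirrE => ->; exists g.
pose id1 : algC_aut := idfun.
have idE : (cfAut id1 'chi_j = 'chi_j)%R.
  by apply/cfun_inP=> g _; rewrite cfunE.
have [] := quadG i u1 u2 => eq_u.
- by apply: Or31; have := autP u1 id1 eq_u; rewrite idE.
- by apply: Or32; have := autP u2 id1 eq_u; rewrite idE.
by apply: Or33; apply: autP => g Gg; rewrite eq_u.
Qed.

(** Send x to a primitive root of unity of order #[x]. *)
Lemma cycle_faithful_irr gT (x : gT) :
  exists j : Iirr <[x]>, forall k l,
    ('chi_j (x ^+ k)%g = 'chi_j (x ^+ l)%g)%R -> x ^+ k = x ^+ l.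
Proof.
have [z prim_z] := C_prim_root_exists (order_gt0 x).
pose lg g := if [pick i : 'I_#[x] | x ^+ i == g] is Some i then val i else 0%N.
have lgK g : g \in <[x]> -> x ^+ lg g = g.
  case/cyclePmin=> m ltm ->; rewrite /lg; case: pickP => [i /eqP // | /(_ (Ordinal ltm))].
  by rewrite /= eqxx.
have zE k l : (z ^+ k == z ^+ l)%R = (x ^+ k == x ^+ l).
  by rewrite (eq_prim_root_expr prim_z) eq_expg_mod_order.
have fP : mx_repr <[x]> (fun g => (z ^+ lg g)%:M : 'M[algC]_1)%R.
  split=> [|g h Xg Xh].
    congr (_%:M)%R; apply/eqP; rewrite -(expr0 z) zE expg0.
    by rewrite lgK ?group1.
  rewrite -scalar_mxM -exprD; congr (_%:M)%R; apply/eqP.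
  by rewrite zE expgD !lgK ?groupM.
have rG := MxRepresentation fP.
pose phi := cfRepr (MxRepresentation fP).
have phiE g : g \in <[x]> -> (phi g = z ^+ lg g)%R.
  by move=> Xg; rewrite cfunE Xg mulr1n mxtrace_scalar.
have Lphi : phi \is a linear_char.
  by rewrite qualifE /= cfRepr_char cfRepr1 /=.
have /irrP[j Dphi] := lin_char_irr Lphi.
exists j => k l; rewrite -Dphi !phiE ?mem_cycle // => /eqP.
by rewrite zE !lgK ?mem_cycle // => /eqP.
Qed.

(** For characters, conjugating a faithful linear character of <[x]> by g amounts to
    conjugating x by the inverse of g. *)
Lemma quadratic_cycle_power gT (G : {group gT}) x k1 k2 :
    quadratic_group G -> <[x]> <| G -> coprime k1 #[x] -> coprime k2 #[x] ->
  [\/ exists2 g, g \in G & x ^ g = x ^+ k1, exists2 g, g \in G & x ^ g = x ^+ k2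
    | exists2 g, g \in G & (x ^+ k1) ^ g = x ^+ k2].
Proof.
move=> quadG nsxG co1 co2; have Gx : x \in G by rewrite -cycle_subG normal_sub.
case: quadG => quadG; last exact: quadratic_classes_power.
have [j inj_j] := cycle_faithful_irr x.
have [u1 u1E] := Qn_aut_exists co1; have [u2 u2E] := Qn_aut_exists co2.
have uE (u : algC_aut) k y : (forall z, z ^+ #[x] = 1 -> u z = z ^+ k)%R ->
    y \in <[x]> -> (cfAut u 'chi_j y = 'chi_j (y ^+ k)%g)%R.
  by move=> uE Xy; rewrite cfunE (char_power_aut Xy (order_dvdG Xy) uE (irr_char j)).
have nX g : g \in G -> g \in 'N(<[x]>) := subsetP (normal_norm nsxG) g.
have memJ g : g \in G -> x ^ g \in <[x]>.
  by move=> Gg; rewrite memJ_norm ?cycle_id ?nX.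
have inj y z : y \in <[x]> -> z \in <[x]> -> ('chi_j y = 'chi_j z)%R -> y = z.
  by move=> /cycleP[k ->] /cycleP[l ->]; apply: inj_j.
have case1 (u : algC_aut) k : (forall z, z ^+ #[x] = 1 -> u z = z ^+ k)%R ->
    (exists2 g, g \in G & (cfAut u 'chi_j = ('chi_j ^ g)%CF)%R) ->
    exists2 g, g \in G & x ^ g = x ^+ k.
  move=> uE' [g Gg eq_g]; exists g^-1; rewrite ?groupV //.
  apply: (conjg_inj g); rewrite conjgKV conjXg; apply: inj => //.
  - exact: cycle_id.
  - by rewrite groupX ?memJ.
  have := uE u k _ uE' (memJ g Gg); rewrite eq_g => <-.
  by rewrite cfConjgEJ ?nX.
have [g1 | g2 | [g Gg eq_g]] := quadratic_chars_orbit j u1 u2 quadG nsxG.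
- by apply: Or31; apply: case1 g1.
- by apply: Or32; apply: case1 g2.
apply: Or33; exists g^-1; rewrite ?groupV //.
apply: (conjg_inj g); rewrite conjgKV conjXg; apply: inj.
- by rewrite mem_cycle.
- by rewrite groupX ?memJ.
have := uE u2 k2 _ u2E (memJ g Gg); rewrite eq_g => <-.
by rewrite cfConjgEJ ?nX // (uE u1 k1) ?cycle_id.
Qed.

End Quadratic.

(** * The structure of quadratic 2-Frobenius groups *)

Section Structure.

Implicit Type gT : finGroupType.

(** A noncyclic elementary abelian subgroup of H contains a nontrivial subgroup with
    fixed points on Z(K), by [abelem_coprime_fix_maximal]. *)
Lemma Frobenius_compl_p_rank gT (G K H : {group gT}) p :
  [Frobenius G = K ><| H] -> 'r_p(H) <= 1.
Proof.
move=> frobG; have [defG ntK ntH ltKG ltHG] := Frobenius_context frobG.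
have [_ _ nKH _] := sdprodP defG.
have nilK : nilpotent K by apply: (@Frobenius_kernel_nilpotent _ G); apply: FrobeniusWker frobG.
rewrite leqNgt; apply/negP => /p_rank_geP[E /pnElemP[sEH abelE oE]].
have pr_p : prime p.
  by case pr_p: (prime p) => //; move: oE; rewrite lognE pr_p.
have pE := abelem_pgroup abelE.
have ntE : E :!=: 1 by apply: contra_eqN oE => /eqP->; rewrite cards1 logn1.
have p'K : p^'.-group K.
  have [_ p_dv_E _] := pgroup_pdiv pE ntE.
  rewrite p'groupEpi; apply: contraL (Frobenius_coprime frobG) => p_dv_K.
  apply: contraL p_dv_K => co; rewrite mem_primes pr_p cardG_gt0 /=.
  by rewrite -prime_coprime // coprime_sym (coprime_dvdr _ co) // (dvdn_trans p_dv_E) ?cardSg.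
have ntZ : 'Z(K) != 1 by rewrite center_nil_eq1.
have nKE := subset_trans sEH nKH.
have fixE (F : {group gT}) : F \subset E -> F :!=: 1 -> 'C_('Z(K))(F) = 1.
  move=> sFE /trivgPn[f Ff ntf]; apply/trivgP.
  rewrite -(Frobenius_reg_ker frobG (x := f)); last first.
    by rewrite !inE ntf (subsetP sEH) // (subsetP sFE).
  by rewrite -cent_cycle setISS ?center_sub // centS // cycle_subG.
have [F [sFE iF]] := abelem_coprime_fix_maximal abelE pr_p (center_abelian K)
  (pgroupS (center_sub K) p'K) (char_norm_trans (center_char K) nKE) ntZ
  (fixE E (subxx _) ntE).
rewrite fixE ?eqxx // -cardG_gt1.
have := Lagrange sFE; rewrite iF (card_pgroup pE) oE => oF.
rewrite -(ltn_pmul2r (prime_gt0 pr_p)) oF mul1n -{1}[p]expn1.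
by rewrite ltn_exp2l ?prime_gt1.
Qed.

(** The rank condition holds for the upper kernel of a 2-Frobenius group, which is also
    a complement of the lower one.  It excludes all noncyclic Sylow subgroups except the
    quaternion ones at the prime 2; but if #|K| were even, Z(O_2(K)) would contain a
    unique involution, and this would be fixed by the complements of K in G. *)
Lemma Frobenius_kernel_rank1_cyclic gT (G K : {group gT}) :
  [Frobenius G with kernel K] -> (forall p, 'r_p(K) <= 1) -> cyclic K /\ odd #|K|.
Proof.
move=> frobG rK; have nilK := Frobenius_kernel_nilpotent frobG.
have /existsP[H frobGH] := frobG.
have [defG ntK ntH ltKG ltHG] := Frobenius_context frobGH.
have [_ _ nKH _] := sdprodP defG.
have odd_K : odd #|K|.
  apply: contraR ntH; rewrite -dvdn2 => even_K.
  pose O := 'O_2(K)%G; pose Z := 'Ohm_1('Z(O))%G.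
  have pO : 2.-group O := pcore_pgroup 2 K.
  have chO : O \char K := pcore_char 2 K.
  have chZ : Z \char K.
    by rewrite (char_trans (Ohm_char 1 _)) // (char_trans (center_char _)).
  have ntZ : Z :!=: 1.
    rewrite /= Ohm1_eq1 center_nil_eq1 ?(pgroup_nil pO) //.
    rewrite -cardG_gt1 (card_Hall (nilpotent_pcore_Hall 2 nilK)).
    by rewrite p_part_gt1 mem_primes cardG_gt0.
  have abelZ : 2.-abelem Z.
    by apply: Ohm1_abelem (center_abelian _); apply: pgroupS (center_sub _) pO.
  have oZ : #|Z| = 2.
    have rZ : logn 2 #|Z| <= 1.
      by rewrite -p_rank_abelem // (leq_trans (p_rankS _ (char_sub chZ))) ?rK.
    apply/eqP; rewrite eqn_leq cardG_gt1 ntZ andbT.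
    by rewrite (card_pgroup (abelem_pgroup abelZ)) (leq_exp2l _ 1).
  have regZ : semiregular Z H.
    apply: semiregularS (Frobenius_reg_ker frobGH) => //.
    exact: char_sub.
  have nZH := char_norm_trans chZ nKH.
  by have := regular_norm_dvd_pred nZH regZ; rewrite oZ dvdn1 -trivg_card1.
split=> //; apply: nil_Zgroup_cyclic => //.
apply/forall_inP=> P /SylowP[p pr_p sylP].
rewrite (odd_pgroup_rank1_cyclic (pHall_pgroup sylP)); last exact: oddSg (pHall_sub sylP) odd_K.
by rewrite (p_rank_Sylow sylP).
Qed.

(** With the exponents k and k ^ 2, each of the three alternatives of
    [quadratic_cycle_power] gives the same conclusion. *)
Lemma quadratic_cycle_square gT (G : {group gT}) x k :
    quadratic_group G -> <[x]> <| G -> coprime k #[x] ->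
  exists2 g, g \in G & x ^ g = x ^+ (k ^ 2).
Proof.
move=> quadG nsxG cok; have cok2 : coprime (k ^ 2) #[x] by rewrite coprimeXl.
have power g : g \in G -> x ^ g = x ^+ k -> exists2 g, g \in G & x ^ g = x ^+ (k ^ 2).
  by move=> Gg xg; exists (g * g); rewrite ?groupM // conjgM xg conjXg xg -expgM.
have [[g Gg xg] | // | [g Gg xg]] := quadratic_cycle_power quadG nsxG cok cok2.
  exact: power g Gg xg.
apply: (power g Gg); have: x ^ g \in <[x]>.
  by rewrite memJ_norm ?cycle_id // (subsetP (normal_norm nsxG)).
move=> Xxg; have co : coprime #|<[x]>| k by rewrite coprime_sym -orderE.
apply: (can_in_inj (expgK co)) => //; first exact: mem_cycle.
by rewrite /= -conjXg xg expnS expn1 expgM.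
Qed.

(** Suppose that n = #|K| is not prime.  Then some unit k modulo n fixes a proper power
    x ^+ d of x after squaring, while k ^ 2 is not 1 modulo n: k = 1 + n / p when p ^ 2
    divides n, and otherwise a k given by the Chinese remainder theorem.  An element
    that conjugates x to x ^+ (k ^ 2) centralises x ^+ d, hence lies in K and centralises
    x, a contradiction. *)
Lemma Frobenius_quadratic_kernel_prime gT (G K : {group gT}) :
    [Frobenius G with kernel K] -> quadratic_group G -> cyclic K -> odd #|K| ->
  prime #|K|.
Proof.
move=> frobG quadG /cyclicP[x defK] oddK.
have [ntK _ nsKG cGK] := Frobenius_kerP frobG.
have ntx : 1 < #[x] by rewrite order_gt1 -cycle_eq1 -defK.
rewrite defK -orderE in oddK *; set n := #[x] in ntx oddK *.
have fixsq k d : coprime k n -> x ^+ d != 1 -> x ^+ (d * k ^ 2)%N = x ^+ d ->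
    k ^ 2 = 1 %[mod n].
  move=> cok ntd xd; have nsxG : <[x]> <| G by rewrite -defK.
  have [g Gg xg] := quadratic_cycle_square quadG nsxG cok.
  have Kxd : x ^+ d \in K^# by rewrite !inE ntd defK mem_cycle.
  have Kg : g \in K.
    apply: (subsetP (cGK _ Kxd)); rewrite inE Gg; apply/cent1P/commute_sym.
    by apply/commgP/conjg_fixP; rewrite conjXg xg -expgM mulnC.
  apply/eqP; rewrite -eq_expg_mod_order expg1 -xg; apply/eqP/conjg_fixP/commgP.
  move: Kg; rewrite defK => /cycleP[l ->]; exact: commuteX.
have ndvd d : ~~ (n %| d) -> x ^+ d != 1 by rewrite order_dvdn.
(* The unit k is 1 modulo a and 2 modulo b; then 4 = 1 modulo b. *)
have two_parts a b : (a * b)%N = n -> coprime a b -> 1 < a -> b <= 3.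
  move=> nab coab a_gt1; rewrite leqNgt; apply/negP => b_gt3.
  pose k := chinese a b 1 2.
  have ka : k = 1 %[mod a] by apply: chinese_modl.
  have kb : k = 2 %[mod b] by apply: chinese_modr.
  have odd_b : odd b by move: oddK; rewrite -nab oddM => /andP[].
  have cok : coprime k n.
    rewrite -nab coprimeMr -coprime_modl ka coprime_modl coprime1n /=.
    by rewrite -coprime_modl kb coprime_modl coprime2n.
  have: k ^ 2 = 1 %[mod n].
    apply: (@fixsq k b cok).
      apply: ndvd; rewrite -nab -{2}[b]mul1n dvdn_pmul2r ?(ltn_trans _ b_gt3) //.
      by rewrite dvdn1 neq_ltn a_gt1 orbT.
    apply/eqP; rewrite eq_expg_mod_order -/n -nab mulnC -[in X in _ == X %[mod _]](mul1n b).
    rewrite -!muln_modl ?(ltn_trans _ b_gt3) //.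
    by rewrite -modnXm ka modnXm.
  move/eqP; rewrite -nab => /eqP k1; have : 4 = 1 %[mod b].
    have: k ^ 2 = 1 %[mod b].
      have b_dv : b %| a * b := dvdn_mull a (dvdnn b).
      by rewrite -(modn_dvdm (k ^ 2) b_dv) k1 modn_dvdm.
    by rewrite -modnXm kb modnXm.
  move/eqP; rewrite eqn_mod_dvd // => b_dv.
  by have := leq_trans b_gt3 (dvdn_leq (isT : 0 < 4 - 1) b_dv).
have [p pr_p p_dv] := pdivP ntx.
have [-> // | neq] := eqVneq n p.
have /dvdnP[b nb] := p_dv.
have odd_p : odd p by apply: dvdn_odd p_dv oddK.
have b_gt0 : 0 < b by move: ntx; rewrite nb; case: (b).
have b_gt1 : 1 < b.
  by rewrite ltn_neqAle b_gt0 andbT; apply: contraNneq neq => b1; rewrite nb -b1 mul1n.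
have [p_dv_b | p'b] := boolP (p %| b).
  have cok : coprime b.+1 n.
    by rewrite nb coprimeMr coprimeSn (coprime_dvdr p_dv_b) // coprimeSn.
  have: b.+1 ^ 2 = 1 %[mod n].
    apply: (@fixsq b.+1 p cok).
      apply: ndvd; rewrite nb -{2}[p]mul1n dvdn_pmul2r ?prime_gt0 //.
      by rewrite dvdn1 neq_ltn b_gt1 orbT.
    apply/eqP; rewrite eq_expg_mod_order -/n nb mulnC -[in X in _ == X %[mod _]](mul1n p).
    rewrite -!muln_modl ?prime_gt0 //.
    by rewrite -modnXm -add1n modnDr modnXm.
  move/eqP; rewrite eqn_mod_dvd ?expn_gt0 // nb.
  have -> : (b.+1 ^ 2 - 1 = b * (b + 2))%N by rewrite -addn1 sqrnD; lia.
  rewrite dvdn_pmul2l // dvdn_addr // dvdn_prime2 // => /eqP p2.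
  by rewrite p2 in odd_p.
have co_pb : coprime p b by rewrite prime_coprime.
have le_b : b <= 3 by apply: (two_parts p b); rewrite ?prime_gt1 // mulnC nb.
have le_p : p <= 3 by apply: (two_parts b p); rewrite // coprime_sym.
have odd_b : odd b by move: oddK; rewrite nb oddM => /andP[].
move: odd_p odd_b p'b pr_p b_gt1.
by case: (p) le_p => [|[|[|[|]]]] // _; case: (b) le_b => [|[|[|[|]]]].
Qed.

(** Taking k2 = m - 1 excludes all units strictly between 1 and m - 1; such units exist
    except for the four values listed. *)
Lemma two_units_le6 m : 1 < m ->
    (forall k1 k2, coprime k1 m -> coprime k2 m ->
       [\/ k1 = 1 %[mod m], k2 = 1 %[mod m] | k1 = k2 %[mod m]]) ->
  m \in [:: 2; 3; 4; 6].
Proof.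
move=> m_gt1 units; rewrite !inE.
have co1 : coprime m.-1 m by rewrite coprimePn // ltnW.
have [le6 | m_gt6] := leqP m 6.
  have [m5 | neq5] := eqVneq m 5; last first.
    by move: m_gt1 neq5 le6; case: (m) => [|[|[|[|[|[|[|]]]]]]].
  have [] // := units 2 4; by rewrite m5.
suffices [k /andP[k_gt1 ltk] cok] : exists2 k, 1 < k < m.-1 & coprime k m.
  have [] := units k m.-1 cok co1; rewrite !modn_small //; lia.
have [odd_m | even_m] := boolP (odd m).
  by exists 2; rewrite ?coprime2n //; lia.
have [j mj] : exists j, m = (2 * j)%N by exists m./2; lia.
have coj k : coprime k 2 -> coprime k j -> coprime k m.
  by move=> ? ?; rewrite mj coprimeMr; apply/andP.
have [odd_j | even_j] := boolP (odd j).
  exists (j + 2)%N; first lia.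
  apply: coj; first by rewrite coprimen2 oddD odd_j.
  by rewrite coprime_sym /coprime gcdnDl -/(coprime _ _) coprimen2.
exists j.+1; first lia.
by apply: coj; rewrite ?coprimen2 ?coprimeSn //= even_j.
Qed.

(** H embeds in the cyclic group Aut K.  As K is abelian, classes of G in K are H-orbits,
    and the nontrivial elements of K fall into at most two of them.  In the abelian
    quotient G / K conjugation is trivial, so the units modulo #|H| satisfy the condition
    of [two_units_le6]. *)
Lemma Frobenius_quadratic_complement gT (G K H : {group gT}) :
    [Frobenius G = K ><| H] -> quadratic_group G -> prime #|K| ->
  [/\ cyclic H, #|H| \in [:: 2; 3; 4; 6], #|H| %| #|K|.-1
     & #|K|.-1 <= 2 * #|H|].
Proof.
move=> frobG quadG pr_K.
have [defG ntK ntH ltKG ltHG] := Frobenius_context frobG.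
have [nsKG sHG mulKH nKH tiKH] := sdprod_context defG.
have [x defK] : exists x, K :=: <[x]> by apply/cyclicP; apply: prime_cyclic.
have Kx : x \in K by rewrite defK cycle_id.
have cycH : cyclic H.
  pose f := restrm nKH (conj_aut K).
  have injf : 'injm f.
    rewrite ker_restrm ker_conj_aut; have [y Ky nty] := trivgPn _ ntK.
    rewrite -(Frobenius_reg_compl frobG (x := y)) ?inE ?nty //.
    by rewrite -cent_cycle setIS // centS // cycle_subG.
  rewrite -(injm_cyclic injf) //; apply: cyclicS (Aut_prime_cyclic pr_K).
  by rewrite /= morphim_restrm Aut_conj_aut.
split=> //; last 2 first.
- exact: Frobenius_dvd_ker1 frobG.
- have classK y z : y \in K -> (exists2 g, g \in G & y ^ g = z) -> z \in y ^: H.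
    move=> Ky [g Gg <-]; move: Gg; rewrite -mulKH => /mulsgP[l h Kl Hh ->].
    apply/imsetP; exists h => //; rewrite conjgM; congr (_ ^ _).
    apply/conjg_fixP/commgP; apply: (centsP (cyclic_abelian (prime_cyclic pr_K))) => //.
  have leH y : #|y ^: H| <= #|H| by apply: leq_imset_card.
  have cov y1 y2 : y1 \in K^# -> y2 \in K^# ->
     [|| y1 \in x ^: H, y2 \in x ^: H | y2 \in y1 ^: H].
    have powK y : y \in K^# -> exists2 k, coprime k #[x] & y = x ^+ k.
      case/setD1P=> nty; rewrite {1}defK => /cycleP[k def_y]; exists k => //.
      rewrite coprime_sym prime_coprime; last by rewrite orderE -defK.
      by rewrite order_dvdn -def_y.
    move=> Ky1 Ky2; have [k1 co1 D1] := powK _ Ky1; have [k2 co2 D2] := powK _ Ky2.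
    have nsxG : <[x]> <| G by rewrite -defK.
    have [] := quadratic_cycle_power quadG nsxG co1 co2; rewrite -?D1 -?D2.
    - by move/(classK _ _ Kx)->.
    - by move/(classK _ _ Kx)->; rewrite orbT.
    by case/setD1P: Ky1 => _ Ky1 /(classK _ _ Ky1)->; rewrite !orbT.
  have -> : #|K|.-1 = #|K^#| by rewrite (cardsD1 1 K) group1.
  have [sKx | /subsetPn[y Ky notxy]] := boolP (K^# \subset x ^: H).
    apply: leq_trans (subset_leq_card sKx) _; apply: leq_trans (leH x) _.
    by rewrite leq_pmull.
  have sKU : K^# \subset x ^: H :|: y ^: H.
    apply/subsetP=> z Kz; rewrite inE; have := cov y z Ky Kz.
    by rewrite (negPf notxy).
  apply: leq_trans (subset_leq_card sKU) _; apply: leq_trans (leq_card_setU _ _) _.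
  by rewrite mul2n -addnn leq_add.
have [h defH] := cyclicP cycH.
have nKG := normal_norm nsKG; have nKh : h \in 'N(K).
  by apply: (subsetP nKH); rewrite defH cycle_id.
have defGK : G / K = <[coset K h]>.
  by rewrite -mulKH quotientMidl -quotient_cycle // -defH.
have oh : #[coset K h] = #|H|.
  rewrite orderE -defGK card_quotient // -(divgS (normal_sub nsKG)).
  by rewrite -(sdprod_card defG) mulKn.
apply: two_units_le6; first by rewrite cardG_gt1.
rewrite -oh => k1 k2 co1 co2.
have cent (y : coset_of K) g : y \in G / K -> g \in G / K -> y ^ g = y.
  move=> Gy Gg; apply/conjg_fixP/commgP; apply: (centsP _ y Gy g Gg).
  by rewrite defGK; apply: cycle_abelian.
have Gh k : coset K h ^+ k \in G / K by rewrite defGK mem_cycle.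
have nsh : <[coset K h]> <| G / K by rewrite -defGK.
have eq1 k g : g \in G / K -> coset K h ^ g = coset K h ^+ k ->
    k = 1 %[mod #[coset K h]].
  move=> Gg; rewrite (cent _ g (Gh 1%N)) // => eq_k.
  by apply/eqP; rewrite -eq_expg_mod_order expg1 -eq_k.
have := quadratic_cycle_power (quadratic_quotient nsKG quadG) nsh co1 co2.
case=> [[g Gg /(eq1 _ _ Gg)] | [g Gg /(eq1 _ _ Gg)] | [g Gg]].
- exact: Or31.
- exact: Or32.
by rewrite cent // => /eqP; rewrite eq_expg_mod_order => /eqP; apply: Or33.
Qed.

(** The shape of a quadratic 2-Frobenius group: N and N <*> R are the two normal
    subgroups, and A is a complement of N that contains R and H. *)
Record Frobenius_tower gT (G N A R H : {group gT}) : Prop := FrobeniusTower {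
  tower_sdprod : N ><| A = G;
  tower_nil : nilpotent N;
  tower_neq1 : N :!=: 1;
  tower_Frobenius : [Frobenius A = R ><| H];
  tower_regular : semiregular N R;
  tower_prime : prime #|R|;
  tower_cyclic : cyclic H;
  tower_compl : #|H| \in [:: 2; 3; 4; 6];
  tower_dvd : #|H| %| #|R|.-1;
  tower_bound : #|R|.-1 <= 2 * #|H|
}.

Lemma tower_cases gT (G N A R H : {group gT}) :
  Frobenius_tower G N A R H ->
  (#|R|, #|H|) \in [:: (3, 2); (5, 2); (5, 4); (7, 3); (7, 6); (13, 6)].
Proof.
case=> _ _ _ _ _ pr_R _; set r := #|R| in pr_R *; set m := #|H|.
move=> om /dvdnP[k def_r] le_r.
have [r_gt1 m_gt0] := (prime_gt1 pr_R, cardG_gt0 H); rewrite -/m in m_gt0.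
have [{}def_r | {}def_r] : r = m.+1 \/ r = (2 * m).+1.
- have [k1 | k2] : k = 1%N \/ k = 2 by nia.
    by left; rewrite k1 in def_r; lia.
  by right; rewrite k2 in def_r; lia.
all: move: pr_R; rewrite def_r; move: om; rewrite 4!inE => /or4P[] /eqP-> //.
Qed.

(** A complement C of N in K is isomorphic to the kernel of G / N, so has prime order and
    is a Sylow subgroup of K.  By the Frattini argument its normaliser A satisfies
    N A = G; moreover N :&: A centralises C, hence is trivial, and A is isomorphic to the
    Frobenius group G / N. *)
Lemma two_Frobenius_tower gT (G : {group gT}) :
    two_Frobenius G -> quadratic_group G ->
  exists N A R H : {group gT}, Frobenius_tower G N A R H.
Proof.
case=> N [K [nsNG nsKG sNK frobK frobGN]] quadG.
have [C frobKC] := existsP frobK.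
have [defK ntN ntC ltNK ltCK] := Frobenius_context frobKC.
have [nsNK sCK mulNC nNC tiNC] := sdprod_context defK.
have nNG := normal_norm nsNG; have sKG := normal_sub nsKG.
have isoC : C \isog K / N by rewrite -mulNC quotientMidl quotient_isog.
have rKN p : 'r_p(K / N) <= 1.
  by rewrite -(isog_p_rank isoC) (Frobenius_compl_p_rank p frobKC).
have [cycKN oddKN] := Frobenius_kernel_rank1_cyclic frobGN rKN.
have quadGN := quadratic_quotient nsNG quadG.
have pr_KN := Frobenius_quadratic_kernel_prime frobGN quadGN cycKN oddKN.
have oC : #|C| = #|K / N| := card_isog isoC.
pose r := #|C|; have pr_r : prime r by rewrite /r oC.
have rC : r.-group C by rewrite /pgroup pnat_id.
have r'N : ~~ (r %| #|N|).
  by rewrite -prime_coprime // coprime_sym (Frobenius_coprime frobKC).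
have sylC : r.-Sylow(K) C.
  by rewrite pHallE sCK -(sdprod_card defK) partnM // p_part logn_coprime ?prime_coprime // mul1n part_pnat_id /=.
pose A := 'N_G(C)%G.
have defG : N * A = G.
  rewrite -(Frattini_arg nsKG sylC) -mulNC -mulgA; congr (_ * _).
  by rewrite mulSGid // subsetI (subset_trans sCK sKG) normG.
have tiNA : N :&: A = 1.
  apply/trivgP; have [c Cc ntc] := trivgPn _ ntC.
  rewrite -(Frobenius_reg_ker frobKC (x := c)) ?inE ?ntc //.
  apply/subsetP=> y /setIP[Ny /setIP[Gy nCy]]; rewrite inE Ny.
  apply/cent1P/commgP/eqP; suffices: [~ y, c] \in N :&: C.
    by rewrite tiNC => /set1P.
  rewrite inE; apply/andP; split.
    by rewrite commgEl groupM ?groupV // memJ_norm // (subsetP nNC).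
  by rewrite commgEr groupM // memJ_norm ?groupV.
have nNA : A \subset 'N(N) by rewrite subIset ?nNG.
have isoA : A \isog G / N by rewrite -defG quotientMidl quotient_isog.
have [f injf fE] := quotient_TI_injm nNA tiNA.
have sCA : C \subset A by rewrite subsetI (subset_trans sCK sKG) normG.
have frobAC : [Frobenius A with kernel C].
  have frobf : [Frobenius f @* A with kernel f @* C].
    by rewrite !fE // -(quotientMidl N A) -(quotientMidl N C) defG mulNC.
  have sfA : f @* A \subset f @* A := subxx _.
  have := injm_Frobenius_ker sfA (injm_invm injf) frobf.
  by rewrite !morphim_invm.
have [H frobA] := existsP frobAC.
have [defA _ _ _ _] := Frobenius_context frobA.
have [_ /mulG_sub[_ sHA] _ _] := sdprodP defA.
have defGN : f @* A = G / N by rewrite fE // -(quotientMidl N A) defG.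
have frobGN' : [Frobenius f @* A = f @* C ><| f @* H] by apply: injm_Frobenius.
have pr_fC : prime #|f @* C| by rewrite card_injm.
have eqGN : (G / N = f @* A)%G by apply/val_inj.
rewrite eqGN in quadGN.
have [] := Frobenius_quadratic_complement frobGN' quadGN pr_fC.
rewrite !card_injm // injm_cyclic // => cycH oH dvH leH.
exists N, A, C, H; split=> //.
- by rewrite sdprodE.
- exact: Frobenius_kernel_nilpotent frobK.
exact: Frobenius_reg_ker frobKC.
Qed.

End Structure.

(** * Actions with many eigenvectors *)

Lemma even_dvd6 n : n %| 6 -> 2 %| n -> n = 2 \/ n = 6.
Proof.
move=> n6; have := dvdn_leq (isT : 0 < 6) n6.
by case: n n6 => [|[|[|[|[|[|[|]]]]]]] // *; [left | right].
Qed.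

Lemma three_dvd6 n : n %| 6 -> 3 %| n -> n = 3 \/ n = 6.
Proof.
move=> n6; have := dvdn_leq (isT : 0 < 6) n6.
by case: n n6 => [|[|[|[|[|[|[|]]]]]]] // *; [left | right].
Qed.

(** This is the count for n subgroups of order at most e that cover a group of order w,
    when e is at most the square root of w. *)
Lemma eigen_count e n w : 1 < e -> e ^ 2 <= w -> w.-1 <= n * e.-1 -> 0 < w ->
  1 < n /\ w <= n.-1 ^ 2.
Proof.
case: e => [|[|f]] // _ e2 lew w_gt0.
have le_n : f.+3 <= n.
  rewrite -(leq_pmul2r (ltn0Sn f)) (leq_trans _ lew) //.
  by move: e2; rewrite -mulnn; lia.
have [g def_n] : exists g, n = (f.+3 + g)%N by exists (n - f.+3)%N; rewrite subnKC.
split; first by apply: leq_trans le_n.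
by move: lew; rewrite def_n /= -mulnn mulnDl !mulnDr; lia.
Qed.

(** Read off a generator of the automorphism group of a cyclic group of order p, written
    additively as 'Z_p. *)
Lemma primitive_root_exists p : prime p ->
  exists2 k, coprime k p & forall j, k ^ j = 1 %[mod p] -> p.-1 %| j.
Proof.
move=> pr_p; have p_gt1 := prime_gt1 pr_p.
pose w : 'Z_p := Zp1; have ow : #[w] = p by rewrite order_Zp1 Zp_cast.
have cycA : cyclic (Aut <[w]>) by rewrite Aut_prime_cyclic // -orderE ow.
have [f defA] := cyclicP cycA; have Af : f \in Aut <[w]> by rewrite defA cycle_id.
have of_ : #[f] = p.-1.
  by rewrite orderE -defA card_Aut_cycle ow totient_prime.
have fM i : autm Af (w ^+ i) = autm Af w ^+ i by rewrite morphX ?cycle_id.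
have: autm Af w \in <[w]> by rewrite -{2}(im_autm Af) mem_morphim ?cycle_id.
case/cycleP=> k fw; rewrite autmE in fw.
have fj j : (f ^+ j) w = w ^+ (k ^ j).
  elim: j => [|j IHj]; first by rewrite expg0 perm1.
  by rewrite expgSr permM IHj -(autmE Af) fM autmE fw -expgM -expnS.
exists k => [|j kj1].
  rewrite coprime_sym prime_coprime // -ow order_dvdn -fw.
  apply: contraTneq p_gt1 => fw1; rewrite -ow order_gt1 negbK.
  by apply/eqP/(perm_inj (s := f)); rewrite fw1 -{1}(autmE Af) morph1.
rewrite -of_ order_dvdn; apply/eqP/(eq_Aut (groupX j Af) (group1 _)) => y.
case/cycleP=> i ->; rewrite perm1.
have Afj : f ^+ j \in Aut <[w]> by rewrite groupX.
rewrite -(autmE Afj) morphX ?cycle_id //= autmE fj.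
suffices -> : w ^+ (k ^ j) = w by [].
by apply/eqP; rewrite -{2}[w]expg1 eq_expg_mod_order ow kj1.
Qed.

Lemma prime_order_mod l c p j : prime l -> c ^ l = 1 %[mod p] ->
  c <> 1 %[mod p] -> c ^ j = 1 %[mod p] -> l %| j.
Proof.
move=> pr_l cl c1 cj; have [// | l_ndiv] := boolP (l %| j); case: c1.
have co : coprime l j by rewrite prime_coprime.
have [j0 | j_gt0] := posnP j; first by rewrite j0 dvdn0 in l_ndiv.
have [u v Duv _] := egcdnP l j_gt0.
have powX n i : c ^ n = 1 %[mod p] -> c ^ (i * n) = 1 %[mod p].
  by move=> cn; rewrite mulnC expnM -modnXm cn modnXm exp1n.
rewrite gcdnC (eqP co) in Duv.
have := powX _ u cj; rewrite Duv expnD expn1 -modnMml (powX _ v cl).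
by rewrite modnMml mul1n.
Qed.

(** The group A acts on W by a bare function, because the results are needed for two
    actions of different nature: conjugation on a normal subgroup, and the action on the
    linear characters of that subgroup. *)
Section Eigenvectors.

Variables (wT aT : finGroupType) (p : nat).
Variables (W : {group wT}) (A R H : {group aT}) (act : wT -> aT -> wT).

Hypotheses (pr_p : prime p) (abelW : p.-abelem W) (ntW : W :!=: 1).
Hypotheses (frobA : [Frobenius A = R ><| H]) (pr_R : prime #|R|) (cycH : cyclic H).
Hypothesis actW : forall w a, w \in W -> a \in A -> act w a \in W.
Hypothesis actMl : forall a v w, a \in A -> v \in W -> w \in W ->
  act (v * w) a = act v a * act w a.
Hypothesis act1 : forall w, w \in W -> act w 1 = w.
Hypothesis actMr : forall w a b, w \in W -> a \in A -> b \in A ->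
  act w (a * b) = act (act w a) b.
Hypothesis act_reg : forall w x, w \in W -> x \in R^# -> act w x = w -> w = 1.

Definition eigen c a := [set w in W | act w a == w ^+ c].

Let abW : abelian W := abelem_abelian abelW.

Let actX w a i : w \in W -> a \in A -> act (w ^+ i) a = act w a ^+ i.
Proof.
move=> Ww Aa; elim: i => [|i IHi]; last by rewrite !expgS actMl ?groupX // IHi.
by rewrite !expg0; apply: (mulgI (act 1 a)); rewrite -actMl // !mulg1.
Qed.

Lemma eigen_group_set c a : a \in A -> group_set (eigen c a).
Proof.
move=> Aa; apply/group_setP; split=> [|v w].
  by rewrite inE group1 expg1n -(expg0 1) actX ?expg0 /=.
rewrite !inE => /andP[Wv /eqP Ev] /andP[Ww /eqP Ew].
rewrite groupM // actMl // Ev Ew expgMn ?eqxx //.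
exact: (centsP abW _ Wv _ Ww).
Qed.

Lemma eigen_iter c a w i : a \in A -> w \in eigen c a ->
  act w (a ^+ i) = w ^+ (c ^ i).
Proof.
move=> Aa; rewrite inE => /andP[Ww /eqP Ew].
elim: i => [|i IHi]; first by rewrite expg0 act1.
by rewrite expgSr actMr ?groupX // IHi actX // Ew -expgM -expnS.
Qed.

(** There is a conjugate a ^ x such that a * (a ^ x)^-1 is a nontrivial element of R.  As
    R acts freely, the eigenspaces of a and a ^ x for the same scalar meet trivially, and
    they have the same order. *)
Lemma card_eigen_le c a : a \in A^# -> #|eigen c a| ^ 2 <= #|W|.
Proof.
case/setD1P=> nta Aa; have [defA ntR ntH ltRA ltHA] := Frobenius_context frobA.
have [nsRA sHA mulRH nRH tiRH] := sdprod_context defA.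
have sRA := normal_sub nsRA.
have [x Ax ntx] : exists2 x, x \in A & a * (a ^ x)^-1 \in R^#.
  have mem_R x : x \in A -> a \in R \/ x \in R -> a * (a ^ x)^-1 \in R.
    move=> Ax [Ra | Rx].
      by rewrite groupM ?groupV // memJ_norm // (subsetP (normal_norm nsRA)).
    have -> : a * (a ^ x)^-1 = (x^-1 ^ a^-1) * x.
      by rewrite !conjgE !invMg !invgK !mulgA.
    by rewrite groupM // memJ_norm ?groupV // (subsetP (normal_norm nsRA)) ?groupV.
  have nt_of x : x \in A -> a ^ x != a -> a * (a ^ x)^-1 != 1.
    by move=> Ax; apply: contra => /eqP/(canRL (mulgK _)); rewrite invgK mul1g => {2}->.
  have [Ra | notRa] := boolP (a \in R).
    have [h Hh nth] := trivgPn _ ntH; have Ah := subsetP sHA h Hh.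
    exists h; rewrite // !inE mem_R ?andbT; [|by []|by left].
    apply: nt_of => //; apply: contra nth => /eqP/conjg_fixP/commgP cah.
    have Ra' : a \in R^# by rewrite !inE nta.
    rewrite -in_set1 -[[set 1]]/(1 : {set aT}) -(Frobenius_reg_compl frobA Ra').
    by rewrite inE Hh; apply/cent1P.
  have [x Rx ntx] := trivgPn _ ntR; have Ax := subsetP sRA x Rx.
  exists x; rewrite // !inE mem_R ?andbT; [|by []|by right].
  apply: nt_of => //; apply: contra notRa => /eqP/conjg_fixP/commgP cax.
  apply: (subsetP (Frobenius_cent1_ker frobA (x := x) _)); first by rewrite !inE ntx.
  by rewrite inE Aa; apply/cent1P.
have Aax : a ^ x \in A by rewrite groupJ.
pose E1 := Group (eigen_group_set c Aa); pose E2 := Group (eigen_group_set c Aax).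
have Wact w y : w \in W -> y \in A -> act (act w y) y^-1 = w.
  by move=> Ww Ay; rewrite -actMr ?groupV // mulgV act1.
have leE : #|eigen c a| <= #|eigen c (a ^ x)|.
  have inj_act : {in eigen c a &, injective (act^~ x)}.
    move=> v w; rewrite !inE => /andP[Wv _] /andP[Ww _] /= eq_vw.
    by rewrite -(Wact v x) // eq_vw Wact.
  rewrite -(card_in_imset inj_act) subset_leq_card //.
  apply/subsetP=> _ /imsetP[w Ew ->]; move: Ew; rewrite !inE => /andP[Ww /eqP Ew].
  rewrite actW //= -actMr // -conjgC actMr // Ew actX //.
have tiE : E1 :&: E2 = 1.
  apply/trivgP/subsetP=> w; rewrite /= !inE => /andP[/andP[Ww /eqP Ea] /andP[_ /eqP Eax]].
  apply/eqP/(act_reg Ww ntx).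
  by rewrite actMr ?groupV // Ea -Eax Wact.
apply: leq_trans (_ : #|E1| * #|E2| <= _); first by rewrite -mulnn leq_mul.
rewrite -TI_cardMg // subset_leq_card // mul_subG //; by apply/subsetP=> w; rewrite inE => /andP[].
Qed.

(** The eigenspaces of the elements of D cover W, and each has order at most the square
    root of #|W| by [card_eigen_le]. *)
Lemma eigen_cover c (D : {set aT}) : D \subset A^# ->
    (forall w, w \in W^# -> exists2 a, a \in D & w \in eigen c a) ->
  1 < #|D| /\ #|W| <= #|D|.-1 ^ 2.
Proof.
move=> sDA cov.
have memE a : a \in D -> 1 \in eigen c a.
  move=> Da; have /setD1P[_ Aa] := subsetP sDA a Da.
  exact: (group1 (Group (eigen_group_set c Aa))).
have [w0 Ww0 ntw0] := trivgPn _ ntW.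
have [a0 Da0 Ea0] : exists2 a, a \in D & w0 \in eigen c a by apply: cov; rewrite !inE ntw0.
have [a Da maxa] := arg_maxnP (fun a => #|eigen c a|) Da0.
set e := #|eigen c a| in maxa.
have e_gt1 : 1 < e.
  apply: leq_trans (maxa a0 Da0); rewrite (cardsD1 1) memE // ltnS.
  by apply/card_gt0P; exists w0; rewrite in_setD1 ntw0.
have e2 : e ^ 2 <= #|W| by apply: card_eigen_le; apply: (subsetP sDA).
have leW : #|W|.-1 <= #|D| * e.-1.
  have -> : #|W|.-1 = #|W^#| by rewrite (cardsD1 1 W) group1.
  apply: leq_trans (_ : #|\bigcup_(b in D) (eigen c b)^#| <= _).
    apply/subset_leq_card/subsetP=> w Ww; have [b Db Eb] := cov w Ww.
    apply/bigcupP; exists b => //; move: Ww Eb; rewrite !inE.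
    by case/andP=> -> _ ->.
  apply: leq_trans (_ : \sum_(b in D) #|(eigen c b)^#| <= _).
    elim/big_rec2: _ => [|b n S _ IH]; first by rewrite cards0.
    by rewrite (leq_trans (leq_card_setU _ _)) // leq_add2l.
  rewrite -sum_nat_const leq_sum // => b Db.
  rewrite -ltnS prednK ?(ltnW e_gt1) // (leq_trans _ (maxa b Db)) //.
  by rewrite [in X in _ <= X](cardsD1 1) memE.
exact: eigen_count e_gt1 e2 leW (cardG_gt0 W).
Qed.

Lemma Frobenius_order a : a \in A ->
  #[a] %| #|R| \/ #[a] %| #|H|.
Proof.
move=> Aa; have := cover_partition (Frobenius_partition frobA).
move/setP/(_ a); rewrite Aa => /bigcupP[B].
case/setU1P=> [-> Ra | /imsetP[y Ry ->]]; first by left; apply: order_dvdG.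
rewrite conjD1g => /setD1P[_ Hya]; right.
by rewrite -(cardJg H y) order_dvdG.
Qed.

Lemma Frobenius_order_R a : a \in A -> #[a] %| #|R| -> a \in R.
Proof.
move=> Aa; have [defA ntR ntH _ _] := Frobenius_context frobA.
have := cover_partition (Frobenius_partition frobA).
move/setP/(_ a); rewrite Aa => /bigcupP[B].
case/setU1P=> [-> Ra // | /imsetP[y Ry ->]].
rewrite conjD1g => /setD1P[_ Hya] oa.
have : #[a] %| gcdn #|R| #|H|.
  by rewrite dvdn_gcd oa -(cardJg H y) order_dvdG.
by rewrite (eqP (Frobenius_coprime frobA)) dvdn1 order_eq1 => /eqP->.
Qed.

(** H is cyclic, so modulo R every such element is a power of a fixed t of order l. *)
Lemma card_prime_order l : prime l -> l %| #|H| ->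
  #|[set a in A | #[a] == l]| <= #|R| * l.-1.
Proof.
move=> pr_l l_dv_H; have [t Ht ot] := Cauchy pr_l l_dv_H.
have [defA ntR ntH ltRA ltHA] := Frobenius_context frobA.
have [nsRA sHA mulRH nRH tiRH] := sdprod_context defA.
have sDT : [set a in A | #[a] == l] \subset R * <[t]>^#.
  apply/subsetP=> a; rewrite inE -mulRH => /andP[/mulsgP[x h Rx Hh ->] /eqP oa].
  have nRh := subsetP nRH h Hh.
  have hl : h ^+ l = 1.
    apply/set1P; rewrite -[[set 1]]/(1 : {set aT}) -tiRH inE (groupX l Hh) andbT.
    rewrite coset_idr ?groupX // morphX //=.
    have -> : coset R h = coset R (x * h).
      by rewrite coset_kerl.
    rewrite -morphX; last by rewrite groupM // (subsetP (normG R) x Rx).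
    by rewrite -oa expg_order morph1.
  have nth : h != 1.
    apply/eqP=> h1; move: oa; rewrite h1 mulg1 => ox.
    have : l %| gcdn #|R| #|H|.
      by rewrite dvdn_gcd l_dv_H andbT -ox order_dvdG.
    by rewrite (eqP (Frobenius_coprime frobA)) dvdn1 => /eqP l1; rewrite l1 in pr_l.
  have oh : #[h] = l.
    by apply/(prime_nt_dvdP pr_l); rewrite ?order_eq1 // order_dvdn hl.
  apply/mulsgP; exists x h => //; rewrite !inE nth.
  have : <[h]> :==: <[t]>.
    by rewrite (eq_subG_cyclic cycH) ?cycle_subG // -!orderE oh ot.
  by move/eqP<-; apply: cycle_id.
apply: leq_trans (subset_leq_card sDT) _.
rewrite /mulg /= /set_mulg curry_imset2X (leq_trans (leq_imset_card _ _)) // cardsX.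
by rewrite leq_mul2l -ot orderE (cardsD1 1 <[t]>) group1 /= leqnn orbT.
Qed.

Hypothesis act_sq : forall w k, w \in W -> coprime k p ->
  exists2 a, a \in A & act w a = w ^+ (k ^ 2).
Hypothesis dvd_RW : #|R| %| #|W|.-1.

Let oW w : w \in W^# -> #[w] = p.
Proof. by case/setD1P=> ntw Ww; apply: abelem_order_p abelW _ _. Qed.

Let p_neq_R : p != #|R|.
Proof.
apply/eqP=> pR; move: dvd_RW; rewrite -pR => p_dv.
have [_ p_dv_W _] := pgroup_pdiv (abelem_pgroup abelW) ntW.
have : p %| 1.
  by rewrite -(dvdn_addr _ p_dv) addn1 prednK ?cardG_gt0.
by rewrite dvdn1 => /eqP p1; move: pr_p; rewrite p1.
Qed.

Let eigen_power c w a : w \in W^# -> a \in A -> w \in eigen c a ->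
  c ^ #[a] = 1 %[mod p].
Proof.
move=> Ww Aa Ew; apply/eqP; rewrite -(oW Ww) -eq_expg_mod_order -(eigen_iter _ Aa Ew).
by rewrite expg_order expg1 act1 //; case/setD1P: Ww.
Qed.

(** For a primitive root k, the scalar k ^ 2 has order (p - 1) / 2, and it is induced on w0
    by some element of A, whose order divides #|R| or #|H|. *)
Let half_order w0 : odd p -> w0 \in W^# -> p.-1./2 %| #|R| \/ p.-1./2 %| #|H|.
Proof.
move=> odd_p Ww; have [k cok primk] := primitive_root_exists pr_p.
have /setD1P[_ Ww0] := Ww.
have [a Aa Ea] := act_sq Ww0 cok.
have Ew : w0 \in eigen (k ^ 2) a by rewrite inE Ww0 Ea eqxx.
have := eigen_power Ww Aa Ew; rewrite -expnM => /primk p_dv.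
have s_dv : p.-1./2 %| #[a].
  have := odd_double_half p.-1; rewrite -subn1 oddB ?prime_gt0 // odd_p /= add0n subn1.
  by move=> Dp; rewrite -Dp -mul2n dvdn_pmul2l in p_dv.
by have [] := Frobenius_order Aa => oa; [left | right]; apply: dvdn_trans s_dv oa.
Qed.

Let cover_bound l c (D := [set a in A | #[a] == l]) n :
    prime l -> l %| #|H| ->
    (forall w, w \in W^# -> exists2 a, a \in D & w \in eigen c a) ->
    #|R| * l.-1 <= n -> #|W| <= n.-1 ^ 2.
Proof.
move=> pr_l l_dv cov le_n; have [|_ leW] := eigen_cover _ cov.
  apply/subsetP=> a; rewrite !inE => /andP[-> /eqP oa].
  by rewrite andbT -order_gt1 oa prime_gt1.
apply: leq_trans leW _; rewrite leq_sqr -!subn1 leq_sub2r //.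
exact: leq_trans (card_prime_order pr_l l_dv) le_n.
Qed.

Let cover_R c : (forall w, w \in W^# -> exists2 a, a \in R & w \in eigen c a) ->
  c <> 1 %[mod p] -> #|W| <= #|R|.-2 ^ 2.
Proof.
move=> cov c1; have [|w Ww|_] := @eigen_cover c R^#.
- by apply: setSD; have [/sdprod_context[/normal_sub]] := Frobenius_context frobA.
- have [a Ra Ew] := cov w Ww; exists a => //; rewrite !inE Ra andbT.
  apply/eqP=> a1; case: c1; have /setD1P[ntw Ww'] := Ww.
  move: Ew; rewrite a1 inE Ww' act1 //= => /eqP Ew.
  by apply/eqP; rewrite -(oW Ww) -eq_expg_mod_order expg1 -Ew.
by rewrite [#|R|](cardsD1 1) group1.
Qed.

Let act_order l k w : w \in W^# -> coprime k p -> prime l ->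
    (k ^ 2) ^ l = 1 %[mod p] -> k ^ 2 <> 1 %[mod p] ->
  exists a, [/\ a \in A, w \in eigen (k ^ 2) a & l %| #[a]].
Proof.
move=> Ww cok pr_l kl k1; have /setD1P[_ Ww'] := Ww.
have [a Aa Ea] := act_sq Ww' cok.
have Ew : w \in eigen (k ^ 2) a by rewrite inE Ww' Ea eqxx.
by exists a; split=> //; apply: prime_order_mod pr_l kl k1 (eigen_power Ww Aa Ew).
Qed.

Let eigen_iter_same c w a j : w \in W^# -> a \in A -> w \in eigen c a ->
  c ^ j = c %[mod p] -> w \in eigen c (a ^+ j).
Proof.
move=> Ww Aa Ew cj; have /setD1P[_ Ww'] := Ww.
by rewrite inE Ww' (eigen_iter _ Aa Ew) eq_expg_mod_order (oW Ww) cj eqxx.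
Qed.

(** Here k ^ 2 is the scalar -1.  If it is induced by an element of order 6, it is also
    induced by the cube of that element, of order 2. *)
Let inverse_bound k : coprime k p -> (k ^ 2) ^ 2 = 1 %[mod p] ->
    k ^ 2 <> 1 %[mod p] -> odd #|R| -> #|H| \in [:: 2; 6] ->
  #|W| <= #|R|.-1 ^ 2.
Proof.
move=> cok k4 k2 odd_R oH; apply: (@cover_bound 2 (k ^ 2)) => //.
- by move: oH; rewrite !inE => /orP[] /eqP->.
- move=> w Ww; have [a [Aa Ew even_a]] := act_order Ww cok (isT : prime 2) k4 k2.
  have [o2 | o6] : #[a] = 2 \/ #[a] = 6.
    apply: (even_dvd6 _ even_a); have [oaR | oaH] := Frobenius_order Aa.
      by move: (dvdn_odd oaR odd_R); rewrite -[odd _]negbK -dvdn2 even_a.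
    by apply: dvdn_trans oaH _; move: oH; rewrite !inE => /orP[] /eqP->.
  - by exists a; rewrite // inE Aa o2.
  exists (a ^+ 3); first by rewrite inE groupX // orderXgcd o6.
  apply: eigen_iter_same => //.
  by rewrite expnS -modnMmr k4 modnMmr muln1.
by rewrite muln1.
Qed.

(** A scalar of order 3.  If it is induced by an element of order 6, it is also induced by
    the fourth power of that element, of order 3. *)
Let cubic_bound k : coprime k p -> (k ^ 2) ^ 3 = 1 %[mod p] ->
    k ^ 2 <> 1 %[mod p] -> ~~ (3 %| #|R|) -> #|H| = 6 ->
  #|W| <= (#|R| * 2).-1 ^ 2.
Proof.
move=> cok k6 k2 R'3 oH; apply: (@cover_bound 3 (k ^ 2)) => //.
- by rewrite oH.
move=> w Ww; have [a [Aa Ew a3]] := act_order Ww cok (isT : prime 3) k6 k2.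
have [o3 | o6] : #[a] = 3 \/ #[a] = 6.
  apply: (three_dvd6 _ a3); have [oaR | ] := Frobenius_order Aa; last by rewrite oH.
  by rewrite (dvdn_trans a3 oaR) in R'3.
- by exists a; rewrite // inE Aa o3.
exists (a ^+ 4); first by rewrite inE groupX // orderXgcd o6.
apply: eigen_iter_same => //.
by rewrite expnS -modnMmr k6 modnMmr muln1.
Qed.

(** Suppose that p > 3.  By [half_order], (p - 1) / 2 divides #|R| or #|H|, which leaves few
    primes for each pair.  In each remaining case some scalar is induced on all vectors by
    elements of a small set (the involutions, the elements of order 3, or R), and
    [eigen_cover] bounds #|W|; but #|W| is a power of p congruent to 1 modulo #|R|. *)
Lemma quadratic_action_prime :
    (#|R|, #|H|) \in [:: (3, 2); (5, 2); (5, 4); (7, 3); (7, 6); (13, 6)] ->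
  p \in [:: 2; 3].
Proof.
move=> casesRH; apply: wlog_neg; rewrite !inE negb_or => /andP[p2 p3].
have [w0 Ww0 ntw0] := trivgPn _ ntW.
have Ww : w0 \in W^# by rewrite !inE ntw0.
have odd_p : odd p by have [/eqP | //] := even_prime pr_p; rewrite (negPf p2).
have p_half : p = (p.-1./2).*2.+1.
  have := odd_double_half p.-1; rewrite -subn1 oddB ?prime_gt0 // odd_p /= subn1.
  by rewrite add0n => ->; rewrite prednK ?prime_gt0.
have s_gt1 : 1 < p.-1./2.
  move: (prime_gt1 pr_p) p2 p3; rewrite p_half; case: (p.-1./2) => [|[|]] //.
have leW : p <= #|W|.
  have [_ p_dv_W _] := pgroup_pdiv (abelem_pgroup abelW) ntW.
  exact: dvdn_leq.
have [d def_W d_gt0] : exists2 d, #|W| = (p ^ d)%N & 0 < d.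
  exists (logn p #|W|); rewrite -?(card_pgroup (abelem_pgroup abelW)) //.
  have [_ _ [n oWn]] := pgroup_pdiv (abelem_pgroup abelW) ntW.
  by rewrite oWn pfactorK.
have leWd n : #|W| <= n -> p ^ d <= n by rewrite def_W.
have dvW : #|R| %| (p ^ d).-1 by rewrite -def_W.
(* 2 ^ 2 = -1 modulo 5. *)
have not_p5 : p = 5 -> #|H| \in [:: 2; 6] -> #|R| \in [:: 3; 7; 13] -> False.
  move=> p5 oH oR; have /leWd : #|W| <= #|R|.-1 ^ 2.
    apply: (@inverse_bound 2); rewrite ?p5 //.
    by move: oR; rewrite !inE => /or3P[] /eqP->.
  move: oR dvW d_gt0; rewrite p5 !inE => /or3P[] /eqP->;
    case: d {def_W leWd} => [|[|[|[|d]]]] //= _ _; rewrite leqNgt (leq_trans (_ : _ < 5 ^ 4)) ?leq_pexp2l //.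
(* 5 ^ 2 = -1 modulo 13. *)
have not_p13 : p = 13 -> #|H| = 6 -> #|R| = 7 -> False.
  move=> p13 oH oR; have /leWd : #|W| <= #|R|.-1 ^ 2.
    by apply: (@inverse_bound 5); rewrite ?p13 ?oH ?oR.
  move: dvW d_gt0; rewrite p13 oR; case: d {def_W leWd} => [|[|d]] //= _ _.
  by rewrite leqNgt (leq_trans (_ : _ < 13 ^ 2)) ?leq_pexp2l.
(* 2 ^ 2 has order 3 modulo 7. *)
have not_p7 : p = 7 -> #|H| = 6 -> #|R| = 13 -> False.
  move=> p7 oH oR; have /leWd : #|W| <= (#|R| * 2).-1 ^ 2.
    by apply: (@cubic_bound 2); rewrite ?p7 ?oH ?oR.
  move: dvW d_gt0; rewrite p7 oR; case: d {def_W leWd} => [|[|[|[|d]]]] //= _ _.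
  by rewrite leqNgt (leq_trans (_ : _ < 7 ^ 4)) ?leq_pexp2l.
(* If p = 2 #|R| + 1, then 2 ^ 2 has order #|R| modulo p. *)
have not_sR : p.-1./2 != #|R|.
  have bound l : prime l -> 4 ^ l = 1 %[mod p] -> 4 <> 1 %[mod p] ->
      ~~ (l %| #|H|) -> #|W| <= #|R|.-2 ^ 2.
    move=> pr_l c_l c1 H'l; apply: (@cover_R 4) => // w Ww'.
    have co2 : coprime 2 p by rewrite coprime2n.
    have [a [Aa Ew l_dv]] := act_order Ww' co2 pr_l c_l c1.
    exists a => //; have [/Frobenius_order_R-> // | oaH] := Frobenius_order Aa.
    by rewrite (dvdn_trans l_dv oaH) in H'l.
  apply/negP=> /eqP sR; move: casesRH; rewrite !inE !xpair_eqE.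
  have pE : p = #|R|.*2.+1 by rewrite -sR -p_half.
  have p_le n : #|W| <= n -> p <= n := leq_trans leW.
  do 5?case/orP; case/andP=> /eqP oR /eqP oH; have := pr_p; rewrite pE oR // => _.
  - suffices: p <= #|R|.-2 ^ 2 by rewrite pE oR.
    by apply/p_le/(bound 3); rewrite ?pE ?oR ?oH.
  - suffices: p <= #|R|.-2 ^ 2 by rewrite pE oR.
    by apply/p_le/(bound 5); rewrite ?pE ?oR ?oH.
  suffices: p <= #|R|.-2 ^ 2 by rewrite pE oR.
    by apply/p_le/(bound 5); rewrite ?pE ?oR ?oH.
have s_H : p.-1./2 %| #|H|.
  have [s_R | //] := half_order odd_p Ww; case/negP: not_sR.
  by apply/eqP/(prime_nt_dvdP pr_R) => //; rewrite neq_ltn s_gt1 orbT.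
have Rp := p_neq_R; have s_le := dvdn_leq (cardG_gt0 H) s_H.
set s := p.-1./2 in p_half s_gt1 s_H s_le; clearbody s.
move: casesRH; rewrite !inE !xpair_eqE.
do 5?case/orP; case/andP=> /eqP oR /eqP oH; rewrite oH in s_H s_le.
all: case: s p_half s_gt1 s_H s_le => [|[|[|[|[|[|[|]]]]]]] //= p_val _ _ _.
all: first [by have := pr_p; rewrite p_val | by case/eqP: Rp; rewrite p_val oR
  | by case: not_p5; rewrite ?oH ?oR | by case: not_p7; rewrite ?oH ?oR
  | by case: not_p13; rewrite ?oH ?oR].
Qed.

End Eigenvectors.

(** * The primes dividing the order of the kernel *)

Section Tower.

Implicit Type gT : finGroupType.

Lemma tower_coprime gT (G N A R H : {group gT}) :
  Frobenius_tower G N A R H -> coprime #|N| #|R| /\ 'C_N(R) = 1.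
Proof.
move=> tower; have [nsNG sAG _ nNA _] := sdprod_context (tower_sdprod tower).
have [defA ntR _ _ _] := Frobenius_context (tower_Frobenius tower).
have [nsRA _ _ _ _] := sdprod_context defA.
have nNR := subset_trans (normal_sub nsRA) nNA.
split; first exact: regular_norm_coprime nNR (tower_regular tower).
have [x Rx ntx] := trivgPn _ ntR; apply/trivgP.
rewrite -(tower_regular tower (x := x)) ?inE ?ntx //.
by rewrite -cent_cycle setIS // centS // cycle_subG.
Qed.

Lemma tower_quotient gT (G N A R H M : {group gT}) :
    Frobenius_tower G N A R H -> M <| G -> M \proper N ->
  [/\ Frobenius_tower (G / M) (N / M) (A / M) (R / M) (H / M),
      #|R / M| = #|R| & #|H / M| = #|H|].
Proof.
move=> tower nsMG prMN; have [sMN not_sNM] := andP prMN.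
have [defG nilN ntN frobA regR pr_R cycH oH dvH leR] := tower.
have [nsNG sAG mulNA nNA tiNA] := sdprod_context defG.
have [defA ntR ntH ltRA ltHA] := Frobenius_context frobA.
have [nsRA sHA mulRH nRH tiRH] := sdprod_context defA.
have nMG := normal_norm nsMG; have nMA := subset_trans sAG nMG.
have sRA := normal_sub nsRA; have nMR := subset_trans sRA nMA.
have tiMA : M :&: A = 1 by apply/trivgP; rewrite -tiNA setSI.
have [f injf fE] := quotient_TI_injm nMA tiMA.
have oE (X : {group gT}) : X \subset A -> #|X / M| = #|X|.
  by move=> sXA; rewrite -fE // card_injm.
have [coNR fixR] := tower_coprime tower.
have fixRM : 'C_(N / M)(R / M) = 1.
  by rewrite -coprime_quotient_cent ?fixR ?quotient1 // nilpotent_sol.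
split; rewrite ?oE //; split; rewrite ?oE //.
- rewrite sdprodE ?quotient_norms // -?quotientMl ?mulNA //.
    exact: subset_trans (normal_sub nsNG) nMG.
  by rewrite -quotientGI // tiNA quotient1.
- exact: quotient_nil.
- by rewrite -subG1 quotient_sub1 // (subset_trans (normal_sub nsNG)).
- have := injm_Frobenius (subxx A) injf frobA.
  by rewrite !fE.
- by move=> y Ry; rewrite -cent_cycle (cycle_prime _ Ry) ?oE.
exact: quotient_cyclic.
Qed.

(** As N is nilpotent, dividing by O_p'(N) makes it a p-group, and dividing further by the
    Frattini subgroup makes it elementary abelian. *)
Lemma tower_abelem gT (G N A R H : {group gT}) p :
    Frobenius_tower G N A R H -> quadratic_group G -> p \in \pi(N) ->
  exists (rT : finGroupType) (G1 N1 A1 R1 H1 : {group rT}),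
    [/\ Frobenius_tower G1 N1 A1 R1 H1, quadratic_group G1, p.-abelem N1,
        #|R1| = #|R| & #|H1| = #|H|].
Proof.
move=> tower quadG pN; have pr_p : prime p by move: pN; rewrite mem_primes => /andP[].
have nilN := tower_nil tower.
have [nsNG _ _ _ _] := sdprod_context (tower_sdprod tower).
pose M := 'O_p^'(N)%G.
have nsMG : M <| G := char_normal_trans (pcore_char _ _) nsNG.
have prMN : M \proper N.
  rewrite properEneq pcore_sub andbT; apply: contraL pN => /eqP defM.
  by have := pcore_pgroup p^' N; rewrite defM p'groupEpi.
have [tower1 oR1 oH1] := tower_quotient tower nsMG prMN.
have quadG1 := quadratic_quotient nsMG quadG.
have pN1 : p.-group (N / M).
  by rewrite /pgroup card_quotient ?gFnorm // -[_.-nat _]pnatNK; have /and3P[] := nilpotent_pcore_Hall p^' nilN.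
have ntN1 := tower_neq1 tower1.
have [nsN1 _ _ _ _] := sdprod_context (tower_sdprod tower1).
have nsPhi : 'Phi(N / M) <| G / M := char_normal_trans (Phi_char _) nsN1.
have prPhi : 'Phi(N / M) \proper N / M := Phi_proper ntN1.
have [tower2 oR2 oH2] := tower_quotient tower1 nsPhi prPhi.
have quadG2 := quadratic_quotient nsPhi quadG1.
exists _, (G / M / 'Phi(N / M))%G, (N / M / 'Phi(N / M))%G, (A / M / 'Phi(N / M))%G.
exists (R / M / 'Phi(N / M))%G, (H / M / 'Phi(N / M))%G.
split=> //; rewrite ?oR2 ?oH2 //.
exact: Phi_quotient_abelem.
Qed.

(** As x acts freely on N, the map n |-> n^-1 * n ^ x is injective. *)
Lemma regular_commutators gT (N R : {group gT}) x :
    R \subset 'N(N) -> semiregular N R -> x \in R^# ->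
  [set n^-1 * n ^ x | n in N] = N.
Proof.
move=> nNR regR Rx; have nNx : x \in 'N(N).
  by apply: (subsetP nNR); case/setD1P: Rx.
apply/eqP; rewrite eqEcard; apply/andP; split.
  by apply/subsetP=> _ /imsetP[n Nn ->]; rewrite groupM ?groupV // memJ_norm.
rewrite card_in_imset // => m n Nm Nn eq_mn.
have: m * n^-1 \in 'C_N[x].
  rewrite inE groupM ?groupV //=; apply/cent1P/commgP/conjg_fixP.
  have mx : m ^ x = m * (n^-1 * n ^ x) by rewrite -eq_mn mulKVg.
  by rewrite conjMg conjVg mx (mulgA m) mulgK.
by rewrite regR // => /set1P/eqP; rewrite -eq_mulgV1 => /eqP.
Qed.

(** The choice of exponents is the same as in [quadratic_cycle_square]. *)
Lemma quadratic_classes_square gT (G : {group gT}) x k :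
    quadratic_classes G -> x \in G -> coprime k #[x] ->
  exists2 g, g \in G & x ^ g = x ^+ (k ^ 2).
Proof.
move=> quadG Gx cok; have cok2 : coprime (k ^ 2) #[x] by rewrite coprimeXl.
have power g : g \in G -> x ^ g = x ^+ k -> exists2 g, g \in G & x ^ g = x ^+ (k ^ 2).
  by move=> Gg xg; exists (g * g); rewrite ?groupM // conjgM xg conjXg xg -expgM.
have [[g Gg xg] | // | [g Gg xg]] := quadratic_classes_power quadG Gx cok cok2.
  exact: power g Gg xg.
apply: (power g Gg).
have [m mE] : exists m, forall y : gT, #[y] = #[x] -> (y ^+ k) ^+ m = y.
  exists (expg_invn <[x]> k) => y oy.
  have co : coprime #|<[y]>| k by rewrite -orderE oy coprime_sym.
  by have := expgK co (cycle_id y); rewrite /expg_invn -!orderE oy.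
rewrite -(mE (x ^ g)) ?orderJ // -conjXg xg expnS expn1 expgM.
by rewrite mE // orderXgcd gcdnC (eqP cok) divn1.
Qed.

Lemma abelian_cover_square gT (G N A : {group gT}) p w k :
    N ><| A = G -> p.-abelem N -> quadratic_classes G -> w \in N -> coprime k p ->
  exists2 a, a \in A & w ^ a = w ^+ (k ^ 2).
Proof.
move=> defG abelN quadG Nw cok; have [nsNG sAG mulNA nNA tiNA] := sdprod_context defG.
have cok' : coprime k #[w].
  have [-> | ntw] := eqVneq w 1; first by rewrite order1 coprimen1.
  by rewrite (abelem_order_p abelN).
have [g] := quadratic_classes_square quadG (subsetP (normal_sub nsNG) w Nw) cok'.
rewrite -mulNA => /mulsgP[n a Nn Aa ->] wg; exists a => //.
rewrite -wg conjgM; congr (_ ^ _); apply/esym/conjg_fixP/commgP.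
exact: (centsP (abelem_abelian abelN)).
Qed.

(** The action is conjugation on N for semi-rational groups.  For character-quadratic
    groups it is the action on the group of linear characters of N, on which Galois
    automorphisms act as power maps; R acts freely there because of
    [regular_commutators]. *)
Lemma tower_abelem_prime gT (G N A R H : {group gT}) p :
    Frobenius_tower G N A R H -> quadratic_group G -> p.-abelem N -> prime p ->
  p \in [:: 2; 3].
Proof.
move=> tower quadG abelN pr_p.
have casesRH := tower_cases tower.
have [defG nilN ntN frobA regR pr_R cycH oH dvH leR] := tower.
have [nsNG sAG mulNA nNA tiNA] := sdprod_context defG.
have [defA ntR ntH ltRA ltHA] := Frobenius_context frobA.
have [nsRA sHA mulRH nRH tiRH] := sdprod_context defA.
have nNR := subset_trans (normal_sub nsRA) nNA.
have dvR := regular_norm_dvd_pred nNR regR.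
have abN := abelem_abelian abelN.
case: quadG => quadG; last first.
  apply: (quadratic_action_prime (act := fun w a => w ^ a) pr_p abelN ntN frobA) => //.
  - by move=> w a Nw Aa; rewrite memJ_norm // (subsetP nNA).
  - by move=> a v w _ _ _; apply: conjMg.
  - by move=> w _; apply: conjg1.
  - by move=> w a b _ _ _; apply: conjgM.
  - move=> w x Nw Rx wx; apply/set1P; rewrite -[[set 1]]/(1 : {set gT}) -(regR x Rx).
    by rewrite inE Nw; apply/cent1P/commgP/conjg_fixP.
  by move=> w k Nw cok; apply: abelian_cover_square defG abelN quadG Nw cok.
have [linN [cF [inj_cF olin linF onto_cF] [cF1 cFM cFX _ _]]] := lin_char_group N.
have actP (u : linN) a : exists v, cF v == (cF u ^ a)%CF.
  by have [v ->] := onto_cF _ (cfConjg_lin_char a (linF u)); exists v.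
pose act u a := xchoose (actP u a).
have actE u a : cF (act u a) = (cF u ^ a)%CF := eqP (xchooseP (actP u a)).
have nN a : a \in A -> a \in 'N(N) := subsetP nNA a.
have abelW : p.-abelem [set: linN].
  apply/abelemP=> //; split=> [|u _].
    by apply/centsP=> u _ v _; apply: inj_cF; rewrite !cFM mulrC.
  apply: inj_cF; rewrite cFX cF1; apply/cfun_inP=> n Nn.
  rewrite exp_cfunE // cfun1E Nn -lin_charX //.
  by have [_ /(_ n Nn) ->] := abelemP pr_p abelN; rewrite lin_char1.
have oW : #|[set: linN]| = #|N|.
  by rewrite cardsT olin (derG1P abN) indexg1.
apply: (quadratic_action_prime (act := act) pr_p abelW _ frobA) => //.
- by rewrite -cardG_gt1 oW cardG_gt1.
- by move=> u a _ _; rewrite inE.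
- by move=> a u v Aa _ _; apply: inj_cF; rewrite cFM !actE cFM rmorphM.
- by move=> u _; apply: inj_cF; rewrite actE cfConjgJ1.
- by move=> u a b _ Aa Ab; apply: inj_cF; rewrite !actE cfConjgMnorm ?nN.
- move=> u x _ Rx ux; apply: inj_cF; rewrite cF1; apply/cfun_inP=> n.
  rewrite -{1}(regular_commutators nNR regR Rx) => /imsetP[m Nm ->].
  have Nx : x \in 'N(N) by apply: (subsetP nNR); case/setD1P: Rx.
  have Nmx : m ^ x \in N by rewrite memJ_norm.
  rewrite cfun1E groupM ?groupV // lin_charM ?groupV // lin_charV //.
  have -> : (cF u (m ^ x)%g = cF u m)%R by rewrite -{1}ux actE cfConjgEJ.
  by rewrite mulVr // unitfE lin_char_neq0.
- move=> u k _ cok.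
  have [j Dj] : exists j, (cF u = 'chi_j)%R by apply/irrP/lin_char_irr.
  have cok2 : coprime (k ^ 2) p by rewrite coprimeXl.
  have autE l (v : {rmorphism algC -> algC}) : (forall z, z ^+ p = 1 -> v z = z ^+ l)%R ->
      (cfAut v 'chi_j = cF (u ^+ l)%g)%R.
    move=> vE; apply/cfun_inP=> n Nn; rewrite cFX -Dj cfunE exp_cfunE //.
    apply: vE; rewrite -lin_charX //.
    by have [_ /(_ n Nn) ->] := abelemP pr_p abelN; rewrite lin_char1.
  have [v1 /autE v1E] := Qn_aut_exists cok; have [v2 /autE v2E] := Qn_aut_exists cok2.
  have toA (w z : linN) : (exists2 g, g \in G & (cF z = (cF w ^ g)%CF)%R) ->
      exists2 a, a \in A & act w a = z.
    case=> g Gg; rewrite -mulNA in Gg; case/mulsgP: Gg => n a Nn Aa -> zE.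
    exists a => //; apply: inj_cF; rewrite actE zE.
    by rewrite (cfConjgMnorm _ (subsetP (normG N) n Nn) (nN a Aa)) (cfConjg_id _ Nn).
  have := quadratic_chars_orbit j v1 v2 quadG nsNG; rewrite v1E v2E -Dj.
  case=> [/toA[a Aa ua] | /toA // | /toA[a Aa ua]].
    exists (a * a); rewrite ?groupM //; apply: inj_cF.
    rewrite actE cfConjgMnorm ?nN // -actE ua cFX rmorphXn /= -actE ua -cFX.
    by rewrite -expgM mulnn.
  have co : coprime #|[set: linN]| k.
    by have [n ->] := p_natP (abelem_pgroup abelW); rewrite coprimeXl // coprime_sym.
  suffices u_a : act u a = u ^+ k.
    exists (a * a); rewrite ?groupM //; apply: inj_cF.
    rewrite actE cfConjgMnorm ?nN // -actE u_a cFX rmorphXn /= -actE u_a -cFX.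
    by rewrite -expgM mulnn.
  apply: (can_in_inj (expgK co)); rewrite ?inE //= -expgM mulnn -ua.
  by apply: inj_cF; rewrite cFX !actE cFX rmorphXn.
by rewrite oW.
Qed.

Lemma tower_primes gT (G N A R H : {group gT}) p :
  Frobenius_tower G N A R H -> quadratic_group G -> p \in \pi(N) -> p \in [:: 2; 3].
Proof.
move=> tower quadG pN; have pr_p : prime p by move: pN; rewrite mem_primes => /andP[].
have [rT [G1 [N1 [A1 [R1 [H1 [tower1 quadG1 abelN1 _ _]]]]]]] := tower_abelem tower quadG pN.
exact: tower_abelem_prime tower1 quadG1 abelN1 pr_p.
Qed.

End Tower.

(** * Complements of order 4 *)

(** By the Clifford correspondence, chi = Ind chi_s is irreducible and determines chi_s
    among the characters of T above chi_t.  If u2 fixes chi, then it fixes chi_s, as it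
    fixes chi_t.  In the other two cases the image of chi under u1 lies above both chi_t
    and the image of chi_t under u1, which are then conjugate by Clifford's theorem. *)
Lemma quadratic_inertia_extension gT (G N T : {group gT}) (t : Iirr N) (s : Iirr T)
    (u1 u2 : algC_aut) :
    quadratic_chars G -> N <| G -> T :=: 'I_G['chi_t]%R ->
    ('Res[N] 'chi_s = 'chi_t -> cfAut u2 'chi_t = 'chi_t ->
  cfAut u2 'chi_s = 'chi_s \/ exists2 g, g \in G & cfAut u1 'chi_t = ('chi_t ^ g)%CF)%R.
Proof.
move=> quadG nsNG defT; have {}defT : T = 'I_G[('chi_t)%R]%G by apply: group_inj.
subst T => Res_s u2_t.
have [Ind_irr Ind_inj Ind_im _ _] := constt_Inertia_bijection t nsNG.
have nsNT : N <| 'I_G[('chi_t)%R] := normal_Inertia _ (normal_sub nsNG).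
have IndP s1 : ('Res[N] 'chi_s1 = 'chi_t)%R ->
    s1 \in irr_constt ('Ind['I_G['chi_t]%G] 'chi_t)%R.
  by move=> Res1; rewrite constt_Ind_Res Res1 constt_irr inE.
have Ind_s := IndP s Res_s; pose k := Ind_Iirr G s.
have kE : ('chi_k = 'Ind 'chi_s)%R by rewrite cfIirrE ?Ind_irr.
have k_t : t \in irr_constt ('Res[N] 'chi_k)%R.
  rewrite -constt_Ind_Res -Ind_im.
  exact: imset_f.
have autE (u : algC_aut) : aut_Iirr u t \in irr_constt ('Res[N] 'chi_(aut_Iirr u k))%R.
  by rewrite !inE !aut_IirrE -cfAutRes cfdot_aut_irr fmorph_eq0.
have aut_eq (u v : algC_aut) : {in G, forall g, u ('chi_k g)%R = v ('chi_k g)%R} ->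
    aut_Iirr u k = aut_Iirr v k.
  move=> eq_uv; apply: irr_inj; rewrite !aut_IirrE; apply/cfun_inP=> g Gg.
  by rewrite !cfunE eq_uv.
pose id1 : algC_aut := idfun.
have idE i : aut_Iirr id1 i = i :> Iirr G.
  by apply: irr_inj; rewrite aut_IirrE; apply/cfun_inP=> g _; rewrite cfunE.
have id_t : aut_Iirr u2 t = t by apply: irr_inj; rewrite aut_IirrE.
have conj1 (v : algC_aut) : t \in irr_constt ('Res[N] 'chi_(aut_Iirr u1 k))%R ->
    exists2 g, g \in G & (cfAut u1 'chi_t = ('chi_t ^ g)%CF)%R.
  by move/(constt_Res_conj nsNG)/(_ (autE u1)); rewrite aut_IirrE.
have [] := quadG k u1 u2 => eq_u.
- by right; apply: conj1 => //; rewrite (aut_eq u1 id1 eq_u) idE.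
- left; have := aut_eq u2 id1 eq_u; rewrite idE => eq_k.
  rewrite -aut_IirrE; apply: (congr1 (fun i => 'chi_i)%R); apply: Ind_inj => //.
    by apply: IndP; rewrite aut_IirrE -cfAutRes Res_s.
  apply: irr_inj; rewrite -[RHS]/('chi_k)%R -[in RHS]eq_k aut_IirrE kE cfAutInd.
  by rewrite -aut_IirrE cfIirrE // Ind_irr // IndP // aut_IirrE -cfAutRes Res_s.
right; apply: conj1 => //; rewrite (aut_eq u1 u2); last by move=> g Gg; rewrite eq_u.
by rewrite -{1}id_t.
Qed.

(** Let h generate H, let w in C_N(H) have order 3, and put y = h * w.  The units 5 and 7
    modulo 12 send (h, w) to (h, w^-1) and to (h^-1, w).  An element of A that conjugates h
    into H lies in H.  Hence no element of G inverts h modulo N, and one that fixes h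
    modulo N acts on N as an element of H, which centralises w.  This rules out
    the three alternatives for the classes of y, y ^+ 5 and y ^+ 7.
    
    For characters, T = N H has a linear character s that is faithful on <[y]>, and the
    inertia group of its restriction t to N is T, since an element of R fixing t would make
    t trivial.  In [quadratic_inertia_extension] the automorphism of exponent 7 does not
    fix s at h, so that of exponent 5 sends t to a conjugate of t.  The conjugating element
    normalises the inertia group T, hence lies in T and fixes t, although the
    automorphism inverts t at w. *)
Lemma tower_compl4 gT (G N A R H : {group gT}) :
    Frobenius_tower G N A R H -> quadratic_group G -> 3.-abelem N -> #|H| <> 4.
Proof.
move=> tower quadG abelN oH.
have [coNR fixR] := tower_coprime tower.
have [defG nilN ntN frobA regR pr_R cycH _ _ _] := tower.
have [nsNG sAG mulNA nNA tiNA] := sdprod_context defG.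
have [defA ntR ntH ltRA ltHA] := Frobenius_context frobA.
have [nsRA sHA mulRH nRH tiRH] := sdprod_context defA.
have sRA := normal_sub nsRA; have sNG := normal_sub nsNG; have nNG := normal_norm nsNG.
have nNR := subset_trans sRA nNA; have nNH := subset_trans sHA nNA.
have sHG := subset_trans sHA sAG.
have abN := abelem_abelian abelN.
have tiNH : N :&: H = 1 by apply/trivgP; rewrite -tiNA setIS.
have [h defH] := cyclicP cycH.
have Hh : h \in H by rewrite defH cycle_id.
have oh : #[h] = 4 by rewrite orderE -defH.
have nth : h != 1 by rewrite -order_gt1 oh.
have [_ _ memJ] : [/\ H^# != set0, H \subset A
    & {in H^# & A, forall a g, (a ^ g \in H^#) = (g \in H)}].
  by apply/normedTI_memJ_P; have /andP[] := FrobeniusWcompl frobA.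
have hJ a : a \in A -> h ^ a \in H -> a \in H.
  by move=> Aa Hha; rewrite -(memJ h) // !inE ?nth ?conjg_eq1 ?nth.
have /trivgPn[w /setIP[Nw cHw] ntw] : 'C_N(H) != 1.
  by apply: contraNneq ntN => fixH; apply/eqP; apply: Frobenius_compl_fix frobA abN nNA coNR fixR fixH.
have ow : #[w] = 3 by rewrite (abelem_order_p abelN).
have whC : commute h w by apply/commute_sym; apply: (centP cHw).
have hE k : (h ^+ k == 1) = (4 %| k) by rewrite -order_dvdn oh.
have wE k : (w ^+ k == 1) = (3 %| k) by rewrite -order_dvdn ow.
have hN n : n \in N -> [~ h, n] \in N.
  by move=> Nn; rewrite commgEr groupM // memJ_norm ?groupV // (subsetP nNH).
have modh k : h ^+ k = h ^+ (k %% 4) by rewrite -oh expg_mod_order.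
have modw k : w ^+ k = w ^+ (k %% 3) by rewrite -ow expg_mod_order.
pose y := h * w; have yE k : y ^+ k = h ^+ k * w ^+ k by rewrite expgMn.
(* 9 is 1 modulo 4 and 0 modulo 3, and 4 is 0 modulo 4 and 1 modulo 3. *)
have y9 m : (y ^+ m) ^+ 9 = h ^+ m.
  by rewrite -expgM mulnC yE !expgM [h ^+ 9]modh [w ^+ 9]modw expg1 expg0 expg1n mulg1.
have y4 m : (y ^+ m) ^+ 4 = w ^+ m.
  by rewrite -expgM mulnC yE !expgM [h ^+ 4]modh [w ^+ 4]modw expg1 expg0 expg1n mul1g.
have oy : #[y] = 12.
  by rewrite orderM // oh ow.
have Gy : y \in G by rewrite groupM ?(subsetP sHG h) ?(subsetP sNG w).
case: quadG => quadG; last first.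
  have no_inv g m : g \in G -> h ^ g = h ^+ m -> exists2 a, a \in H & h ^+ m = h /\ forall n, n \in N -> n ^ g = n ^ a.
    rewrite -mulNA => /mulsgP[n a Nn Aa ->] hg.
    have ha : h ^ a = h ^+ m.
      apply/eqP; rewrite eq_mulVg1; apply/eqP/set1P; rewrite -[[set 1]]/(1 : {set gT}) -tiNA.
      apply/setIP; split; last by rewrite groupM ?groupV ?groupX ?groupJ ?(subsetP sHA h).
      by rewrite -hg conjgM (conjg_mulR h n) conjMg mulKg memJ_norm ?hN ?(subsetP nNA).
    have Ha : a \in H by rewrite hJ // ha groupX.
    exists a => //; split.
      rewrite -ha; apply/conjg_fixP/commgP.
      exact: (centsP (cyclic_abelian cycH)).
    move=> n1 Nn1; rewrite conjgM; congr (_ ^ _); apply/conjg_fixP/commgP.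
    exact: (centsP abN).
  have y57 k g : k = 5 \/ k = 1%N -> g \in G -> (y ^+ k) ^ g = y ^+ 7 -> False.
    move=> k51 Gg /(congr1 (expgn^~ 9)); rewrite /= -conjXg !y9 => hg.
    have [] := no_inv g 7 Gg.
      by rewrite -hg; case: k51 => ->; rewrite ?expg1 // [h ^+ 5]modh.
    move=> a _ [/eqP]; rewrite -[X in _ == X](mulg1 h) expgS.
    by rewrite (inj_eq (mulgI h)) hE.
  have [] := @quadratic_classes_power _ G y 5 7 quadG Gy; rewrite ?oy //.
  - case=> g Gg yg; have := congr1 (expgn^~ 4) yg; rewrite /= -conjXg.
    have := congr1 (expgn^~ 9) yg; rewrite /= -conjXg.
    rewrite -{1 3}[y]expg1 !y9 !y4 !expg1 => hg wg.
    have [a Ha [_ actN]] := no_inv g 5 Gg hg.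
    have: w ^+ 5 == w.
      rewrite -wg actN //; apply/eqP/conjg_fixP/commgP; exact: (centP cHw).
    by rewrite -[X in _ == X](mulg1 w) expgS (inj_eq (mulgI w)) wE.
  - case=> g Gg yg; apply: (y57 1%N g) => //; by right.
  by case=> g Gg yg; apply: (y57 5 g) => //; left.
pose T := (N <*> H)%G; pose M := [~: N, H]%G.
have sTG : T \subset G by rewrite join_subG sNG.
have sNT : N \subset T := joing_subl _ _; have sHT : H \subset T := joing_subr _ _.
have sMN : M \subset N by rewrite commg_subl.
have nMT : T \subset 'N(M) by rewrite join_subG commg_norml commg_normr.
have nsMT : M <| T by rewrite /normal (subset_trans sMN).
have abTM : abelian (T / M).
  have nMN := subset_trans sNT nMT; have nMH := subset_trans sHT nMT.
  have cHN : H / M \subset 'C(N / M) by rewrite quotient_cents2 // commGC.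
  by rewrite /= quotientY // abelianY cHN !quotient_abelian // cyclic_abelian.
have tiMw m : w ^+ m \in M -> 3 %| m.
  move=> Mw; rewrite -wE; apply/eqP/set1P; rewrite -[[set 1]]/(1 : {set gT}).
  have <- : 'C_M(H) = 1.
    apply: coprime_abel_cent_TI nNH _ abN.
    by have [n ->] := p_natP (abelem_pgroup abelN); rewrite oH coprimeXl.
  by rewrite inE Mw groupX.
have Ty : y \in T by rewrite groupM ?(subsetP sNT w) ?(subsetP sHT h).
have nMy : y \in 'N(M) := subsetP nMT y Ty.
have [j0 j0P] := cycle_faithful_irr (coset M y).
have sYT : <[coset M y]> \subset T / M by rewrite cycle_subG mem_quotient.
have [j1 Ind_j1] := constt_cfInd_irr j0 sYT.
have lin_j1 : ('chi_j1)%R \is a linear_char by move: (char_abelianP _ abTM j1).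
have Res_j1 : ('Res[<[coset M y]>] 'chi_j1 = 'chi_j0)%R.
  have /irrP[j Dj] := lin_char_irr (cfRes_lin_char <[coset M y]>%G lin_j1).
  move: Ind_j1; rewrite constt_Ind_Res Dj constt_irr inE => /eqP Ej.
  by rewrite Ej.
pose s := mod_Iirr j1; have sE : ('chi_s = ('chi_j1 %% M)%CF)%R by rewrite mod_IirrE.
have lin_s : ('chi_s)%R \is a linear_char by rewrite sE cfMod_lin_char.
have sP k l : ('chi_s (y ^+ k)%g = 'chi_s (y ^+ l)%g)%R -> y ^+ k * y ^- l \in M.
  rewrite sE !cfModE ?groupX // !morphX // => eq_kl.
  have: coset M y ^+ k = coset M y ^+ l by apply: j0P; rewrite -Res_j1 !cfResE ?mem_cycle.
  rewrite -!morphX // => eqM; apply: coset_idr; first by rewrite groupM ?groupV ?groupX.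
  by rewrite morphM ?morphV ?groupV ?groupX // eqM mulgV.
have [t tE] : exists t, ('Res[N] 'chi_s = 'chi_t)%R.
  by apply/irrP/lin_char_irr/cfRes_lin_char.
have linX m : y ^+ m \in N -> ('chi_t (y ^+ m)%g = 'chi_s (y ^+ m)%g)%R.
  by move=> Nm; rewrite -tE cfResE.
have lin_t : ('chi_t)%R \is a linear_char by rewrite -tE cfRes_lin_char.
have y4w : y ^+ 4 = w by have := y4 1%N; rewrite !expg1.
have y9h : y ^+ 9 = h by have := y9 1%N; rewrite !expg1.
have sTI : T \subset 'I_G[('chi_t)%R].
  apply/subsetP=> g Tg; rewrite inE (subsetP sTG) //= inE.
  rewrite (subsetP nNG) ?(subsetP sTG) //; apply/eqP/cfun_inP=> n Nn.
  have nNg : g \in 'N(N) by rewrite (subsetP nNG) ?(subsetP sTG).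
  rewrite cfConjgE // -tE !cfResE ?memJ_norm ?groupV // cfunJ ?groupV //.
have stabH a : a \in A -> a \in 'I[('chi_t)%R] -> a \in H.
  rewrite -mulRH => /mulsgP[x b Rx Hb ->] stab_a.
  have stab_b : b \in 'I[('chi_t)%R].
    by have := subsetP sTI b (subsetP sHT b Hb); case/setIP.
  rewrite groupMr // in stab_a.
  suffices -> : x = 1 by rewrite mul1g.
  apply/eqP; apply: contraT => ntx; have Rx1 : x \in R^# by rewrite !inE ntx.
  suffices : ('chi_t w = 1)%R.
    rewrite -y4w linX ?y4w // -y4w -(lin_char1 lin_s) -(expg0 y) => /sP.
    by rewrite expg0 invg1 mulg1 y4w -[w]expg1 => /tiMw.
  have : w \in N by []; rewrite -{1}(regular_commutators nNR regR Rx1).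
  case/imsetP=> n Nn ->; rewrite lin_charM ?groupV ?memJ_norm ?(subsetP nNR) //.
  by rewrite (inertia_valJ _ stab_a) -lin_charM ?groupV // mulVg lin_char1.
have defT : T :=: 'I_G[('chi_t)%R].
  apply/eqP; rewrite eqEsubset sTI; apply/subsetP=> g /setIP[Gg].
  rewrite -mulNA in Gg; case/mulsgP: Gg => n a Nn Aa ->.
  rewrite (groupMl _ (subsetP (sub_inertia _) n Nn)) => stab_a; have Ha := stabH a Aa stab_a.
  by rewrite groupM ?(subsetP sNT n) ?(subsetP sHT a).
have [u1 u1E] := @Qn_aut_exists 5 12 isT; have [u2 u2E] := @Qn_aut_exists 7 12 isT.
have valN n : n \in N -> ('chi_t n ^+ 3 = 1)%R.
  move=> Nn; rewrite -lin_charX //.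
  by have [_ /(_ n Nn) ->] := abelemP (isT : prime 3) abelN; rewrite lin_char1.
have u2t : (cfAut u2 'chi_t = 'chi_t)%R.
  apply/cfun_inP=> n Nn; rewrite cfunE u2E; last by rewrite (exprM _ 3 4) valN // expr1n.
  by rewrite (exprD _ 6 1) (exprM _ 3 2) valN // expr1n mul1r expr1.
have [u2s | [g Gg u1t]] := quadratic_inertia_extension u1 quadG nsNG defT tE u2t.
  have: ('chi_s (y ^+ 63)%g = 'chi_s (y ^+ 9)%g)%R.
    rewrite -[63]/(9 * 7)%N expgM lin_charX ?groupX // -u2E; last first.
      by rewrite -lin_charX ?groupX // y9h -[12]/(4 * 3)%N expgM -{1}oh expg_order expg1n lin_char1.
    by have := congr1 (fun f : 'CF(T) => f (y ^+ 9)) u2s; rewrite cfunE.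
  move/sP; rewrite -[63]/(54 + 9)%N expgD mulgK -[54]/(6 * 9)%N expgM y9 => /(subsetP sMN) Nh6.
  have: h ^+ 6 \in N :&: H by rewrite inE Nh6 groupX.
  by rewrite tiNH => /set1P/eqP; rewrite hE.
have nNg := subsetP nNG g Gg; have nNhg : h ^ g \in 'N(N) by rewrite (subsetP nNG) ?groupJ ?(subsetP sHG h).
have stab_h : h \in 'I[('chi_t)%R] by have := subsetP sTI h (subsetP sHT h Hh); case/setIP.
have stab_hg : h ^ g \in 'I[('chi_t)%R].
  rewrite inE nNhg; apply/eqP/cfun_inP=> n Nn; apply: (fmorph_inj u1).
  have u1E1 m : m \in N -> (u1 ('chi_t m) = 'chi_t (m ^ g^-1)%g)%R.
    by move=> Nm; have := congr1 (fun f : 'CF(N) => f m) u1t; rewrite cfunE cfConjgE.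
  rewrite cfConjgE // !u1E1 ?memJ_norm ?groupV // -conjgM.
  have -> : (h ^ g)^-1 * g^-1 = g^-1 * h^-1 by rewrite [RHS]conjgCV invgK conjVg.
  by rewrite conjgM inertia_valJ // groupV.
have Tg : g \in T.
  move: Gg stab_hg; rewrite -mulNA => /mulsgP[n a Nn Aa ->].
  rewrite conjgM (conjg_mulR h n) conjMg groupMr => [stab_ha|]; last first.
    by apply: (subsetP (sub_inertia _)); rewrite memJ_norm ?hN // (subsetP nNA).
  rewrite groupM ?(subsetP sNT n) // (subsetP sHT a) // hJ // stabH // groupJ // (subsetP sHA h) //.
have: ('chi_s (y ^+ 20)%g = 'chi_s (y ^+ 4)%g)%R.
  rewrite -[20]/(4 * 5)%N expgM lin_charX ?groupX // -u1E; last first.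
    by rewrite -lin_charX ?groupX // y4w -[12]/(3 * 4)%N expgM -{1}ow expg_order expg1n lin_char1.
  rewrite -linX ?y4w //; have := congr1 (fun f : 'CF(N) => f w) u1t.
  by rewrite cfunE => ->; rewrite inertiaJ //; move: Tg; rewrite defT => /setIP[].
move/sP; rewrite -[20]/(16 + 4)%N expgD mulgK -[16]/(4 * 4)%N expgM y4.
by move/tiMw.
Qed.

Lemma tower_compl4_p' gT (G N A R H : {group gT}) :
  Frobenius_tower G N A R H -> quadratic_group G -> #|H| = 4 -> 3 \notin \pi(N).
Proof.
move=> tower quadG oH; apply/negP=> /(tower_abelem tower quadG).
case=> rT [G1 [N1 [A1 [R1 [H1 [tower1 quadG1 abelN1 _ oH1]]]]]].
by case: (tower_compl4 tower1 quadG1 abelN1); rewrite oH1.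
Qed.

(** * The Fitting subgroup and the Gruenberg-Kegel graph *)

Section TowerStructure.

Variables (gT : finGroupType) (G N A R H : {group gT}).
Hypothesis tower : Frobenius_tower G N A R H.

(** If R were contained in F(G), it would centralise N, as their orders are coprime;
    but R acts freely on N.
    Hence R meets F(G) :&: A trivially; the latter is normalised by R and normalises R, so
    it centralises R, and therefore is contained in R. *)
Lemma tower_Fitting : N :=: 'F(G).
Proof.
have [coNR fixR] := tower_coprime tower.
have [defG nilN ntN frobA _ pr_R _ _ _ _] := tower.
have [nsNG sAG mulNA nNA tiNA] := sdprod_context defG.
have [defA ntR ntH ltRA ltHA] := Frobenius_context frobA.
have [nsRA sHA mulRH nRH tiRH] := sdprod_context defA.
have sNF : N \subset 'F(G) := Fitting_max nsNG nilN.
pose K := (A :&: 'F(G))%G.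
have defF : N * K = 'F(G) by rewrite /K /= group_modl //= mulNA (setIidPr (Fitting_sub G)).
suffices K1 : K :=: 1 by rewrite -defF K1 mulg1.
have nKR : R \subset 'N(K).
  have sRA := normal_sub nsRA.
  apply: normsI; first by rewrite (subset_trans sRA) ?normG.
  exact: subset_trans sRA (subset_trans sAG (normal_norm (Fitting_normal G))).
have [sRK | ] := boolP (R \subset K).
  case/eqP: ntN; rewrite -fixR; apply/esym/setIidPl; rewrite centsC.
  apply: sub_nilpotent_cent2 (Fitting_nil G) sNF _ coNR.
  by apply: subset_trans sRK _; rewrite subsetIr.
move/(prime_TIg pr_R)=> tiRK.
have cRK : K \subset 'C(R).
  apply/commG1P/trivgP; rewrite -tiRK subsetI commg_subl nKR andbT commg_subr.
  by rewrite (subset_trans (subsetIl _ _)) ?normal_norm.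
apply/trivgP; rewrite -tiRK subsetI subxx andbT.
have [x Rx ntx] := trivgPn _ ntR.
apply: subset_trans (Frobenius_cent1_ker frobA (x := x) _); last by rewrite !inE ntx.
by rewrite subsetI subsetIl -cent_cycle (subset_trans cRK) // centS // cycle_subG.
Qed.

Lemma tower_quotient_Frobenius : Frobenius_cyclic (G / N) #|R| #|H|.
Proof.
have [defG _ _ frobA _ pr_R cycH _ _ _] := tower.
have [nsNG sAG mulNA nNA tiNA] := sdprod_context defG.
have [defA ntR ntH ltRA ltHA] := Frobenius_context frobA.
have [nsRA sHA mulRH nRH tiRH] := sdprod_context defA.
have sRA := normal_sub nsRA.
have [f injf fE] := quotient_TI_injm nNA tiNA.
have oE (X : {group gT}) : X \subset A -> #|X / N| = #|X|.
  by move=> sXA; rewrite -fE // card_injm.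
exists (R / N)%G, (H / N)%G; rewrite !oE //; split=> //.
- have := injm_Frobenius (subxx A) injf frobA; rewrite !fE //.
  by have -> : A / N = G / N by rewrite -mulNA quotientMidl.
- by rewrite quotient_cyclic ?prime_cyclic.
exact: quotient_cyclic.
Qed.

Lemma tower_pi p :
  (p \in \pi(G)) = [|| p \in \pi(N), p == #|R| | p \in \pi(#|H|)].
Proof.
have [defG _ _ frobA _ pr_R _ _ _ _] := tower.
have [defA _ _ _ _] := Frobenius_context frobA.
rewrite -[LHS]/(p \in primes #|G|) -(sdprod_card defG) -(sdprod_card defA).
by rewrite !primesM ?muln_gt0 ?cardG_gt0 // (primes_prime pr_R) mem_seq1.
Qed.

(** If n * a centralises x, with n in N and a in A, then a centralises x modulo N, so a
    centralises x and lies in R.  As R is abelian, n also centralises x. *)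
Lemma tower_kernel_cent1 x : x \in R^# -> 'C_G[x] \subset R.
Proof.
move=> Rx; have [defG _ _ frobA regR pr_R _ _ _ _] := tower.
have [nsNG sAG mulNA nNA tiNA] := sdprod_context defG.
have [defA ntR ntH ltRA ltHA] := Frobenius_context frobA.
have [nsRA sHA mulRH nRH tiRH] := sdprod_context defA.
have [ntx R_x] := setD1P Rx; have Ax := subsetP (normal_sub nsRA) x R_x.
apply/subsetP=> y /setIP[]; rewrite -mulNA => /mulsgP[n a Nn Aa ->] cx.
have {cx} xna : (x ^ n) ^ a = x.
  by rewrite -conjgM; apply/conjg_fixP/commgP/cent1P; rewrite cent1C.
have xn : [~ x, n] \in N by rewrite commgEr groupM // memJ_norm ?groupV // (subsetP nNA).
have xa : x ^ a = x.
  apply/eqP; rewrite eq_mulVg1; apply/eqP/set1P; rewrite -[[set 1]]/(1 : {set gT}) -tiNA.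
  apply/setIP; split; last by rewrite groupM ?groupV ?groupJ.
  by rewrite -{2}xna (conjg_mulR x n) conjMg mulKg memJ_norm // (subsetP nNA).
have Ra : a \in R.
  apply: (subsetP (Frobenius_cent1_ker frobA Rx)); rewrite inE Aa.
  by apply/cent1P/commute_sym/commgP/conjg_fixP.
have xn1 : x ^ n = x.
  by apply: (conjg_inj a); rewrite xna xa.
suffices /set1P-> : n \in [set 1] by rewrite mul1g.
rewrite -[[set 1]]/(1 : {set gT}) -(regR x Rx) inE Nn.
by apply/cent1P/commute_sym/commgP/conjg_fixP.
Qed.

(** R is a Sylow subgroup, so the power of x of order #|R| can be conjugated into R; by
    [tower_kernel_cent1] the corresponding conjugate of x lies in R. *)
Lemma tower_kernel_isolated q x :
  prime q -> x \in G -> #[x] <> (#|R| * q)%N.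
Proof.
move=> pr_q Gx ox; have [coNR _] := tower_coprime tower.
have [defG _ _ frobA _ pr_R _ _ _ _] := tower.
have [nsNG sAG mulNA nNA tiNA] := sdprod_context defG.
have [defA ntR ntH ltRA ltHA] := Frobenius_context frobA.
have [nsRA sHA mulRH nRH tiRH] := sdprod_context defA.
have sylR : #|R|.-Sylow(G) R.
  rewrite pHallE (subset_trans (normal_sub nsRA)) //=.
  rewrite -(sdprod_card defG) -(sdprod_card defA) !partnM ?muln_gt0 ?cardG_gt0 //.
  have r'N : #|R|^'.-nat #|N| by rewrite p'natE // -prime_coprime // coprime_sym.
  have r'H : #|R|^'.-nat #|H|.
    by rewrite p'natE // -prime_coprime // (Frobenius_coprime frobA).
  by rewrite (part_p'nat r'N) (part_p'nat r'H) part_pnat_id ?pnat_id // mul1n muln1.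
have oy : #[x ^+ q] = #|R| by rewrite orderXdiv ox ?dvdn_mull // mulnK ?prime_gt0.
have [g Gg sYR] : exists2 g, g \in G & <[x ^+ q]> \subset R :^ g.
  apply: Sylow_subJ sylR _ _; first by rewrite cycle_subG groupX.
  by rewrite /pgroup -orderE oy pnat_id.
have Ry : (x ^+ q) ^ g^-1 \in R^#.
  rewrite !inE conjg_eq1 -order_gt1 oy prime_gt1 //= -mem_conjg.
  by rewrite -cycle_subG.
have: x ^ g^-1 \in R.
  apply: (subsetP (tower_kernel_cent1 Ry)); rewrite inE groupJ ?groupV //=.
  by apply/cent1P; rewrite conjXg; apply: commuteX.
move/order_dvdG; rewrite orderJ ox => /dvdn_leq; rewrite cardG_gt0 => /(_ isT).
by rewrite -{2}[#|R|]muln1 leq_pmul2l ?cardG_gt0 // leqNgt prime_gt1.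
Qed.

(** Apply [Frobenius_compl_fix] to the elementary abelian group Ohm_1(Z(O_p(N))). *)
Lemma tower_fixed_point p : p \in \pi(N) -> exists2 w, w \in 'C_N(H) & #[w] = p.
Proof.
move=> pN; have pr_p : prime p by move: pN; rewrite mem_primes => /andP[].
have [coNR fixR] := tower_coprime tower.
have [defG nilN _ frobA _ _ _ _ _ _] := tower.
have [nsNG sAG mulNA nNA tiNA] := sdprod_context defG.
pose P := 'O_p(N)%G; pose Z := 'Ohm_1('Z(P))%G.
have pP : p.-group P := pcore_pgroup p N.
have sPN : P \subset N := pcore_sub p N.
have ntP : P :!=: 1.
  apply: contraTneq pN => P1; have := nilpotent_pcore_Hall p nilN.
  by move/card_Hall; rewrite -/P P1 cards1 => /esym/eqP; rewrite p_part_eq1.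
have ntZ : Z :!=: 1.
  by rewrite Ohm1_eq1; apply: contra ntP => /eqP/(trivg_center_pgroup pP)/eqP.
have chZ : Z \char N.
  by rewrite (char_trans (Ohm_char 1 _)) // (char_trans (center_char _)) ?pcore_char.
have sZN := char_sub chZ.
have abelZ : p.-abelem Z.
  by rewrite Ohm1_abelem ?center_abelian // (pgroupS (center_sub _)).
have nZA : A \subset 'N(Z) := char_norm_trans chZ nNA.
have /trivgPn[w /setIP[Zw cHw] ntw] : 'C_Z(H) != 1.
  apply: contraNneq ntZ => fixH; apply/eqP.
  apply: Frobenius_compl_fix frobA (abelem_abelian abelZ) nZA _ _ fixH.
    exact: coprimeSg sZN coNR.
  by apply/trivgP; rewrite -fixR setSI.
by exists w; rewrite ?inE ?(subsetP sZN) // (abelem_order_p abelZ).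
Qed.

Lemma tower_mixed_order p q :
    p \in \pi(N) -> prime q -> q %| #|H| -> p != q ->
  exists2 x, x \in G & #[x] = (p * q)%N.
Proof.
move=> pN pr_q q_dv_H neq_pq; have pr_p : prime p by move: pN; rewrite mem_primes => /andP[].
have [w /setIP[Nw cHw] ow] := tower_fixed_point pN.
have [t Ht ot] := Cauchy pr_q q_dv_H.
have [defG _ _ frobA _ _ _ _ _ _] := tower.
have [nsNG sAG _ _ _] := sdprod_context defG.
have [defA _ _ _ _] := Frobenius_context frobA.
have [_ sHA _ _ _] := sdprod_context defA.
exists (w * t); first by rewrite groupM ?(subsetP (normal_sub nsNG) w) ?(subsetP sAG t) ?(subsetP sHA t).
rewrite orderM ?ow ?ot //; first exact: (centP cHw).
by rewrite prime_coprime // dvdn_prime2.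
Qed.

Lemma tower_graph q :
  (forall p, p \in \pi(G) -> p = q \/ p = #|R|) -> q \in \pi(G) ->
  GK_graph_is G [:: q; #|R|] [::].
Proof.
move=> piG qG; have pr_R := tower_prime tower.
have RG : #|R| \in \pi(G) by rewrite tower_pi eqxx orbT.
split=> [p | p1 p2].
  rewrite !inE; split; first by case/piG=> ->; rewrite eqxx ?orbT.
  by case/orP=> /eqP->.
split=> [[p1G p2G neq12 [x Gx ox]] | [] //].
have [pr1 pr2] : prime p1 /\ prime p2.
  by split; [move: p1G | move: p2G]; rewrite mem_primes => /andP[].
have [/piG[] E1 /piG[] E2] := (p1G, p2G); subst p1 p2 => //.
  by case: (tower_kernel_isolated pr1 Gx); rewrite ox mulnC.
by case: (tower_kernel_isolated pr2 Gx).
Qed.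

Lemma tower_graph_edge :
  (forall p, p \in \pi(G) <-> p \in [:: 2; 3; #|R|]) ->
  (exists2 x, x \in G & #[x] = 6) ->
  GK_graph_is G [:: 2; 3; #|R|] [:: (2, 3)].
Proof.
move=> piG [x6 Gx6 ox6]; split=> // p1 p2; split; last first.
  have piP p : p \in [:: 2; 3] -> p \in \pi(G).
    by rewrite !inE => p23; apply/piG; rewrite !inE orbA p23.
  rewrite !inE => -[/eqP[-> ->]|/eqP[-> ->]]; split; rewrite ?piP //; exists x6; rewrite ?ox6 //.
case=> p1G p2G neq12 [x Gx ox].
have [pr1 pr2] : prime p1 /\ prime p2.
  by split; [move: p1G | move: p2G]; rewrite mem_primes => /andP[].
have [/piG + /piG] := (p1G, p2G); rewrite !inE => + /or3P E2.
case/or3P=> /eqP E1; case: E2 => /eqP E2; rewrite ?E1 ?E2 ?eqxx; auto; subst => //.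
- by case: (tower_kernel_isolated pr1 Gx); rewrite ox mulnC.
- by case: (tower_kernel_isolated pr1 Gx); rewrite ox mulnC.
- by case: (tower_kernel_isolated pr2 Gx).
by case: (tower_kernel_isolated pr2 Gx).
Qed.

End TowerStructure.

Theorem theorem2p2 (gT : finGroupType) (G : {group gT}) :
  two_Frobenius G ->
  character_quadratic G \/ semi_rational G ->
  (forall p : nat, p \in \pi('F(G)) -> p \in [:: 2; 3]) /\
  ( (* a *) (Frobenius_cyclic (G / 'F(G)) 3 2 /\ 2.-group 'F(G) /\
             GK_graph_is G [:: 2; 3] [::])
 \/ (* b *) (Frobenius_cyclic (G / 'F(G)) 5 2 /\ 3 %| #|'F(G)| /\
             GK_graph_is G [:: 2; 3; 5] [:: (2, 3)])
 \/ (* c *) (Frobenius_cyclic (G / 'F(G)) 5 2 /\ 2.-group 'F(G) /\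
             GK_graph_is G [:: 2; 5] [::])
 \/ (* d *) (Frobenius_cyclic (G / 'F(G)) 5 4 /\ 2.-group 'F(G) /\
             GK_graph_is G [:: 2; 5] [::])
 \/ (* e *) (Frobenius_cyclic (G / 'F(G)) 7 3 /\ 2 %| #|'F(G)| /\
             GK_graph_is G [:: 2; 3; 7] [:: (2, 3)])
 \/ (* f *) (Frobenius_cyclic (G / 'F(G)) 7 3 /\ 3.-group 'F(G) /\
             GK_graph_is G [:: 3; 7] [::])
 \/ (* g *) (Frobenius_cyclic (G / 'F(G)) 7 6 /\
             GK_graph_is G [:: 2; 3; 7] [:: (2, 3)])
 \/ (* h *) (Frobenius_cyclic (G / 'F(G)) 13 6 /\
             GK_graph_is G [:: 2; 3; 13] [:: (2, 3)])).
Proof.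
move=> frobG /quadratic_group_of quadG.
have [N [A [R [H tower]]]] := two_Frobenius_tower frobG quadG.
have defN : N = 'F(G)%G by apply/group_inj/(tower_Fitting tower).
have piN p : p \in \pi(N) -> p \in [:: 2; 3] := tower_primes tower quadG.
have [coNR _] := tower_coprime tower.
have r'N : #|R| \notin \pi(N).
  by rewrite mem_primes cardG_gt0 (tower_prime tower) /= -prime_coprime ?(tower_prime tower) // coprime_sym.
have frobGN := tower_quotient_Frobenius tower.
have piG := tower_pi tower; have graph := tower_graph tower.
have edge := tower_graph_edge tower; have mixed := tower_mixed_order tower.
have pN q : (forall p, p \in \pi(N) -> p = q) -> q.-group N.
  move=> piNq; apply/pgroupP=> p pr_p p_dv; rewrite inE /=; apply/eqP/piNq.
  by rewrite mem_primes pr_p cardG_gt0.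
have compl4 : #|H| = 4 -> 3 \notin \pi(N) := tower_compl4_p' tower quadG.
have cycH := tower_cyclic tower.
have sHG : H \subset G.
  have [_ sAG _ _ _] := sdprod_context (tower_sdprod tower).
  have [defA _ _ _ _] := Frobenius_context (tower_Frobenius tower).
  by have [_ sHA _ _ _] := sdprod_context defA; apply: subset_trans sAG.
have dvN p : p \in \pi(N) -> p %| #|N| by rewrite mem_primes => /and3P[].
have gen6 : #|H| = 6 -> exists2 x, x \in G & #[x] = 6.
  have [x defH] := cyclicP cycH; move=> oH; exists x; last by rewrite orderE -defH.
  by rewrite (subsetP sHG) // defH cycle_id.
have cases := tower_cases tower.
rewrite -(congr1 (@gval gT) defN) /= -/N; split=> //.
move: cases; rewrite 6!inE => cases.
have piN2 : 3 \notin \pi(N) -> forall p, p \in \pi(N) -> p = 2.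
  move=> N'3 p pNp; have := piN p pNp; rewrite !inE => /orP[]/eqP // p3.
  by rewrite p3 (negPf N'3) in pNp.
have piN3 : 2 \notin \pi(N) -> forall p, p \in \pi(N) -> p = 3.
  move=> N'2 p pNp; have := piN p pNp; rewrite !inE => /orP[]/eqP // p2.
  by rewrite p2 (negPf N'2) in pNp.
move: piG graph edge mixed compl4 gen6 frobGN r'N.
case/or4P: cases => [/eqP[-> ->] | /eqP[-> ->] | /eqP[-> ->] | /or3P[]/eqP[-> ->]];
  move=> piG graph edge mixed compl4 gen6 frobGN r'N.
- have {}piG p : (p \in \pi(G)) = [|| p \in \pi(N), p == 3 | p \in [:: 2]] := piG p.
  left; split=> //; have piN2' := piN2 r'N; split; first exact: pN.
  apply: graph; last by rewrite piG mem_seq1 eqxx !orbT.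
  move=> p; rewrite piG mem_seq1.
  by case/or3P=> [/piN2' | /eqP | /eqP]; [left | right | left].
- have {}piG p : (p \in \pi(G)) = [|| p \in \pi(N), p == 5 | p \in [:: 2]] := piG p.
  right; have [N3 | N'3] := boolP (3 \in \pi(N)); [left | right; left]; split=> //.
    split; first exact: dvN; apply: edge; last exact: (mixed 3 2).
    move=> p; rewrite piG !inE; split; last by case/or3P=> /eqP->; rewrite ?N3 ?eqxx ?orbT.
    by case/or3P=> [/piN | /eqP-> | /eqP->] //; rewrite !inE => /orP[]/eqP->.
  have piN2' := piN2 N'3; split; first exact: pN.
  apply: graph; last by rewrite piG mem_seq1 eqxx !orbT.
  move=> p; rewrite piG mem_seq1.
  by case/or3P=> [/piN2' | /eqP | /eqP]; [left | right | left].
- have {}piG p : (p \in \pi(G)) = [|| p \in \pi(N), p == 5 | p \in [:: 2]] := piG p.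
  have piN2' := piN2 (compl4 (erefl 4)).
  do 3 right; left; split=> //; split; first exact: pN.
  apply: graph; last by rewrite piG mem_seq1 eqxx !orbT.
  move=> p; rewrite piG mem_seq1.
  by case/or3P=> [/piN2' | /eqP | /eqP]; [left | right | left].
- have {}piG p : (p \in \pi(G)) = [|| p \in \pi(N), p == 7 | p \in [:: 3]] := piG p.
  do 4 right; have [N2 | N'2] := boolP (2 \in \pi(N)); [left | right; left]; split=> //.
    split; first exact: dvN; apply: edge; last exact: (mixed 2 3).
    move=> p; rewrite piG !inE; split; last by case/or3P=> /eqP->; rewrite ?N2 ?eqxx ?orbT.
    by case/or3P=> [/piN | /eqP-> | /eqP->] //; rewrite !inE => /orP[]/eqP->.
  have piN3' := piN3 N'2; split; first exact: pN.
  apply: graph; last by rewrite piG mem_seq1 eqxx !orbT.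
  move=> p; rewrite piG mem_seq1.
  by case/or3P=> [/piN3' | /eqP | /eqP]; [left | right | left].
- have {}piG p : (p \in \pi(G)) = [|| p \in \pi(N), p == 7 | p \in [:: 2; 3]] := piG p.
  do 6 right; left; split=> //; apply: edge; last exact: gen6.
  move=> p; rewrite piG !inE; split; last by case/or3P=> /eqP->; rewrite ?eqxx ?orbT.
  by case/or3P=> [/piN | /eqP-> | ]; rewrite ?inE // => /orP[]/eqP->.
have {}piG p : (p \in \pi(G)) = [|| p \in \pi(N), p == 13 | p \in [:: 2; 3]] := piG p.
do 7 right; split=> //; apply: edge; last exact: gen6.
move=> p; rewrite piG !inE; split; last by case/or3P=> /eqP->; rewrite ?eqxx ?orbT.
by case/or3P=> [/piN | /eqP-> | ]; rewrite ?inE // => /orP[]/eqP->.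
Qed.
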